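(* Every conformal class of the torus can be realized by a constrained Willmore immersion into the round 3-sphere: for every lattice $\Lambda\subset\mathbb{C}$ there exists a conformal immersion $f:\mathbb{C}/\Lambda\to S^3$ which is constrained Willmore.
   Context: For an immersion $f:M\to S^3$ of a compact oriented surface into the round unit 3-sphere, the Willmore energy is $\mathcal{W}(f)=\int_M (H^2+1)\,dA$, where $H$ is the mean curvature and $dA$ the induced area form. A conformal immersion $f$ of a compact Riemann surface $M$ is called constrained Willmore if it is a critical point of $\mathcal{W}$ under conformal variations, i.e. under variations through immersions that are conformal with respect to the fixed Riemann surface structure. *)

(* Defs.v *)
From HB Require Import structures.
From mathcomp Require Import all_boot all_order all_algebra.
From mathcomp Require Import all_classical all_reals all_analysis.
Import Order.TTheory GRing.Theory Num.Theory numFieldNormedType.Exports.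

Set Implicit Arguments.
Unset Strict Implicit.
Unset Printing Implicit Defensive.

Local Open Scope classical_set_scope.
Local Open Scope ring_scope.

(* The complex line is used through its underlying real plane R * R, with
   (x, y) standing for x + i y; its complex structure only matters through the
   flat conformal structure [|dz|^2].  A map on the torus C / Lambda is a
   Lambda-periodic map on the plane. *)

Section Smooth.
Context {R : realType} {V W : normedModType R}.

(* Meant for finite-dimensional V and open U, where 'D_v f on U depends only on
   the values of f on U. *)
Fixpoint Ck (U : set V) (k : nat) (f : V -> W) : Prop :=
  match k with
  | 0 => forall x, U x -> {for x, continuous f}
  | k'.+1 => (forall x, U x -> differentiable f x) /\
             (forall v, Ck U k' (fun x => 'D_v f x))
  end.

Definition smooth_on (U : set V) (f : V -> W) : Prop := forall k, Ck U k f.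

End Smooth.

Section Lattice.
Context {R : realType}.

Definition det2 (w1 w2 : R * R) : R := w1.1 * w2.2 - w1.2 * w2.1.

Definition R_independent (w1 w2 : R * R) : Prop := det2 w1 w2 != 0.

Definition lattice (w1 w2 : R * R) : set (R * R) :=
  [set z | exists m n : int, z = w1 *~ m + w2 *~ n].

Definition periodic (T : Type) (L : set (R * R)) (f : R * R -> T) : Prop :=
  forall z l, L l -> f (z + l) = f z.

(* Integral over C / (Z w1 + Z w2) of a periodic density with respect to
   dx dy: the fundamental parallelogram is parametrised by
   (s, t) |-> s w1 + t w2 on the unit square, with Jacobian |det2 w1 w2|. *)
Definition torus_integral (w1 w2 : R * R) (h : R * R -> R) : R :=
  \int[(lebesgue_measure \x lebesgue_measure)%E]_(p in `[0, 1] `*` `[0, 1])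
    (h (p.1 *: w1 + p.2 *: w2) * `|det2 w1 w2|).

End Lattice.

Section Geometry.
Context {R : realType}.
Implicit Types (f : R * R -> 'rV[R]_4) (z : R * R).

(* The library norm on row vectors is the sup norm, so the Euclidean structure
   of R^4 is given separately. *)
Definition dot (u v : 'rV[R]_4) : R := \sum_i u 0 i * v 0 i.

Definition S3 : set 'rV[R]_4 := [set u | dot u u = 1].

(* Triple cross product in R^4: dot (cross3 a b c) d is the determinant of the
   matrix with rows a, b, c, d. *)
Definition cross3 (a b c : 'rV[R]_4) : 'rV[R]_4 :=
  \row_j \det (\matrix_(i < 4, k < 4)
                 (nth 0 [:: a; b; c; delta_mx 0 j] i) 0 k).

Definition dx f z : 'rV[R]_4 := 'D_((1, 0) : R * R) f z.
Definition dy f z : 'rV[R]_4 := 'D_((0, 1) : R * R) f z.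

Definition gE f z : R := dot (dx f z) (dx f z).
Definition gF f z : R := dot (dx f z) (dy f z).
Definition gG f z : R := dot (dy f z) (dy f z).

Definition area_density f z : R :=
  Num.sqrt (gE f z * gG f z - gF f z ^+ 2).

(* Unit normal of f inside S^3: orthogonal to f, f_x and f_y. *)
Definition unit_normal f z : 'rV[R]_4 :=
  let n := cross3 (f z) (dx f z) (dy f z) in (Num.sqrt (dot n n))^-1 *: n.

(* Second fundamental form in S^3.  The ambient R^4 derivatives may be used
   because the S^3-normal component f of the acceleration is orthogonal to
   unit_normal. *)
Definition hL f z : R := dot (dx (dx f) z) (unit_normal f z).
Definition hM f z : R := dot (dy (dx f) z) (unit_normal f z).
Definition hN f z : R := dot (dy (dy f) z) (unit_normal f z).

(* Half the trace of the second fundamental form with respect to the induced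
   metric. *)
Definition mean_curvature f z : R :=
  (gE f z * hN f z - 2 * gF f z * hM f z + gG f z * hL f z) /
  (2 * (gE f z * gG f z - gF f z ^+ 2)).

Definition willmore (w1 w2 : R * R) f : R :=
  torus_integral w1 w2
    (fun z => (mean_curvature f z ^+ 2 + 1) * area_density f z).

Definition torus_immersion (w1 w2 : R * R) f : Prop :=
  [/\ periodic (lattice w1 w2) f,
      forall z, S3 (f z),
      smooth_on setT f &
      forall z (v : R * R), 'D_v f z = 0 -> v = 0].

Definition conformal f : Prop :=
  forall z, exists2 rho : R, 0 < rho &
    forall v w : R * R,
      dot ('D_v f z) ('D_w f z) = rho * (v.1 * w.1 + v.2 * w.2).

Definition conformal_immersion (w1 w2 : R * R) f : Prop :=
  torus_immersion w1 w2 f /\ conformal f.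

Definition conformal_variation (w1 w2 : R * R) f (eps : R)
    (F : R -> R * R -> 'rV[R]_4) : Prop :=
  [/\ 0 < eps,
      smooth_on [set p : R * (R * R) | `|p.1| < eps] (fun p => F p.1 p.2),
      forall t, `|t| < eps -> conformal_immersion w1 w2 (F t) &
      F 0 = f].

Definition constrained_willmore (w1 w2 : R * R) f : Prop :=
  forall eps F, conformal_variation w1 w2 f eps F ->
    is_derive (0 : R) (1 : R) (fun t : R => willmore w1 w2 (F t)) 0.

End Geometry.

(* Main.v *)
(* Every conformal class is realized by a Hopf torus [f (x, y) = exp (i y) c (x)],
   with [c] the horizontal lift to S^3 in C^2 of a curve in S^2, that is
   [c'' = - c + i k c'].  Such an [f] is an isometric immersion of the plane.

   First variation.  On conformal immersions the Willmore integrand is a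
   function of the Laplacian alone (a Gram determinant computation).  For a
   conformal variation [f + G] the difference of the energies is, up to an
   error quadratic in [G], the integral of an exact divergence as soon as
   [k'' + k ^ 3 / 2 + al k + be = 0]: the Lagrange multipliers of the conformal
   constraints are the constants [al] and [be].  Expanding the constraints
   exactly avoids any differentiation under the integral sign.

   Closing the curve.  The solutions [k = m + h sin u], with
   [u' = sqrt ((2 m + h sin u) ^ 2 + d) / 2], lift explicitly to S^3.  Over one
   period of length [T], let [Phi] be the integral of [k] and [theta] the angle
   of rotation of the spherical curve.  The torus has a prescribed conformal
   class if [T] and [Phi] have prescribed values and [theta] is a rational
   multiple of [2 pi].  The first two conditions leave a one-parameter family,
   which joins a circle with [theta ^ 2 = 4 T ^ 2 + Phi ^ 2] to a curve with
   [theta ^ 2 = 4 T ^ 2 + (4 pi - Phi) ^ 2]; as [theta] varies continuously and is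
   not constant, it takes such a value. *)
Require Import Defs.
From HB Require Import structures.
From mathcomp Require Import all_boot all_order all_algebra.
From mathcomp Require Import all_classical all_reals all_analysis.
From mathcomp Require Import ring lra.
Import Order.TTheory GRing.Theory Num.Theory numFieldNormedType.Exports.
Set Implicit Arguments.
Unset Strict Implicit.
Unset Printing Implicit Defensive.
Local Open Scope classical_set_scope.
Local Open Scope ring_scope.

(** * Integrals over a fundamental domain *)

(** The immersion may be a multiple cover: the direction [w1] runs [j * N] times around the Hopf
    fibre. The factor [N] makes the period of the curvature long, hence the curvature small; the
    factor [j] clears denominators, so that closing becomes a matter of rationality. [Phi] is then
    not dictated by the lattice but can be picked in a dense set, and a short interval below [2 pi]
    is enough.

    Small curvature matters because the lift is written in polar coordinates about the axis of the
    curve: while [elastic_e] is positive, the curve avoids both poles and an arctangent yields a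
    global periodic phase.

    Where [d = 0], the quartic for [k' ^ 2] has the double root [- m] and the integrals become
    elementary up to exact derivatives; this is how [theta] is known at the second end of the
    family.

    In the first variation, conformality is a pair of exact quadratic equations for the increment,
    so any multiple of their linear parts can be added at second-order cost. Besides the constants,
    multipliers depending on [k] are needed to reach a divergence. *)

Section Square.
Context {R : realType}.
Notation mu := (@lebesgue_measure R).

(** The product sigma-algebra only knows rectangles; second countability bridges the gap, since an
    open set is the union of the rational open boxes inside it. *)
Lemma open_measurable_prod (U : set (R * R)) : open U ->
  measurable (U : set (measurableTypeR R * measurableTypeR R)).
Proof.
move=> oU.
pose box (q : (rat * rat) * (rat * rat)) : set (R * R) :=
  `]ratr q.1.1, ratr q.1.2[ `*` `]ratr q.2.1, ratr q.2.2[.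
have -> : U = \bigcup_q (if `[< box q `<=` U >] then box q else set0).
  apply/seteqP; split => [z Uz|z [q _]]; last first.
    by case: ifP => // /asboolP + zq; apply.
  have /nbhs_ballP[e /= e0 zeU] := oU _ Uz.
  have near (a : R) : exists q : rat * rat,
      [/\ a - e < ratr q.1, ratr q.1 < a, a < ratr q.2 & ratr q.2 < a + e].
    have [|p] := @rat_in_itvoo _ (a - e) a; first by rewrite ltrBlDr ltrDl.
    have [|q] := @rat_in_itvoo _ a (a + e); first by rewrite ltrDl.
    by rewrite !in_itv/= => /andP[? ?] /andP[? ?]; exists (p, q).
  have [p [p1 p2 p3 p4]] := near z.1; have [q [q1 q2 q3 q4]] := near z.2.
  exists (p, q) => //; case: ifPn => [_|/negP].
    by split; rewrite /= in_itv/=; apply/andP.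
  case; apply/asboolP => y [] /=; rewrite !in_itv/= => /andP[? ?] /andP[? ?].
  apply: zeU; split => /=; rewrite /ball/= ltr_distl; apply/andP; split; lra.
apply: countable_bigcupT_measurable; first exact: countableP.
move=> q; case: ifP => // _.
by apply: measurableX; exact: measurable_itv.
Qed.

Lemma continuous_measurable_prod (f : R * R -> R) : continuous f ->
  measurable_fun setT (f : measurableTypeR R * measurableTypeR R -> measurableTypeR R).
Proof.
move=> cf; apply: (measurability _ (measurable_realfun.RGenOpens.measurableE R)).
move=> _ [_ [a [b ->] <-]]; rewrite setTI.
apply: open_measurable_prod.
by apply: open_comp; [move=> *; exact: cf|exact: interval_open].
Qed.

Let sq : set (R * R) := `[0, 1] `*` `[0, 1].

Lemma measurable_square :
  measurable (sq : set (measurableTypeR R * measurableTypeR R)).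
Proof. by apply: measurableX; exact: measurable_itv. Qed.

Lemma square_measure : (mu \x mu)%E sq = 1%E.
Proof.
rewrite product_measure1E//.
have m1 : mu `[0, 1] = 1%E by rewrite lebesgue_measure_itv/= lte01 oppr0 adde0.
by rewrite [X in (X * _)%E]m1 [X in (_ * X)%E]m1 mule1.
Qed.

Lemma continuous_square_integrable (f : R * R -> R) : continuous f ->
  (mu \x mu)%E.-integrable sq (EFin \o f).
Proof.
move=> cf; apply: measurable_bounded_integrable.
- exact: measurable_square.
- have h : ((mu \x mu)%E sq < +oo)%E by rewrite square_measure ltry.
  exact: h.
- apply: measurable_funTS; exact: continuous_measurable_prod.
- have : compact (f @` sq).
    apply: continuous_compact; first exact: continuous_subspaceT.
    by apply: compact_setX; exact: segment_compact.
  move=> /compact_bounded [M [Mr HM]].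
  exists M; split => // x Mx y sqy; apply: HM => //.
Qed.

Lemma integral_derive_unit (g G : R -> R) :
  (forall s, {for s, continuous g}) -> (forall s : R, is_derive s (1:R) G (g s)) ->
  (\int[mu]_(s in `[0%R, 1%R]) (g s)%:E = (G 1 - G 0)%R%:E)%E.
Proof.
move=> cg dG; rewrite (@continuous_FTC2 _ g G) ?EFinB//.
- by apply: continuous_subspaceT => s; exact: cg.
- have cG : continuous G.
    by move=> s; apply: differentiable_continuous; apply/derivable1_diffP;
      have [] := dG s.
  split => [s _||]; first by have [] := dG s.
  + exact/cvg_at_right_filter/cG.
  + exact/cvg_at_left_filter/cG.
- by move=> s _; rewrite derive1E; exact: derive_val.
Qed.

Lemma fubini_square1 (f : R * R -> R) : continuous f ->
  (\int[(mu \x mu)%E]_(p in sq) (f p)%:E =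
   \int[mu]_(t in `[0%R, 1%R]) \int[mu]_(s in `[0%R, 1%R]) (f (s, t))%:E)%E.
Proof.
move=> cf; rewrite integral_mkcond -integral21_prod_meas1; last first.
  by apply/(integrable_mkcond _ measurable_square); exact: continuous_square_integrable.
rewrite [RHS]integral_mkcond; apply: eq_integral => t _.
rewrite /fubini_G patchE; case: ifPn => [|] t01.
  rewrite [RHS]integral_mkcond; apply: eq_integral => s _.
  by rewrite !patchE /sq in_setX t01 andbT.
by apply: integral0_eq => s _; rewrite patchE in_setX (negbTE t01) andbF.
Qed.

Lemma fubini_square2 (f : R * R -> R) : continuous f ->
  (\int[(mu \x mu)%E]_(p in sq) (f p)%:E =
   \int[mu]_(s in `[0%R, 1%R]) \int[mu]_(t in `[0%R, 1%R]) (f (s, t))%:E)%E.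
Proof.
move=> cf; rewrite integral_mkcond -integral12_prod_meas1; last first.
  by apply/(integrable_mkcond _ measurable_square); exact: continuous_square_integrable.
rewrite [RHS]integral_mkcond; apply: eq_integral => s _.
rewrite /fubini_F patchE; case: ifPn => [|] s01.
  rewrite [RHS]integral_mkcond; apply: eq_integral => t _.
  by rewrite !patchE /sq in_setX s01.
by apply: integral0_eq => t _; rewrite patchE in_setX (negbTE s01).
Qed.

(** Fubini is applied with the direction of the derivative innermost, so each inner integral already
    vanishes by the fundamental theorem of calculus. *)
Lemma Rintegral_square_derive1 (f : R * R -> R) (F : R -> R -> R) :
  continuous f -> (forall s t, is_derive s (1:R) (F t) (f (s, t))) ->
  (forall t, F t 1 = F t 0) ->
  \int[(mu \x mu)%E]_(p in `[0, 1] `*` `[0, 1]) f p = 0.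
Proof.
move=> cf dF F01; rewrite /Rintegral fubini_square1//.
rewrite integral0_eq// => t _.
rewrite (@integral_derive_unit _ (F t)) ?F01 ?subrr// => s.
apply: (continuous_comp (f := fun s => (s, t)) (g := f)); last exact: cf.
exact: (cvg_pair cvg_id (cvg_cst t)).
Qed.

Lemma Rintegral_square_derive2 (f : R * R -> R) (F : R -> R -> R) :
  continuous f -> (forall s t, is_derive t (1:R) (F s) (f (s, t))) ->
  (forall s, F s 1 = F s 0) ->
  \int[(mu \x mu)%E]_(p in `[0, 1] `*` `[0, 1]) f p = 0.
Proof.
move=> cf dF F01; rewrite /Rintegral fubini_square2//.
rewrite integral0_eq// => s _.
rewrite (@integral_derive_unit _ (F s)) ?F01 ?subrr// => t.
apply: (continuous_comp (f := fun t => (s, t)) (g := f)); last exact: cf.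
exact: (cvg_pair (cvg_cst s) cvg_id).
Qed.

End Square.

(** * Differentiation rules on the line and along affine slices *)

Section RealDerivatives.
Context {R : realType}.
Implicit Types (f g : R -> R) (x a b : R).

Lemma is_derive_const x a : is_derive x (1 : R) (fun _ => a) (0 : R).
Proof. exact: is_derive_cst. Qed.

Lemma is_derive_addf f g x a b : is_derive x (1 : R) f a ->
  is_derive x (1 : R) g b -> is_derive x (1 : R) (fun y => f y + g y) (a + b).
Proof. by move=> df dg; exact: is_deriveD. Qed.

Lemma is_derive_subf f g x a b : is_derive x (1 : R) f a ->
  is_derive x (1 : R) g b -> is_derive x (1 : R) (fun y => f y - g y) (a - b).
Proof. by move=> df dg; exact: is_deriveB. Qed.

Lemma is_derive_mulf f g x a b : is_derive x (1 : R) f a ->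
  is_derive x (1 : R) g b ->
  is_derive x (1 : R) (fun y => f y * g y) (a * g x + f x * b).
Proof.
move=> df dg; apply: (is_derive_eq (is_deriveM df dg)).
by rewrite /GRing.scale/= addrC [g x * a]mulrC.
Qed.

Lemma is_derive_scale f x a c : is_derive x (1 : R) f a ->
  is_derive x (1 : R) (fun y => c * f y) (c * a).
Proof.
move=> df; apply: (is_derive_eq (is_derive_mulf (is_derive_const x c) df)).
by rewrite mul0r add0r.
Qed.

Lemma is_derive_inv f x a : f x != 0 -> is_derive x (1 : R) f a ->
  is_derive x (1 : R) (fun y => (f y)^-1) (- a / f x ^+ 2).
Proof.
move=> fx0 df; apply: (is_derive_eq (is_deriveV fx0 df)).
by rewrite /GRing.scale/= -exprVn; ring.
Qed.

Lemma is_derive_divf f g x a b : g x != 0 -> is_derive x (1 : R) f a ->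
  is_derive x (1 : R) g b ->
  is_derive x (1 : R) (fun y => f y / g y) ((a * g x - f x * b) / g x ^+ 2).
Proof.
move=> gx0 df dg; apply: (is_derive_eq (is_derive_mulf df (is_derive_inv gx0 dg))).
by field.
Qed.

Lemma is_derive_continuous f f' : (forall x, is_derive x (1 : R) f (f' x)) ->
  continuous f.
Proof.
move=> df x; apply: differentiable_continuous; apply/derivable1_diffP.
by have [] := df x.
Qed.

End RealDerivatives.

Section Slices.
Context {R : realType} {U V W : normedModType R}.

(** The two difference quotients are the same function of the increment, so the equality needs no
    differentiability. *)
Lemma derive_slice (f : V -> W) (g : U -> V) (x w : U) (v : V) :
  (forall h : R, g (h *: w + x) = h *: v + g x) ->
  'D_w (f \o g) x = 'D_v f (g x).
Proof.
move=> gE; rewrite /derive.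
suff -> : (fun h : R => h^-1 *: (((f \o g) \o shift x) (h *: w) - (f \o g) x)) =
    (fun h : R => h^-1 *: ((f \o shift (g x)) (h *: v) - f (g x))) by [].
by apply/funext => h /=; rewrite gE.
Qed.

Lemma derivable_slice (f : V -> W) (g : U -> V) (x w : U) (v : V) :
  (forall h : R, g (h *: w + x) = h *: v + g x) ->
  derivable f (g x) v -> derivable (f \o g) x w.
Proof.
move=> gE; rewrite /derivable.
suff -> : (fun h : R => h^-1 *: (((f \o g) \o shift x) (h *: w) - (f \o g) x)) =
    (fun h : R => h^-1 *: ((f \o shift (g x)) (h *: v) - f (g x))) by [].
by apply/funext => h /=; rewrite gE.
Qed.

End Slices.

Section Line.
Context {R : realType} {V W : normedModType R}.

Lemma is_derive_line (f : V -> W) (a v : V) (s : R) :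
  derivable f (s *: v + a) v ->
  is_derive s (1 : R) (fun r => f (r *: v + a)) ('D_v f (s *: v + a)).
Proof.
have lineE h : (h *: (1 : R) + s) *: v + a = h *: v + (s *: v + a).
  by rewrite scalerDl addrA -scalerA scale1r.
move=> dfv; apply: DeriveDef.
  exact: (@derivable_slice R R V W f (fun r => r *: v + a) s (1 : R) v lineE dfv).
exact: (@derive_slice R R V W f (fun r => r *: v + a) s (1 : R) v lineE).
Qed.

Lemma derive_lin_dir (f : V -> W) (z u v : V) (a b : R) : differentiable f z ->
  'D_(a *: u + b *: v) f z = a *: 'D_u f z + b *: 'D_v f z.
Proof. by move=> df; rewrite !deriveE// linearD !linearZ. Qed.

End Line.

(** * Integrals over the torus and exact derivatives *)

Section Torus.
Context {R : realType}.
Implicit Types (w z u v : R * R) (f g P : R * R -> R).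

Let par (w1 w2 p : R * R) : R * R := p.1 *: w1 + p.2 *: w2.

Lemma continuous_par (w1 w2 : R * R) : continuous (par w1 w2).
Proof.
move=> p; apply: cvgD; apply: cvgZr_tmp.
- exact: cvg_fst.
- exact: cvg_snd.
Qed.

Lemma torus_integral_integrable (w1 w2 : R * R) f : continuous f ->
  (lebesgue_measure \x lebesgue_measure)%E.-integrable (`[0%R, 1%R] `*` `[0%R, 1%R])
    (EFin \o (fun p : R * R => f (p.1 *: w1 + p.2 *: w2) * `|det2 w1 w2|)).
Proof.
move=> cf; apply: continuous_square_integrable => p.
apply: cvgMr_tmp.
apply: (continuous_comp (f := par w1 w2) (g := f)); last exact: cf.
exact: continuous_par.
Qed.

Lemma torus_integralD (w1 w2 : R * R) f g : continuous f -> continuous g ->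
  torus_integral w1 w2 (fun z => f z + g z) =
  torus_integral w1 w2 f + torus_integral w1 w2 g.
Proof.
move=> cf cg; rewrite /torus_integral -RintegralD.
- by apply: eq_Rintegral => p _; rewrite mulrDl.
- exact: measurable_square.
- exact: torus_integral_integrable.
- exact: torus_integral_integrable.
Qed.

Lemma torus_integralZ (w1 w2 : R * R) f a : continuous f ->
  torus_integral w1 w2 (fun z => a * f z) = a * torus_integral w1 w2 f.
Proof.
move=> cf; rewrite /torus_integral -RintegralZl.
- by apply: eq_Rintegral => p _; rewrite mulrA.
- exact: measurable_square.
- exact: torus_integral_integrable.
Qed.

Lemma torus_integral_le (w1 w2 : R * R) f C : continuous f ->
  (forall s t, 0 <= s <= 1 -> 0 <= t <= 1 -> `|f (s *: w1 + t *: w2)| <= C) ->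
  `|torus_integral w1 w2 f| <= C * `|det2 w1 w2|.
Proof.
move=> cf fC; rewrite /torus_integral.
have ifd := torus_integral_integrable w1 w2 cf.
apply: (le_trans (le_normr_Rintegral measurable_square ifd)).
have -> : C * `|det2 w1 w2| =
    \int[(lebesgue_measure \x lebesgue_measure)%E]_(p in `[0%R, 1%R] `*` `[0%R, 1%R])
    (cst (C * `|det2 w1 w2|) (p : R * R)).
  rewrite Rintegral_cst; last exact: measurable_square.
  by rewrite [X in fine X]square_measure mulr1.
apply: le_Rintegral.
- exact: measurable_square.
- apply: continuous_square_integrable => p; apply: cvg_norm; apply: cvgMr_tmp.
  apply: (continuous_comp (f := par w1 w2) (g := f)); last exact: cf.
  exact: continuous_par.
- by apply: continuous_square_integrable => p; exact: cvg_cst.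
move=> -[s t] [/=]; rewrite !in_itv/= => s01 t01.
by rewrite normrM normr_id ler_wpM2r// fC.
Qed.

Lemma eq_torus_integral (w1 w2 : R * R) f g : f =1 g ->
  torus_integral w1 w2 f = torus_integral w1 w2 g.
Proof. by move=> /funext ->. Qed.

Lemma torus_integral_derive (w1 w2 : R * R) u P : R_independent w1 w2 ->
  Defs.periodic (lattice w1 w2) P -> (forall z, differentiable P z) ->
  (forall v, continuous (fun z => 'D_v P z)) ->
  torus_integral w1 w2 (fun z => 'D_u P z) = 0.
Proof.
move=> wi perP dP cDP.
have P1 z : P (w1 + z) = P z.
  by rewrite addrC; apply: perP; exists 1, 0; rewrite mulr1z mulr0z addr0.
have P2 z : P (w2 + z) = P z.
  by rewrite addrC; apply: perP; exists 0, 1; rewrite mulr1z mulr0z add0r.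
have I1 : torus_integral w1 w2 (fun z => 'D_w1 P z) = 0.
  apply: (@Rintegral_square_derive1 _ _
    (fun t s => P (s *: w1 + t *: w2) * `|det2 w1 w2|)).
  - move=> p; apply: cvgMr_tmp.
    apply: (continuous_comp (f := par w1 w2) (g := (fun z => 'D_w1 P z))).
      exact: continuous_par.
    exact: cDP.
  - move=> s t; have := is_derive_line (diff_derivable (dP (s *: w1 + t *: w2)) (v := w1)).
    move=> h; apply: (is_derive_eq (is_derive_mulf h (is_derive_const _ _))).
    by rewrite mulr0 addr0.
  - by move=> t; rewrite scale1r scale0r add0r P1.
have I2 : torus_integral w1 w2 (fun z => 'D_w2 P z) = 0.
  apply: (@Rintegral_square_derive2 _ _
    (fun s t => P (t *: w2 + s *: w1) * `|det2 w1 w2|)).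
  - move=> p; apply: cvgMr_tmp.
    apply: (continuous_comp (f := par w1 w2) (g := (fun z => 'D_w2 P z))).
      exact: continuous_par.
    exact: cDP.
  - move=> s t; have := is_derive_line (diff_derivable (dP (t *: w2 + s *: w1)) (v := w2)).
    move=> h; apply: (is_derive_eq (is_derive_mulf h (is_derive_const _ _))).
    by rewrite mulr0 addr0 addrC.
  - by move=> t; rewrite scale1r scale0r add0r P2.
pose d := det2 w1 w2.
(* Cramer's rule in the lattice basis: periodicity kills the integrals of the derivatives along [w1]
   and [w2], and these two directions span the plane. *)
have uE : u = (det2 u w2 / d) *: w1 + (det2 w1 u / d) *: w2.
  move: wi; rewrite /R_independent -/d => d0.
  by apply/pair_eqP/andP; split; apply/eqP => /=; rewrite /d /det2 /GRing.scale/=; field.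
rewrite {1}uE (@eq_torus_integral _ _ _ (fun z =>
  (det2 u w2 / d) * 'D_w1 P z + (det2 w1 u / d) * 'D_w2 P z)); last first.
  by move=> z; rewrite derive_lin_dir.
rewrite torus_integralD ?torus_integralZ ?I1 ?I2 ?mulr0 ?addr0//.
- by move=> z; apply: cvgMl_tmp; exact: cDP.
- by move=> z; apply: cvgMl_tmp; exact: cDP.
Qed.

End Torus.

(** * The Willmore integrand of a conformal immersion *)

Section Dot.
Context {R : realType}.
Implicit Types (a b c d : 'rV[R]_4).

Lemma dotC a b : dot a b = dot b a.
Proof. by apply: eq_bigr => i _; rewrite mulrC. Qed.

Lemma dotDl a b c : dot (a + b) c = dot a c + dot b c.
Proof. by rewrite /dot -big_split; apply: eq_bigr => i _; rewrite mxE mulrDl. Qed.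

Lemma dotZl (k : R) a b : dot (k *: a) b = k * dot a b.
Proof. by rewrite /dot mulr_sumr; apply: eq_bigr => i _; rewrite mxE mulrA. Qed.

Lemma dotDr a b c : dot a (b + c) = dot a b + dot a c.
Proof. by rewrite dotC dotDl !(dotC a). Qed.

Lemma dotZr (k : R) a b : dot a (k *: b) = k * dot a b.
Proof. by rewrite dotC dotZl dotC. Qed.

Lemma dotNl a b : dot (- a) b = - dot a b.
Proof. by rewrite -scaleN1r dotZl mulN1r. Qed.

Lemma dotNr a b : dot a (- b) = - dot a b.
Proof. by rewrite -scaleN1r dotZr mulN1r. Qed.

Definition dotE := (dotDl, dotDr, dotZl, dotZr, dotNl, dotNr).

Lemma dot0l a : dot 0 a = 0.
Proof. by rewrite -(scale0r 0) dotZl mul0r. Qed.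

Lemma dot_ge0 a : 0 <= dot a a.
Proof. by apply: sumr_ge0 => i _; rewrite -expr2 sqr_ge0. Qed.

Lemma dot_eq0 a : dot a a = 0 -> a = 0.
Proof.
move=> /eqP; rewrite psumr_eq0 => [/allP a0|i _]; last by rewrite -expr2 sqr_ge0.
apply/rowP => i; rewrite mxE; apply/eqP; rewrite -sqrf_eq0 expr2.
exact: (implyP (a0 i (mem_index_enum i))).
Qed.

Lemma dot4 a b : dot a b =
  a 0 0 * b 0 0 + a 0 1 * b 0 1 + a 0 2%:R * b 0 2%:R + a 0 3%:R * b 0 3%:R.
Proof.
rewrite /dot !big_ord_recl big_ord0 addr0 !addrA.
by do ![congr (_ + _)]; congr (a _ _ * b _ _); apply/val_inj.
Qed.

Lemma det3_fun (m : nat -> nat -> R) : \det (\matrix_(i < 3, j < 3) m i j) =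
  m 0%N 0%N * (m 1%N 1%N * m 2%N 2%N - m 1%N 2%N * m 2%N 1%N)
  - m 0%N 1%N * (m 1%N 0%N * m 2%N 2%N - m 1%N 2%N * m 2%N 0%N)
  + m 0%N 2%N * (m 1%N 0%N * m 2%N 1%N - m 1%N 1%N * m 2%N 0%N) :> R.
Proof.
rewrite (expand_det_row _ ord0) !big_ord_recl big_ord0 /cofactor.
rewrite !(expand_det_row _ ord0) !big_ord_recl !big_ord0 /cofactor !det_mx11 !mxE.
by rewrite /= /bump /=; ring.
Qed.

Definition d3 (m : nat -> nat -> R) (i j k : nat) : R :=
  m 1%N i * (m 2%N j * m 3%N k - m 2%N k * m 3%N j)
  - m 1%N j * (m 2%N i * m 3%N k - m 2%N k * m 3%N i)
  + m 1%N k * (m 2%N i * m 3%N j - m 2%N j * m 3%N i).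

Lemma det4_fun (m : nat -> nat -> R) : \det (\matrix_(i < 4, j < 4) m i j) =
  m 0%N 0%N * d3 m 1%N 2%N 3%N - m 0%N 1%N * d3 m 0%N 2%N 3%N + m 0%N 2%N * d3 m 0%N 1%N 3%N - m 0%N 3%N * d3 m 0%N 1%N 2%N.
Proof.
have minor (j : 'I_4) : \det (row' ord0 (col' j (\matrix_(i < 4, j < 4) m i j))) =
    d3 m (bump j 0%N) (bump j 1%N) (bump j 2%N).
  rewrite /d3 -(det3_fun (fun i l : nat => m i.+1 (bump j l))); congr (\det _).
  by apply/matrixP => i l; rewrite !mxE.
rewrite (expand_det_row _ ord0) !big_ord_recl big_ord0 /cofactor !minor !mxE /= /bump /=.
by ring.
Qed.

End Dot.

Section Gram.
Context {R : realType}.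
Implicit Types (a b c d : 'rV[R]_4).

Definition rows4 a b c d : 'M[R]_4 :=
  \matrix_(i < 4, k < 4) (nth 0 [:: a; b; c; d] i) 0 k.

Lemma dot_cross3 a b c d : dot (cross3 a b c) d = \det (rows4 a b c d).
Proof.
(* The cofactors of the last row do not see that row, so they may be computed with any vector in
   it. *)
have cofE e j : cofactor (rows4 a b c e) ord_max j = cofactor (rows4 a b c 0) ord_max j.
  rewrite /cofactor; congr (_ * \det _); apply/matrixP => i k; rewrite !mxE.
  by case: i => -[|[|[|//]]] ?.
rewrite (expand_det_row _ ord_max); apply: eq_bigr => j _.
rewrite !mxE /= (expand_det_row _ ord_max) (bigD1 j)//= big1 ?addr0 => [|k kj].
  by rewrite !mxE /= eqxx mul1r mulrC -!/(rows4 a b c _) !cofE.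
by rewrite !mxE /= (negbTE kj) mul0r.
Qed.

Lemma gram4 a b c d : \det (rows4 a b c d) ^+ 2 =
  \det (\matrix_(i < 4, j < 4) dot (nth 0 [:: a; b; c; d] i) (nth 0 [:: a; b; c; d] j)).
Proof.
rewrite expr2 -{2}det_tr -det_mulmx; congr (\det _).
by apply/matrixP => i j; rewrite !mxE; apply: eq_bigr => k _; rewrite !mxE.
Qed.

(* Pythagoras in the orthogonal frame [a, b, c, cross3 a b c]. *)
Lemma dot_cross3_sqr a b c d r : dot a a = 1 -> dot a b = 0 -> dot a c = 0 ->
  dot b b = r -> dot c c = r -> dot b c = 0 ->
  dot (cross3 a b c) d ^+ 2 =
  r ^+ 2 * (dot d d - dot a d ^+ 2) - r * (dot b d ^+ 2 + dot c d ^+ 2).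
Proof.
move=> aa ab ac bb cc bc.
rewrite dot_cross3 gram4.
rewrite (det4_fun (fun i j => dot (nth 0 [:: a; b; c; d] i) (nth 0 [:: a; b; c; d] j))).
rewrite /d3 /=.
rewrite (dotC b a) (dotC c a) (dotC d a) (dotC c b) (dotC d b) (dotC d c).
by rewrite aa ab ac bb cc bc; ring.
Qed.

Lemma dot_delta a j : dot a (delta_mx 0 j) = a 0 j.
Proof.
rewrite /dot (bigD1 j)//= big1 ?addr0 => [|k kj]; rewrite mxE !eqxx ?mulr1//.
by rewrite (negbTE kj) mulr0.
Qed.

(** Pythagoras is summed over the four coordinate vectors [d]: the result is
    [(4 - 1) r ^ 2 - r (r + r) = r ^ 2]. *)
Lemma dot_cross3_self a b c r : dot a a = 1 -> dot a b = 0 -> dot a c = 0 ->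
  dot b b = r -> dot c c = r -> dot b c = 0 ->
  dot (cross3 a b c) (cross3 a b c) = r ^+ 2.
Proof.
move=> aa ab ac bb cc bc.
rewrite {1}/dot (eq_bigr (fun j => r ^+ 2 * (1 - a 0 j * a 0 j)
    - r * (b 0 j * b 0 j + c 0 j * c 0 j))) => [|j _]; last first.
  rewrite -expr2 -dot_delta (dot_cross3_sqr _ aa ab ac bb cc bc) !dot_delta.
  by rewrite mxE !eqxx !expr2.
rewrite sumrB -!mulr_sumr sumrB big_split/= -!/(dot _ _) aa bb cc.
by rewrite sumr_const card_ord; ring.
Qed.

End Gram.

Section DerivativeOfDot.
Context {R : realType} {V : normedModType R}.
Implicit Types (F G : V -> 'rV[R]_4) (z v : V).

Lemma is_derive_dot F G z v dF dG : is_derive z v F dF -> is_derive z v G dG ->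
  is_derive z v (fun x => dot (F x) (G x)) (dot dF (G z) + dot (F z) dG).
Proof.
have comp (H : V -> 'rV[R]_4) (dH : 'rV[R]_4) i : is_derive z v H dH -> is_derive z v (fun x => H x 0 i : R) (dH 0 i).
  move=> [Hd <-]; have /derivable_mxP Hd' := Hd; split; first exact: Hd'.
  by rewrite derive_mx// mxE.
move=> dFz dGz.
have -> : (fun x => dot (F x) (G x)) =
    \sum_(i < 4) ((fun x => F x 0 i) * (fun x => G x 0 i)) :> (V -> R).
  by apply/funext => x; rewrite fct_sumE.
apply: (is_derive_eq (is_derive_sum (fun i => is_deriveM (comp _ _ i dFz) (comp _ _ i dGz)))).
rewrite /dot -big_split/=; apply: eq_bigr => i _.
by rewrite /GRing.scale/= addrC [G z 0 i * _]mulrC.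
Qed.

Lemma derive_dot F G z v : derivable F z v -> derivable G z v ->
  'D_v (fun x => dot (F x) (G x)) z = dot ('D_v F z) (G z) + dot (F z) ('D_v G z).
Proof.
move=> dF dG; apply: derive_val.
by apply: is_derive_dot; exact: derivableP.
Qed.

Lemma differentiable_comp_mx (F : V -> 'rV[R]_4) z i :
  differentiable F z -> differentiable (fun x => F x 0 i : R) z.
Proof.
by move=> dF; exact: (differentiable_comp dF (differentiable_coord _ _ _)).
Qed.

Lemma differentiable_dot F G z : differentiable F z -> differentiable G z ->
  differentiable (fun x => dot (F x) (G x) : R) z.
Proof.
move=> dF dG.
have -> : (fun x => dot (F x) (G x)) =
    \sum_(i < 4) ((fun x => F x 0 i) * (fun x => G x 0 i)) :> (V -> R).
  by apply/funext => x; rewrite fct_sumE.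
apply: differentiable_sum => i.
by apply: differentiableM; exact: differentiable_comp_mx.
Qed.

Lemma continuous_dot F G : continuous F -> continuous G ->
  continuous (fun x => dot (F x) (G x) : R).
Proof.
move=> cF cG x; have cM i : {for x, continuous (fun x => F x 0 i * G x 0 i : R)}.
  apply: cvgM.
    exact: (continuous_comp (cF x) (@coord_continuous _ _ _ _ _ _)).
  exact: (continuous_comp (cG x) (@coord_continuous _ _ _ _ _ _)).
have -> : (fun x => dot (F x) (G x)) =
    (fun x => F x 0 0 * G x 0 0 + F x 0 1 * G x 0 1 + F x 0 2%:R * G x 0 2%:R
      + F x 0 3%:R * G x 0 3%:R) by apply/funext => y; rewrite dot4.
by apply: cvgD; [apply: cvgD; [apply: cvgD|]|]; exact: cM.
Qed.

End DerivativeOfDot.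

Section Density.
Context {R : realType}.
Implicit Types (F : R * R -> 'rV[R]_4) (z u v w : R * R).

(** For [a], [b] orthogonal of squared length [r], and [d] the Laplacian, the part of [d] normal to
    the surface is [- 2 r f + 2 r H n]; its square over [4 r] is [(H ^ 2 + 1) r]. Subtracting the
    tangential part, instead of proving that it vanishes for conformal maps, costs nothing: near a
    Hopf torus it only enters at second order. *)
Definition energy_density (a b d : 'rV[R]_4) : R :=
  (dot d d - (dot a d ^+ 2 + dot b d ^+ 2) / dot a a) / (4 * dot a a).

Lemma sphere_derive1 F z v : (forall z, S3 (F z)) -> differentiable F z ->
  dot (F z) ('D_v F z) = 0.
Proof.
move=> S dF; have dFv := diff_derivable dF (v := v).
have := derive_dot dFv dFv.
have -> : (fun x => dot (F x) (F x)) = cst 1 by apply/funext => x; exact: S.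
rewrite derive_cst dotC => /esym/eqP; rewrite -mulr2n mulrn_eq0/= => /eqP <-.
by rewrite dotC.
Qed.

Lemma sphere_derive2 F z v w : (forall z, S3 (F z)) ->
  (forall z, differentiable F z) -> differentiable (fun z => 'D_v F z) z ->
  dot (F z) ('D_w (fun z => 'D_v F z) z) = - dot ('D_w F z) ('D_v F z).
Proof.
move=> S dF ddF.
have := derive_dot (diff_derivable (dF z) (v := w)) (diff_derivable ddF (v := w)).
have -> : (fun x => dot (F x) ('D_v F x)) = cst 0.
  by apply/funext => x; exact: sphere_derive1.
by rewrite derive_cst => /esym/eqP; rewrite addrC addr_eq0 => /eqP.
Qed.

Lemma derive_coord (H : R * R -> 'rV[R]_4) z w : differentiable H z ->
  'D_w H z = w.1 *: dx H z + w.2 *: dy H z.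
Proof.
move=> dH; have wE : w = w.1 *: (1, 0) + w.2 *: (0, 1).
  by apply/pair_eqP/andP; split; apply/eqP; rewrite /= /GRing.scale/=; ring.
by have := derive_lin_dir ((1, 0) : R * R) (0, 1) w.1 w.2 dH; rewrite -wE.
Qed.

Lemma derive_comb (G H : R * R -> 'rV[R]_4) z w (a b : R) :
  differentiable G z -> differentiable H z ->
  'D_w (fun y => a *: G y + b *: H y) z =
  a *: (w.1 *: dx G z + w.2 *: dy G z) + b *: (w.1 *: dx H z + w.2 *: dy H z).
Proof.
move=> dG dH.
have dGw := derivableP (diff_derivable dG (v := w)).
have dHw := derivableP (diff_derivable dH (v := w)).
apply: etrans (derive_val (is_derive := is_deriveD (is_deriveZ a dGw) (is_deriveZ b dHw))) _.
by congr (_ *: _ + _ *: _); exact: derive_coord.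
Qed.

Lemma quadratic_comb (p q p' q' : 'rV[R]_4) (x y : R) :
  x *: (x *: p + y *: q) + y *: (x *: p' + y *: q') =
  x ^+ 2 *: p + y ^+ 2 *: q' + (x * y) *: (p' + q).
Proof. by apply/rowP => i; rewrite !mxE; ring. Qed.

(** In an orthogonal pair of directions of equal length the mixed terms cancel as a sum, so the
    symmetry of second derivatives is never invoked. *)
Lemma quadratic_comb_orth (p q p' q' : 'rV[R]_4) (x y s : R) : s ^+ 2 = 1 ->
  x ^+ 2 *: p + y ^+ 2 *: q' + (x * y) *: (p' + q) +
  ((- s * y) ^+ 2 *: p + (s * x) ^+ 2 *: q' + (- s * y * (s * x)) *: (p' + q)) =
  (x ^+ 2 + y ^+ 2) *: (p + q').
Proof.
move=> s1; have -> : - s * y * (s * x) = - (s ^+ 2 * (x * y)) by ring.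
rewrite !exprMn sqrrN s1 !mul1r.
by apply/rowP => i; rewrite !mxE; ring.
Qed.

Lemma derive_dir2 F z w : (forall z, differentiable F z) ->
  (forall w z, differentiable (fun z => 'D_w F z) z) ->
  'D_w (fun z => 'D_w F z) z = w.1 ^+ 2 *: dx (dx F) z + w.2 ^+ 2 *: dy (dy F) z
    + (w.1 * w.2) *: (dx (dy F) z + dy (dx F) z).
Proof.
move=> dF ddF.
have -> : (fun z => 'D_w F z) = (fun y => w.1 *: dx F y + w.2 *: dy F y).
  by apply/funext => y; exact: derive_coord.
rewrite (derive_comb w w.1 w.2 (ddF (1, 0) z) (ddF (0, 1) z)).
exact: quadratic_comb.
Qed.

(** The component of [d] along [f] is [- 2 r], and its square accounts exactly for the [1] in
    [H ^ 2 + 1]. The new frame is orthogonal, with orientation [s], and only its squared length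
    survives, as a factor. *)
Lemma conformal_algebra (f a b d : 'rV[R]_4) (r s x y : R) : 0 < r ->
  s ^+ 2 = 1 -> x ^+ 2 + y ^+ 2 != 0 ->
  dot f f = 1 -> dot f a = 0 -> dot f b = 0 -> dot a a = r -> dot b b = r ->
  dot a b = 0 -> dot f d = - 2 * r ->
  ((dot (cross3 f a b) d / r / (2 * r)) ^+ 2 + 1) * r =
  (x ^+ 2 + y ^+ 2)^-1 * energy_density (x *: a + y *: b)
    (- s * y *: a + s * x *: b) ((x ^+ 2 + y ^+ 2) *: d).
Proof.
move=> r0 s1 l0 ff fa fb aa bb ab fd.
rewrite 2!exprMn (dot_cross3_sqr d ff fa fb aa bb ab) fd.
rewrite /energy_density; set t1 := dot a d; set t2 := dot b d; set t3 := dot d d.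
rewrite !dotE (dotC b a) aa bb ab -/t1 -/t2 -/t3.
have r0' : r != 0 by rewrite gt_eqF.
clearbody t1 t2 t3.
have -> : x * (x * r + y * 0) + y * (x * 0 + y * r) = (x ^+ 2 + y ^+ 2) * r by ring.
have /orP[/eqP->|/eqP->] : (s == 1) || (s == -1) by rewrite -sqrf_eq1 s1.
  by field; rewrite l0 r0'.
by field; rewrite l0 r0'.
Qed.

Lemma mean_algebra (r : R) (n p q t : 'rV[R]_4) : r != 0 ->
  (r * dot q (r^-1 *: n) - 2 * 0 * dot t (r^-1 *: n) + r * dot p (r^-1 *: n))
    / (2 * (r * r - 0 ^+ 2)) =
  dot n (p + q) / r / (2 * r).
Proof.
move=> r0; rewrite dotDr (dotC n p) (dotC n q) !dotZr.
by field.
Qed.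

Lemma mean_curvature_conformal F z r : 0 < r ->
  (forall z, S3 (F z)) -> (forall z, differentiable F z) ->
  gE F z = r -> gG F z = r -> gF F z = 0 ->
  mean_curvature F z =
  dot (cross3 (F z) (dx F z) (dy F z)) (dx (dx F) z + dy (dy F) z) / r / (2 * r).
Proof.
move=> r0 S dF gEr gGr gFr.
have F1 : dot (F z) (dx F z) = 0 by exact: sphere_derive1.
have F2 : dot (F z) (dy F z) = 0 by exact: sphere_derive1.
have nn := dot_cross3_self (S z) F1 F2 gEr gGr gFr.
rewrite /mean_curvature gEr gGr gFr /hN /hL /hM /unit_normal nn sqrtr_sqr gtr0_norm//.
by apply: mean_algebra; rewrite gt_eqF.
Qed.

(** The curve and fibre directions of a Hopf torus need not be the coordinate axes; this expresses
    the integrand in a rotated and scaled frame, orientation reversing when [s = -1]. *)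
Lemma willmore_densityE F z u v (s : R) : (forall z, S3 (F z)) ->
  (forall z, differentiable F z) ->
  (forall w z, differentiable (fun z => 'D_w F z) z) -> conformal F ->
  u != 0 -> s ^+ 2 = 1 -> v = (- s * u.2, s * u.1) ->
  (mean_curvature F z ^+ 2 + 1) * area_density F z =
  (u.1 ^+ 2 + u.2 ^+ 2)^-1 *
  energy_density ('D_u F z) ('D_v F z)
    ('D_u (fun z => 'D_u F z) z + 'D_v (fun z => 'D_v F z) z).
Proof.
move=> S dF ddF /(_ z)[r r0 cF] u0 s1 vE.
have l0 : u.1 ^+ 2 + u.2 ^+ 2 != 0.
  apply: contra u0 => /eqP h.
  have := sqr_ge0 u.1; have := sqr_ge0 u.2 => h2 h1.
  have a0 : u.1 ^+ 2 == 0 by apply/eqP; clear -h h1 h2; lra.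
  have b0 : u.2 ^+ 2 == 0 by apply/eqP; clear -h h1 h2; lra.
  by rewrite !sqrf_eq0 in a0 b0; apply/eqP/pair_eqP/andP.
have gEr : gE F z = r by rewrite /gE /dx cF /=; ring.
have gGr : gG F z = r by rewrite /gG /dy cF /=; ring.
have gFr : gF F z = 0 by rewrite /gF /dx /dy cF /=; ring.
have area : area_density F z = r.
  rewrite /area_density gEr gGr gFr expr0n/= subr0 -expr2 sqrtr_sqr.
  by rewrite gtr0_norm.
rewrite (mean_curvature_conformal r0 S dF gEr gGr gFr) area.
rewrite (derive_coord u (dF z)) (derive_coord v (dF z)).
have Du2 := derive_dir2 z u dF ddF; have Dv2 := derive_dir2 z v dF ddF.
rewrite [X in energy_density _ _ X](congr2 +%R Du2 Dv2).
have F1 : dot (F z) (dx F z) = 0 by exact: sphere_derive1.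
have F2 : dot (F z) (dy F z) = 0 by exact: sphere_derive1.
have Fd1 : dot (F z) (dx (dx F) z) = - r.
  by rewrite -gEr; apply: sphere_derive2 => //; exact: ddF.
have Fd2 : dot (F z) (dy (dy F) z) = - r.
  by rewrite -gGr; apply: sphere_derive2 => //; exact: ddF.
have Fd : dot (F z) (dx (dx F) z + dy (dy F) z) = - 2 * r.
  by rewrite dotDr; apply: (etrans (congr2 +%R Fd1 Fd2)); ring.
move: gEr gGr gFr F1 F2 Fd; rewrite /gE /gG /gF.
move=> aa bb ab fa fb fd.
have ff : dot (F z) (F z) = 1 by exact: S.
have CA := @conformal_algebra (F z) (dx F z) (dy F z) (dx (dx F) z + dy (dy F) z)
  r s u.1 u.2 r0 s1 l0 ff fa fb aa bb ab fd.
apply: (etrans CA); clear CA.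
rewrite vE.
exact: (congr1 (fun d => (u.1 ^+ 2 + u.2 ^+ 2)^-1 * energy_density
  (u.1 *: dx F z + u.2 *: dy F z) (- s * u.2 *: dx F z + s * u.1 *: dy F z) d)
  (esym (quadratic_comb_orth _ _ _ _ _ _ s1))).
Qed.

End Density.

(** * Second-order expansion of the energy density *)

Section Expansion.
Context {R : realType}.
Implicit Types (a b : 'rV[R]_4).

Lemma dot_cauchy_schwarz a b : dot a b ^+ 2 <= dot a a * dot b b.
Proof.
have [b0|b0] := eqVneq (dot b b) 0.
  by rewrite (dot_eq0 b0) dotC dot0l expr0n/= dot0l mulr0.
have := dot_ge0 (dot b b *: a - dot a b *: b).
rewrite !dotE (dotC b a) => h.
have bb : 0 < dot b b by rewrite lt_neqAle eq_sym b0 dot_ge0.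
rewrite -subr_ge0 -(pmulr_rge0 _ bb).
by move: h; congr (0 <= _); ring.
Qed.

Lemma dot_le a b (x y : R) : 0 <= x -> 0 <= y -> dot a a <= x ^+ 2 -> dot b b <= y ^+ 2 ->
  `|dot a b| <= x * y.
Proof.
move=> x0 y0 ax byy; rewrite -ler_sqr ?nnegrE ?mulr_ge0// real_normK ?num_real// exprMn.
apply: (le_trans (dot_cauchy_schwarz a b)).
by apply: ler_pM => //; exact: dot_ge0.
Qed.

Lemma normM_le (x y a b : R) : `|x| <= a -> `|y| <= b -> `|x * y| <= a * b.
Proof. by move=> xa yb; rewrite normrM ler_pM. Qed.

(** These are the terms left by [energy_expansion] after the linear part is removed: [r] is the
    change of the conformal factor, [s] pairs the old Laplacian with its increment, [t1] and [t2]
    are tangential components, [gu], [gv], [ga], [c] are products of increments. The five pieces are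
    at most 32, 50, 2, 2 and 2 times [K ^ 2 * e ^ 2], so 200 is generous. *)
Lemma expansion_remainder (k m n K e r s t1 t2 gu gv c ga : R) :
  1 <= K -> `|k| <= K -> `|m| <= K -> `|n| <= K -> 0 <= e ->
  `|r| <= 3 * e -> 1 / 2 <= 1 + r -> `|s| <= (2 + K) * e ->
  t1 ^+ 2 + t2 ^+ 2 <= 2 * ((4 + K) * e) ^+ 2 ->
  0 <= gu <= e ^+ 2 -> 0 <= gv <= e ^+ 2 -> `|c| <= e * e -> 0 <= ga <= e ^+ 2 ->
  `|(ga - 2 * (s * r) + (4 + k ^+ 2) * (r * r)) * (4 * (1 + r))^-1
   - (t1 ^+ 2 + t2 ^+ 2) * (4 * ((1 + r) * (1 + r)))^-1
   - ((1 + 3 / 4 * k ^+ 2 + m) / 2 * gu - (m + k ^+ 2 / 4 - 1) / 2 * gv - (n - k) * c)|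
  <= 200 * K ^+ 2 * e ^+ 2.
Proof.
move=> K1 kK mK nK e0 re r1 s_e tt /andP[gu0 Gue] /andP[gv0 Gve] gg /andP[ga0 Gae].
have k2K : k ^+ 2 <= K ^+ 2.
  by rewrite -[k ^+ 2]real_normK ?num_real// lerXn2r// nnegrE; lra.
have i1 : `|(4 * (1 + r))^-1| <= 1 / 2.
  clear -r1; rewrite ger0_norm ?invr_ge0; last by lra.
  by rewrite -[X in _ <= X]invrK lef_pV2 ?posrE; lra.
have i2 : `|(4 * ((1 + r) * (1 + r)))^-1| <= 1.
  clear -r1; rewrite ger0_norm ?invr_ge0; last by nra.
  by rewrite -[X in _ <= X]invr1 lef_pV2 ?posrE; nra.
have e2 : 0 <= e ^+ 2 by rewrite sqr_ge0.
have kk : `|k ^+ 2| <= K ^+ 2 by rewrite ger0_norm ?sqr_ge0.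
have K2 : 1 <= K ^+ 2 by clear -K1; nra.
have KK2 : K <= K ^+ 2 by clear -K1; nra.
have i3 : `|ga - 2 * (s * r) + (4 + k ^+ 2) * (r * r)| <= 64 * K ^+ 2 * e ^+ 2.
  have sr := normM_le s_e re; have rr := normM_le re re.
  have krr : `|(4 + k ^+ 2) * (r * r)| <= (4 + K ^+ 2) * (3 * e * (3 * e)).
    apply: normM_le => //; rewrite ger0_norm; first by lra.
    by have := sqr_ge0 k; lra.
  move: sr krr => /ler_normlP[? ?] /ler_normlP[? ?].
  have Ke : K * e ^+ 2 <= K ^+ 2 * e ^+ 2 by apply: ler_wpM2r.
  have Ke1 : 1 * e ^+ 2 <= K ^+ 2 * e ^+ 2 by apply: ler_wpM2r.
  have E1 : (2 + K) * e * (3 * e) = 6 * e ^+ 2 + 3 * (K * e ^+ 2) by ring.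
  have E2 : (4 + K ^+ 2) * (3 * e * (3 * e)) = 36 * e ^+ 2 + 9 * (K ^+ 2 * e ^+ 2) by ring.
  have E3 : 64 * K ^+ 2 * e ^+ 2 = 64 * (K ^+ 2 * e ^+ 2) by ring.
  by apply/ler_normlP; split; lra.
have i4 : `|t1 ^+ 2 + t2 ^+ 2| <= 50 * K ^+ 2 * e ^+ 2.
  rewrite ger0_norm; last by rewrite addr_ge0// sqr_ge0.
  apply: (le_trans tt).
  rewrite exprMn mulrA ler_wpM2r//; clear -K1; nra.
have i5 : `|(1 + 3 / 4 * k ^+ 2 + m) / 2 * gu| <= 2 * K ^+ 2 * e ^+ 2.
  apply: normM_le; last by rewrite ger0_norm.
  move: mK => /ler_normlP[? ?]; have ? := sqr_ge0 k.
  by apply/ler_normlP; split; lra.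
have i6 : `|(m + k ^+ 2 / 4 - 1) / 2 * gv| <= 2 * K ^+ 2 * e ^+ 2.
  apply: normM_le; last by rewrite ger0_norm.
  move: mK => /ler_normlP[? ?]; have ? := sqr_ge0 k.
  by apply/ler_normlP; split; lra.
have i7 : `|(n - k) * c| <= 2 * K ^+ 2 * e ^+ 2.
  apply: normM_le; last by rewrite expr2.
  move: nK kK => /ler_normlP[? ?] /ler_normlP[? ?].
  by apply/ler_normlP; split; lra.
have P0 : 0 <= K ^+ 2 * e ^+ 2 by rewrite mulr_ge0// sqr_ge0.
move: (normM_le i3 i1) (normM_le i4 i2) i5 i6 i7.
clear -P0; move=> /ler_normlP[? ?] /ler_normlP[? ?] /ler_normlP[? ?] /ler_normlP[? ?] /ler_normlP[? ?].
by apply/ler_normlP; split; lra.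
Qed.

(** Conformality gives exactly [dot A Gu = (r - dot Gu Gu) / 2], [dot B Gv = (r - dot Gv Gv) / 2]
    and [dot B Gu + dot A Gv = - dot Gu Gv]. Hence the terms in [m] and [n] are quadratic for any
    choice of these numbers, and the two diagonal coefficients add up to [- 2 - k ^ 2 / 2], which is
    the first-order effect of dividing by the conformal factor [1 + r]. *)
Lemma energy_expansion (f A B N Gu Gv Ga : 'rV[R]_4) (k m n K e : R) :
  dot f f = 1 -> dot A A = 1 -> dot B B = 1 -> dot N N = 1 ->
  dot f A = 0 -> dot f B = 0 -> dot f N = 0 -> dot A B = 0 -> dot A N = 0 -> dot B N = 0 ->
  1 <= K -> `|k| <= K -> `|m| <= K -> `|n| <= K -> 0 <= e -> 6 * e <= 1 ->
  dot Gu Gu <= e ^+ 2 -> dot Gv Gv <= e ^+ 2 -> dot Ga Ga <= e ^+ 2 ->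
  dot (A + Gu) (A + Gu) = dot (B + Gv) (B + Gv) -> dot (A + Gu) (B + Gv) = 0 ->
  `|energy_density (A + Gu) (B + Gv) ((- 2) *: f + k *: N + Ga) - (4 + k ^+ 2) / 4
    - (- dot f Ga + k / 2 * dot N Ga - (1 + 3 / 4 * k ^+ 2 + m) * dot A Gu
       + (m + k ^+ 2 / 4 - 1) * dot B Gv + (n - k) * (dot B Gu + dot A Gv))|
  <= 200 * K ^+ 2 * e ^+ 2.
Proof.
move=> ff AA BB NN fA fB fN AB AN BN K1 kK mK nK e0 e6 Gue Gve Gae c1 c2.
pose r := dot (A + Gu) (A + Gu) - 1.
pose S := (- 2) *: f + k *: N.
have K0 : 0 <= K by lra.
have SS : dot S S = 4 + k ^+ 2.
  by rewrite !dotE ff NN fN (dotC N f) fN; ring.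
have AS : dot A S = 0 by rewrite !dotE (dotC A f) fA AN; ring.
have BS : dot B S = 0 by rewrite !dotE (dotC B f) fB BN; ring.
have k2K : k ^+ 2 <= K ^+ 2 by rewrite -[k ^+ 2]real_normK ?num_real// lerXn2r// nnegrE.
have SSK : dot S S <= (2 + K) ^+ 2 by rewrite SS; nra.
have rA : dot A Gu = (r - dot Gu Gu) / 2.
  by rewrite /r !dotE AA (dotC Gu A); field.
have rB : dot B Gv = (r - dot Gv Gv) / 2.
  by rewrite /r c1 !dotE BB (dotC Gv B); field.
have cAB : dot B Gu + dot A Gv = - dot Gu Gv.
  by move: c2; rewrite !dotE AB (dotC Gu B) => /eqP; rewrite add0r => /eqP; lra.
have one_sq x : dot x x = 1 -> dot x x <= (1 : R) ^+ 2 by move=> ->; rewrite expr1n.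
(* Here [r = 2 dot A Gu + dot Gu Gu] is at most [2 e + e ^ 2] in absolute value; with [6 e <= 1]
   this keeps [1 + r] above [1 / 2]. *)
have re : `|r| <= 3 * e.
  have := dot_le ler01 e0 (one_sq _ AA) Gue; have := dot_ge0 Gu.
  rewrite mul1r rA => ? /ler_normlP[? ?]; apply/ler_normlP; split; nra.
have r1 : 1 / 2 <= 1 + r by move/ler_normlP: re => [? ?]; lra.
have s_e : `|dot S Ga| <= (2 + K) * e by apply: dot_le => //; lra.
pose t1 := dot (A + Gu) (S + Ga); pose t2 := dot (B + Gv) (S + Ga).
have t_le X G : dot X X = 1 -> dot X S = 0 -> dot G G <= e ^+ 2 ->
    `|dot (X + G) (S + Ga)| <= (4 + K) * e.
  move=> XX XS Ge.
  have h1 := dot_le ler01 e0 (one_sq _ XX) Gae.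
  have h2 : `|dot G S| <= e * (2 + K) by apply: dot_le => //; lra.
  have h3 := dot_le e0 e0 Ge Gae.
  rewrite dotDl !(dotDr _ S) XS add0r.
  move/ler_normlP: h1 => [? ?]; move/ler_normlP: h2 => [? ?]; move/ler_normlP: h3 => [? ?].
  apply/ler_normlP; split; nra.
have t1e : `|t1| <= (4 + K) * e by exact: t_le.
have t2e : `|t2| <= (4 + K) * e by exact: t_le.
have tt : t1 ^+ 2 + t2 ^+ 2 <= 2 * ((4 + K) * e) ^+ 2.
  have p0 : 0 <= (4 + K) * e by apply: mulr_ge0 => //; lra.
  rewrite -[t1 ^+ 2]real_normK ?num_real// -[t2 ^+ 2]real_normK ?num_real//.
  by rewrite mulr_natl mulr2n lerD// lerXn2r// nnegrE.
have gg := dot_le e0 e0 Gue Gve.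
rewrite /energy_density -/t1 -/t2 -/S -[dot (A + Gu) (A + Gu)](subrK 1) -/r.
have -> : dot (S + Ga) (S + Ga) = 4 + k ^+ 2 + 2 * dot S Ga + dot Ga Ga.
  by rewrite dotDl !(dotDr _ S) SS (dotC Ga S); ring.
have -> : - dot f Ga + k / 2 * dot N Ga = dot S Ga / 2 by rewrite !dotE; field.
rewrite rA rB cAB.
move: (dot S Ga) (dot Gu Gu) (dot Gv Gv) (dot Gu Gv) (dot Ga Ga) (dot_ge0 Gu)
  (dot_ge0 Gv) (dot_ge0 Ga) s_e gg Gue Gve Gae => s gu gv c ga gu0 gv0 ga0 s_e gg Gue Gve Gae.
clearbody t1 t2 r.
have r10 : 1 + r != 0 by rewrite gt_eqF//; lra.
set E := (X in `|X| <= _).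
have -> : E = (ga - 2 * (s * r) + (4 + k ^+ 2) * (r * r)) * (4 * (1 + r))^-1
   - (t1 ^+ 2 + t2 ^+ 2) * (4 * ((1 + r) * (1 + r)))^-1
   - ((1 + 3 / 4 * k ^+ 2 + m) / 2 * gu - (m + k ^+ 2 / 4 - 1) / 2 * gv - (n - k) * c).
  by rewrite /E; field.
apply: expansion_remainder => //; by apply/andP.
Qed.

End Expansion.

(** * First variation in a moving frame *)

Section CkCalculus.
Context {R : realType}.

Lemma Ck_differentiable (V W : normedModType R) (U : set V) k (f : V -> W) x :
  Ck U k.+1 f -> U x -> differentiable f x.
Proof. by case=> + _; exact. Qed.

Lemma Ck_derive (V W : normedModType R) (U : set V) k (f : V -> W) v :
  Ck U k.+1 f -> Ck U k (fun x => 'D_v f x).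
Proof. by case=> _; exact. Qed.

Lemma Ck_continuous (V W : normedModType R) (U : set V) k (f : V -> W) x :
  Ck U k f -> U x -> {for x, continuous f}.
Proof.
case: k => [|k] cf Ux; first exact: cf.
exact: differentiable_continuous (Ck_differentiable cf Ux).
Qed.

Lemma CkS (V W : normedModType R) (U : set V) k (f : V -> W) : Ck U k.+1 f -> Ck U k f.
Proof.
elim: k f => [|k IH] f cf; first by move=> x Ux; exact: Ck_continuous cf Ux.
by split => [x Ux|v]; [exact: Ck_differentiable cf Ux|apply: IH; exact: Ck_derive].
Qed.

Lemma CkB (V W : normedModType R) k (f g : V -> W) :
  Ck setT k f -> Ck setT k g -> Ck setT k (fun x => f x - g x).
Proof.
elim: k f g => [|k IH] f g cf cg.
  by move=> x _; apply: cvgB; [exact: cf|exact: cg].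
split => [x _|v].
  by apply: differentiableB; [exact: (cf.1 x)|exact: (cg.1 x)].
have -> : (fun x => 'D_v (fun x => f x - g x) x) = (fun x => 'D_v f x - 'D_v g x).
  apply/funext => x; apply: (@deriveB _ _ _ f g); apply: diff_derivable.
    exact: cf.1.
  exact: cg.1.
by apply: IH; exact: Ck_derive.
Qed.

Context {V : normedModType R}.
Implicit Types (f g : V -> R) (x v : V).

Lemma is_derive_addv f g x v (a b : R) : is_derive x v f a -> is_derive x v g b ->
  is_derive x v (fun y => f y + g y) (a + b).
Proof. by move=> df dg; exact: is_deriveD. Qed.

Lemma is_derive_mulv f g x v (a b : R) : is_derive x v f a -> is_derive x v g b ->
  is_derive x v (fun y => f y * g y) (a * g x + f x * b).
Proof.
move=> df dg; apply: (is_derive_eq (is_deriveM df dg)).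
by rewrite /GRing.scale/= addrC [g x * a]mulrC.
Qed.

Lemma is_derive_scalev f x v (a c : R) : is_derive x v f a ->
  is_derive x v (fun y => c * f y) (c * a).
Proof. by move=> df; apply: (is_derive_eq (is_deriveZ c df)). Qed.

Lemma C1D f g : Ck setT 1 f -> Ck setT 1 g -> Ck setT 1 (fun x => f x + g x).
Proof.
move=> cf cg; split => [x _|v].
  by apply: differentiableD; [exact: (cf.1 x)|exact: (cg.1 x)].
have -> : (fun x => 'D_v (fun x => f x + g x) x) = (fun x => 'D_v f x + 'D_v g x).
  apply/funext => x; apply: (@deriveD _ _ _ f g); apply: diff_derivable.
    exact: cf.1.
  exact: cg.1.
by move=> x _; apply: cvgD; [exact: (cf.2 v x)|exact: (cg.2 v x)].
Qed.

Lemma C1M f g : Ck setT 1 f -> Ck setT 1 g -> Ck setT 1 (fun x => f x * g x).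
Proof.
move=> cf cg; split => [x _|v].
  by apply: differentiableM; [exact: (cf.1 x)|exact: (cg.1 x)].
have -> : (fun x => 'D_v (fun x => f x * g x) x) =
    (fun x => 'D_v f x * g x + f x * 'D_v g x).
  apply/funext => x; apply: (derive_val (is_derive := is_derive_mulv
    (derivableP (diff_derivable _)) (derivableP (diff_derivable _)))).
    exact: cf.1.
  exact: cg.1.
move=> x _; have cfx := Ck_continuous cf (I : setT x); have cgx := Ck_continuous cg (I : setT x).
by apply: cvgD; apply: cvgM => //; [exact: (cf.2 v x)|exact: (cg.2 v x)].
Qed.

Lemma C1_cst (a : R) : Ck setT 1 (fun _ : V => a).
Proof.
split => [x _|v x _]; first exact: differentiable_cst.
have -> : (fun x : V => 'D_v (fun _ : V => a) x) = cst 0.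
  by apply/funext => y; exact: derive_cst.
exact: cvg_cst.
Qed.

Lemma C1_dot (F G : V -> 'rV[R]_4) : Ck setT 1 F -> Ck setT 1 G ->
  Ck setT 1 (fun x => dot (F x) (G x) : R).
Proof.
move=> cF cG; split => [x _|v].
  by apply: differentiable_dot; [exact: (cF.1 x)|exact: (cG.1 x)].
have -> : (fun x => 'D_v (fun x => dot (F x) (G x) : R) x) =
    (fun x => dot ('D_v F x) (G x) + dot (F x) ('D_v G x)).
  apply/funext => x; apply: derive_dot; apply: diff_derivable.
    exact: cF.1.
  exact: cG.1.
have cF0 y : {for y, continuous F} by exact: Ck_continuous cF I.
have cG0 y : {for y, continuous G} by exact: Ck_continuous cG I.
move=> x _; apply: cvgD.
  by apply: (@continuous_dot _ _ (fun x => 'D_v F x) G) => // y; exact: (cF.2 v y).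
by apply: (@continuous_dot _ _ F (fun x => 'D_v G x)) => // y; exact: (cG.2 v y).
Qed.

End CkCalculus.

Section Frame.
Context {R : realType}.

(* The moving frame of a Hopf torus over a curve of curvature [k]: [A] is the
   horizontal and [B] the fibre direction, [N] the normal in the sphere.  The
   last field is the constrained elastica equation. *)
Record hopf_frame (w1 w2 u v : R * R) (f A B N : R * R -> 'rV[R]_4)
    (k k1 : R * R -> R) (m n : R) : Prop := HopfFrame {
  frame_C2 : smooth_on setT f;
  frame_C1 : [/\ Ck setT 1 A, Ck setT 1 B, Ck setT 1 N, Ck setT 1 k & Ck setT 1 k1];
  frame_per : Defs.periodic (lattice w1 w2) f;
  frame_perA : Defs.periodic (lattice w1 w2) A;
  frame_perB : Defs.periodic (lattice w1 w2) B;
  frame_perN : Defs.periodic (lattice w1 w2) N;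
  frame_perk : Defs.periodic (lattice w1 w2) k;
  frame_perk1 : Defs.periodic (lattice w1 w2) k1;
  frame_unit : forall z, [/\ dot (f z) (f z) = 1, dot (A z) (A z) = 1,
    dot (B z) (B z) = 1 & dot (N z) (N z) = 1];
  frame_orth : forall z, [/\ dot (f z) (A z) = 0, dot (f z) (B z) = 0 &
    dot (f z) (N z) = 0] /\ [/\ dot (A z) (B z) = 0, dot (A z) (N z) = 0 &
    dot (B z) (N z) = 0];
  frame_Du : forall z, [/\ 'D_u f z = A z, 'D_u A z = - f z + k z *: N z,
    'D_u B z = N z & 'D_u N z = - B z - k z *: A z];
  frame_Dv : forall z, [/\ 'D_v f z = B z, 'D_v A z = N z,
    'D_v B z = - f z & 'D_v N z = - A z];
  frame_Dk : forall z, 'D_u k z = k1 z /\ 'D_v k z = 0;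
  frame_Dk1 : forall z, 'D_v k1 z = 0 /\
    'D_u k1 z = - (k z ^+ 3 / 2 + 2 * (1 + m) * k z - 4 * n)
}.

(** The first variation of the density, plus [- (m + k ^ 2 / 2)] times [dot A Gu - dot B Gv] and
    [n - k] times [dot B Gu + dot A Gv], the linearised conformal constraints. The parts of the
    multipliers in [k] are those that make the sum a divergence. *)
Definition linear_variation (f A B N : 'rV[R]_4) (k m n : R) (Gu Gv Ga : 'rV[R]_4) : R :=
  - dot f Ga + k / 2 * dot N Ga - (1 + 3 / 4 * k ^+ 2 + m) * dot A Gu
  + (m + k ^+ 2 / 4 - 1) * dot B Gv + (n - k) * (dot B Gu + dot A Gv).

(** The right-hand side is the product rule for ['D_u P + 'D_v Q] in [frame_divergence], with the
    frame equations inserted. The undifferentiated [g] survives only against [N], and there the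
    elastica equation cancels it. *)
Lemma frame_identity (f A B N Guu Gvv Gu Gv g : 'rV[R]_4) (k k1 m n : R) :
  linear_variation f A B N k m n Gu Gv (Guu + Gvv) =
  -1 * (dot A Gu + dot f Guu) +
  2^-1 * (k1 * dot N Gu + k * (dot (- B - k *: A) Gu + dot N Guu)) +
  - m * (dot (- f + k *: N) g + dot A Gu) +
  - 4^-1 * ((k1 * k + k * k1) * dot A g + k * k * (dot (- f + k *: N) g + dot A Gu)) +
  n * (dot N g + dot B Gu) +
  - 2^-1 * (k1 * dot B g + k * (dot N g + dot B Gu)) +
  - 2^-1 * (- (k ^+ 3 / 2 + 2 * (1 + m) * k - 4 * n) * dot N g +
    k1 * (dot (- B - k *: A) g + dot N Gu)) +
  (-1 * (dot B Gv + dot f Gvv) +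
   2^-1 * (0 * dot N Gv + k * (dot (- A) Gv + dot N Gvv)) +
   n * (dot N g + dot A Gv) +
   - 2^-1 * (0 * dot A g + k * (dot N g + dot A Gv)) +
   m * (dot (- f) g + dot B Gv) +
   4^-1 * ((0 * k + k * 0) * dot B g + k * k * (dot (- f) g + dot B Gv))).
Proof. by rewrite /linear_variation !dotE; field. Qed.

Lemma frame_divergence w1 w2 u v f A B N k k1 m n (G : R * R -> 'rV[R]_4) :
  R_independent w1 w2 -> hopf_frame w1 w2 u v f A B N k k1 m n ->
  Ck setT 2 G -> Defs.periodic (lattice w1 w2) G ->
  torus_integral w1 w2 (fun z => linear_variation (f z) (A z) (B z) (N z) (k z) m n
    ('D_u G z) ('D_v G z) ('D_u (fun z => 'D_u G z) z + 'D_v (fun z => 'D_v G z) z)) = 0.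
Proof.
move=> wi [C2 [CA CB CN Ck0 Ck1] perf perA perB perN perk perk1 _ _ Du Dv Dk Dk1] CG perG.
have CG1 : Ck setT 1 G by exact: CkS.
have Cf : Ck setT 1 f by exact: C2.
have CGu : Ck setT 1 (fun z => 'D_u G z) by exact: Ck_derive.
have CGv : Ck setT 1 (fun z => 'D_v G z) by exact: Ck_derive.
have perD w z l : lattice w1 w2 l -> 'D_w G (z + l) = 'D_w G z.
  move=> Ll; rewrite -(@derive_slice _ _ _ _ G (fun z => z + l) z w w) => [|h].
    by congr ('D_w _ z); apply/funext => y; exact: perG.
  by rewrite addrA.
(* [P] and [Q] collect the boundary terms that arise when all derivatives in [linear_variation] are
   moved off [G] by parts, in the directions [u] and [v] respectively. *)
pose P z : R := (-1) * dot (f z) ('D_u G z) + 2^-1 * (k z * dot (N z) ('D_u G z))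
  + (- m) * dot (A z) (G z) + (- 4^-1) * (k z * k z * dot (A z) (G z))
  + n * dot (B z) (G z) + (- 2^-1) * (k z * dot (B z) (G z))
  + (- 2^-1) * (k1 z * dot (N z) (G z)).
pose Q z : R := (-1) * dot (f z) ('D_v G z) + 2^-1 * (k z * dot (N z) ('D_v G z))
  + n * dot (A z) (G z) + (- 2^-1) * (k z * dot (A z) (G z))
  + m * dot (B z) (G z) + 4^-1 * (k z * k z * dot (B z) (G z)).
have CP : Ck setT 1 P.
  exact: (C1D (C1D (C1D (C1D (C1D (C1D (C1M (C1_cst _) (C1_dot Cf CGu))
    (C1M (C1_cst _) (C1M Ck0 (C1_dot CN CGu)))) (C1M (C1_cst _) (C1_dot CA CG1)))
    (C1M (C1_cst _) (C1M (C1M Ck0 Ck0) (C1_dot CA CG1))))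
    (C1M (C1_cst _) (C1_dot CB CG1))) (C1M (C1_cst _) (C1M Ck0 (C1_dot CB CG1))))
    (C1M (C1_cst _) (C1M Ck1 (C1_dot CN CG1)))).
have CQ : Ck setT 1 Q.
  exact: (C1D (C1D (C1D (C1D (C1D (C1M (C1_cst _) (C1_dot Cf CGv))
    (C1M (C1_cst _) (C1M Ck0 (C1_dot CN CGv)))) (C1M (C1_cst _) (C1_dot CA CG1)))
    (C1M (C1_cst _) (C1M Ck0 (C1_dot CA CG1)))) (C1M (C1_cst _) (C1_dot CB CG1)))
    (C1M (C1_cst _) (C1M (C1M Ck0 Ck0) (C1_dot CB CG1)))).
have perP : Defs.periodic (lattice w1 w2) P.
  move=> z l Ll; rewrite /P (perf z l Ll) (perA z l Ll) (perB z l Ll) (perN z l Ll).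
  by rewrite (perk z l Ll) (perk1 z l Ll) (perG z l Ll) (perD u z l Ll).
have perQ : Defs.periodic (lattice w1 w2) Q.
  move=> z l Ll; rewrite /Q (perf z l Ll) (perA z l Ll) (perB z l Ll) (perN z l Ll).
  by rewrite (perk z l Ll) (perG z l Ll) (perD v z l Ll).
have dC (W : normedModType R) (H : R * R -> W) z w : Ck setT 1 H -> is_derive z w H ('D_w H z).
  by move=> CH; apply: derivableP; apply: diff_derivable; exact: CH.1.
have IP := torus_integral_derive u wi perP (fun z => CP.1 z I) (fun w z => CP.2 w z I).
have IQ := torus_integral_derive v wi perQ (fun z => CQ.1 z I) (fun w z => CQ.2 w z I).
rewrite -[RHS](addr0 0) -{1}IP -IQ -torus_integralD; last 2 first.
- by move=> z; exact: CP.2.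
- by move=> z; exact: CQ.2.
apply: eq_torus_integral => z.
have [Duf DuA DuB DuN] := Du z; have [Dvf DvA DvB DvN] := Dv z.
have [Duk Dvk] := Dk z; have [Dvk1 Duk1] := Dk1 z.
have gG w := dC _ G z w CG1.
have gu w := dC _ (fun z => 'D_u G z) z w CGu; have gv w := dC _ (fun z => 'D_v G z) z w CGv.
have df w := dC _ f z w Cf; have dA w := dC _ A z w CA; have dB w := dC _ B z w CB.
have dN w := dC _ N z w CN; have dk w := dC _ k z w Ck0; have dk1 w := dC _ k1 z w Ck1.
have DP := is_derive_addv (is_derive_addv (is_derive_addv (is_derive_addv (is_derive_addv
  (is_derive_addv
  (is_derive_scalev (-1) (is_derive_dot (df u) (gu u)))
  (is_derive_scalev 2^-1 (is_derive_mulv (dk u) (is_derive_dot (dN u) (gu u)))))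
  (is_derive_scalev (- m) (is_derive_dot (dA u) (gG u))))
  (is_derive_scalev (- 4^-1) (is_derive_mulv (is_derive_mulv (dk u) (dk u))
     (is_derive_dot (dA u) (gG u)))))
  (is_derive_scalev n (is_derive_dot (dB u) (gG u))))
  (is_derive_scalev (- 2^-1) (is_derive_mulv (dk u) (is_derive_dot (dB u) (gG u)))))
  (is_derive_scalev (- 2^-1) (is_derive_mulv (dk1 u) (is_derive_dot (dN u) (gG u)))).
have DQ := is_derive_addv (is_derive_addv (is_derive_addv (is_derive_addv (is_derive_addv
  (is_derive_scalev (-1) (is_derive_dot (df v) (gv v)))
  (is_derive_scalev 2^-1 (is_derive_mulv (dk v) (is_derive_dot (dN v) (gv v)))))
  (is_derive_scalev n (is_derive_dot (dA v) (gG v))))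
  (is_derive_scalev (- 2^-1) (is_derive_mulv (dk v) (is_derive_dot (dA v) (gG v)))))
  (is_derive_scalev m (is_derive_dot (dB v) (gG v))))
  (is_derive_scalev 4^-1 (is_derive_mulv (is_derive_mulv (dk v) (dk v))
     (is_derive_dot (dB v) (gG v)))).
have -> : 'D_u P z = _ := derive_val (is_derive := DP).
have -> : 'D_v Q z = _ := derive_val (is_derive := DQ).
rewrite Duf DuA DuB DuN Dvf DvA DvB DvN Duk Dvk Duk1.
exact: frame_identity.
Qed.

End Frame.

(** * Uniform estimates in the deformation parameter *)

Section ParameterBounds.
Context {R : realType}.

Lemma derivative_bound (g g' : R -> R) (C d : R) : 0 <= C ->
  (forall s, `|s| <= d -> is_derive s (1 : R) g (g' s) /\ `|g' s| <= C) ->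
  forall t, `|t| <= d -> `|g t - g 0| <= C * `|t|.
Proof.
move=> C0 dg.
have main a b : - d <= a -> b <= d -> a <= b -> `|g b - g a| <= C * `|b - a|.
  move=> da bd ab.
  have ind s : s \in `[a, b] -> `|s| <= d.
    by rewrite in_itv/= => /andP[? ?]; apply/ler_normlP; split; lra.
  have [||c cab ->] := @MVT_segment _ g g' a b ab.
  - by move=> s sab; have [] := dg s (ind s (subset_itv_oo_cc sab)).
  - apply: continuous_in_subspaceT => s /set_mem sab.
    have [dgs _] := dg s (ind s sab).
    by apply: differentiable_continuous; apply/derivable1_diffP; have [] := dgs.
  by rewrite normrM ler_wpM2r//; have [] := dg c (ind c cab).
move=> t /ler_normlP[? ?]; have [t0|t0] := leP 0 t.
  by have := main 0 t; rewrite subr0; apply; lra.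
by have := main t 0; rewrite distrC sub0r normrN; apply; lra.
Qed.

(** A quadratic bound gives both the existence of the derivative and its vanishing, so nothing has
    to be known beforehand on the dependence of the energy on [t]. *)
Lemma is_derive_quadratic (W : R -> R) (M d : R) : 0 < d -> 0 <= M ->
  (forall t, `|t| < d -> `|W t - W 0| <= M * `|t| ^+ 2) -> is_derive (0 : R) (1 : R) W 0.
Proof.
move=> d0 M0 HW.
have lim0 : h^-1 *: (W (h *: (1 : R) + 0) - W 0) @[h --> (0 : R)^'] --> (0 : R).
  apply/cvgrPdist_le => e e0; near=> h.
  have h0 : 0 < `|h| by rewrite normr_gt0; near: h; exact: nbhs_dnbhs_neq.
  have hd : `|h| < d.
    near: h; apply: dnbhs0_lt; exact: d0.
  have he : `|h| <= e / (M + 1).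
    near: h; apply: dnbhs0_le; rewrite divr_gt0//; lra.
  rewrite sub0r normrN addr0 /GRing.scale/= mulr1 normrM normfV.
  rewrite ler_pdivrMl//; apply: (le_trans (HW _ hd)).
  rewrite expr2 mulrA [X in _ <= X]mulrC ler_wpM2r//.
  apply: (le_trans (ler_wpM2l M0 he)).
  by rewrite mulrA ler_pdivrMr; nra.
split; first by apply/cvg_ex; exists 0.
exact: (cvg_lim _ lim0).
Unshelve. all: by end_near. Qed.

Let slab (eps : R) : set (R * (R * R)) := [set p | `|p.1| < eps].

Lemma param_lipschitz (h D : R * (R * R) -> R) (eps : R) (K : set (R * R)) : 0 < eps ->
  (forall p, slab eps p -> is_derive p ((1, 0) : R * (R * R)) h (D p)) ->
  (forall p, slab eps p -> {for p, continuous D}) -> compact K ->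
  exists2 C, 0 <= C & forall t z, `|t| <= eps / 2 -> K z ->
    `|h (t, z) - h (0, z)| <= C * `|t|.
Proof.
move=> eps0 dh cD cK.
have /compact_bounded [M [Mr HM]] : compact (D @` (`[- (eps / 2), eps / 2] `*` K)).
  apply: continuous_compact; last by apply: compact_setX => //; exact: segment_compact.
  apply: continuous_in_subspaceT => p /set_mem [/=]; rewrite in_itv/= => /andP[? ?] _.
  by apply: cD; rewrite /slab/=; apply/ltr_normlP; split; lra.
pose C := `|M| + 1; exists C; first by rewrite addr_ge0.
move=> t z td Kz.
apply: (@derivative_bound (fun t => h (t, z)) (fun t => D (t, z)) C (eps / 2)) => //.
  by rewrite addr_ge0.
move=> s sd; have /ler_normlP[? ?] := sd.
split; last first.
  apply: HM; first by rewrite (le_lt_trans (ler_norm M))// ltrDl.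
  by exists (s, z) => //; split=> //=; rewrite in_itv/=; apply/andP; split; lra.
have sl : slab eps (s, z) by rewrite /slab/=; apply/ltr_normlP; split; lra.
have [dhs <-] := dh _ sl.
have gE (r : R) : (r *: (1 : R) + s, z) = r *: ((1, 0) : R * (R * R)) + (s, z).
  by congr (_, _); rewrite /= scaler0 add0r.
split.
  exact: (@derivable_slice R R _ R h (fun t => (t, z)) s (1 : R) _ gE dhs).
exact: (@derive_slice R R _ R h (fun t => (t, z)) s (1 : R) _ gE).
Qed.

Lemma param_lipschitz_mx (F : R * (R * R) -> 'rV[R]_4) (eps : R) (K : set (R * R)) :
  0 < eps -> Ck (slab eps) 1 F -> compact K ->
  exists2 C, 0 <= C & forall t z, `|t| <= eps / 2 -> K z ->
    dot (F (t, z) - F (0, z)) (F (t, z) - F (0, z)) <= (C * `|t|) ^+ 2.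
Proof.
move=> eps0 [dF cD] cK.
have comp (i : 'I_4) : exists C, 0 <= C /\ forall t z, `|t| <= eps / 2 -> K z ->
    `|(F (t, z) - F (0, z)) 0 i| <= C * `|t|.
  have [p Up|p Up|C C0 HC] := @param_lipschitz (fun p => F p 0 i)
    (fun p => 'D_((1, 0) : R * (R * R)) F p 0 i) eps K eps0 _ _ cK.
  - have dFp := diff_derivable (dF p Up) (v := ((1, 0) : R * (R * R))).
    have /derivable_mxP dFp' := dFp; split; first exact: dFp'.
    by rewrite derive_mx// mxE.
  - exact: (continuous_comp (cD ((1, 0) : R * (R * R)) p Up) (@coord_continuous _ _ _ _ _ _)).
  by exists C; split => // t z td Kz; rewrite !mxE; exact: HC.
have [C HC] := choice comp.
have C0 i : 0 <= C i by have [] := HC i.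
(* The sum of the constants of the coordinates dominates their Euclidean norm. *)
exists (\sum_i C i); first exact: sumr_ge0.
move=> t z td Kz.
apply: (@le_trans _ _ (\sum_i (C i * `|t|) ^+ 2)).
  apply: ler_sum => i _; rewrite -expr2 -real_normK ?num_real//.
  by rewrite lerXn2r ?nnegrE ?mulr_ge0//; have [_] := HC i; exact.
rewrite exprMn (eq_bigr (fun i => C i ^+ 2 * `|t| ^+ 2)) => [|i _]; last by rewrite exprMn.
rewrite -mulr_suml ler_wpM2r ?sqr_ge0// expr2 mulr_suml.
apply: ler_sum => i _; rewrite expr2 ler_wpM2l//.
by rewrite (bigD1 i)//= lerDl sumr_ge0.
Qed.

Lemma dot_add_le (a b : 'rV[R]_4) (x y : R) : 0 <= x -> 0 <= y ->
  dot a a <= x ^+ 2 -> dot b b <= y ^+ 2 -> dot (a + b) (a + b) <= (x + y) ^+ 2.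
Proof.
move=> x0 y0 ax byy; have /ler_normlP[_ ?] := dot_le x0 y0 ax byy.
rewrite !dotE (dotC b a); nra.
Qed.

End ParameterBounds.

Section ConstrainedWillmore.
Context {R : realType}.
Implicit Types (f F : R * R -> 'rV[R]_4).

Lemma energy_density_continuous (a b d : R * R -> 'rV[R]_4) : continuous a ->
  continuous b -> continuous d -> (forall z, dot (a z) (a z) != 0) ->
  continuous (fun z => energy_density (a z) (b z) (d z)).
Proof.
move=> ca cb cd a0 z.
have cda := @continuous_dot _ _ a d ca cd z; have cdb := @continuous_dot _ _ b d cb cd z.
have cdd := @continuous_dot _ _ d d cd cd z; have caa := @continuous_dot _ _ a a ca ca z.
rewrite /energy_density; apply: cvgM; last first.
  by apply: cvgV; [rewrite mulf_neq0|apply: cvgM => //; exact: cvg_cst].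
apply: cvgB => //; apply: cvgM; last by apply: cvgV.
by apply: cvgD; apply: cvgM.
Qed.

Lemma linear_variation_continuous (f A B N a b d : R * R -> 'rV[R]_4) (k : R * R -> R) m n :
  continuous f -> continuous A -> continuous B -> continuous N -> continuous k ->
  continuous a -> continuous b -> continuous d ->
  continuous (fun z => linear_variation (f z) (A z) (B z) (N z) (k z) m n (a z) (b z) (d z)).
Proof.
move=> cf cA cB cN ck ca cb cd z.
have c1 := @continuous_dot _ _ f d cf cd z; have c2 := @continuous_dot _ _ N d cN cd z.
have c3 := @continuous_dot _ _ A a cA ca z; have c4 := @continuous_dot _ _ B b cB cb z.
have c5 := @continuous_dot _ _ B a cB ca z; have c6 := @continuous_dot _ _ A b cA cb z.
have k0 := ck z.
have cst0 (c : R) : {for z, continuous (fun _ : R * R => c)} by exact: cvg_cst.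
have k2 : {for z, continuous (fun z => k z ^+ 2)} by apply: cvgM.
rewrite /linear_variation; apply: cvgD; last first.
  by apply: cvgM; [apply: cvgB => //; exact: cst0|apply: cvgD].
apply: cvgD; last first.
  apply: cvgM => //; apply: cvgB; last exact: cst0.
  by apply: cvgD; [exact: cst0|apply: cvgM => //; exact: cst0].
apply: cvgB; last first.
  apply: cvgM => //; apply: cvgD; last exact: cst0.
  by apply: cvgD; [exact: cst0|apply: cvgM => //; exact: cst0].
apply: cvgD; first exact: cvgN.
by apply: cvgM => //; apply: cvgM => //; exact: cst0.
Qed.

Lemma conformal_dir F z u v (s : R) : conformal F -> u != 0 -> s ^+ 2 = 1 ->
  v = (- s * u.2, s * u.1) ->
  [/\ dot ('D_u F z) ('D_u F z) = dot ('D_v F z) ('D_v F z),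
      dot ('D_u F z) ('D_v F z) = 0 & dot ('D_u F z) ('D_u F z) != 0].
Proof.
move=> /(_ z)[r r0 cF] u0 s1 vE.
have h : 0 < u.1 ^+ 2 + u.2 ^+ 2.
  rewrite lt_neqAle addr_ge0 ?sqr_ge0// andbT eq_sym paddr_eq0 ?sqr_ge0//.
  by rewrite !sqrf_eq0; move: u0; case: (u) => a b; rewrite -pair_eqE.
split.
- apply: (etrans (cF u u)); apply/esym; apply: (etrans (cF v v)); rewrite vE /=.
  rewrite [LHS](_ : _ = r * (s ^+ 2 * (u.1 ^+ 2 + u.2 ^+ 2))); last by ring.
  by rewrite s1 mul1r !expr2.
- by apply: (etrans (cF u v)); rewrite vE /=; ring.
- apply/eqP => duu; have /eqP := etrans (esym (cF u u)) duu.
  by apply/negP; rewrite mulf_neq0 ?gt_eqF// -!expr2.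
Qed.

Lemma par_compact (w1 w2 : R * R) : compact ((fun p : R * R => p.1 *: w1 + p.2 *: w2) @`
  (`[0, 1] `*` `[0, 1])).
Proof.
apply: continuous_compact; last by apply: compact_setX; exact: segment_compact.
by apply: continuous_subspaceT => p; exact: continuous_par.
Qed.

(** The space derivatives of each [F t] are directional derivatives of the joint map along [(0, w)];
    thus joint smoothness controls how they vary with [t]. *)
Lemma slice_derive (F : R -> R * R -> 'rV[R]_4) t z w :
  'D_w (F t) z = 'D_((0, w) : R * (R * R)) (fun p : R * (R * R) => F p.1 p.2) (t, z).
Proof.
apply: (@derive_slice R _ _ _ (fun p : R * (R * R) => F p.1 p.2) (fun z => (t, z)) z w).
by move=> h; congr (_, _); rewrite /= scaler0 add0r.
Qed.

Lemma willmoreE w1 w2 F u v (s : R) : conformal_immersion w1 w2 F ->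
  u != 0 -> s ^+ 2 = 1 -> v = (- s * u.2, s * u.1) ->
  let E z := energy_density ('D_u F z) ('D_v F z)
    ('D_u (fun z => 'D_u F z) z + 'D_v (fun z => 'D_v F z) z) in
  continuous E /\
  willmore w1 w2 F = (u.1 ^+ 2 + u.2 ^+ 2)^-1 * torus_integral w1 w2 E.
Proof.
move=> [[_ S sF _] cF] u0 s1 vE E.
have dF z : differentiable F z by exact: (Ck_differentiable (sF 1%N) I).
have ddF w z : differentiable (fun z => 'D_w F z) z.
  exact: (Ck_differentiable (Ck_derive w (sF 2%N)) I).
have cDF w : continuous (fun z => 'D_w F z).
  by move=> z; exact: (Ck_continuous (Ck_derive w (sF 1%N)) I).
have cDDF w : continuous (fun z => 'D_w (fun z => 'D_w F z) z).
  by move=> z; exact: (Ck_continuous (Ck_derive w (Ck_derive w (sF 2%N))) I).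
have cE : continuous E.
  apply: energy_density_continuous; [exact: cDF|exact: cDF| |].
    by move=> z; apply: cvgD; exact: cDDF.
  by move=> z; have [] := conformal_dir z cF u0 s1 vE.
split => //; rewrite -torus_integralZ//; apply: eq_torus_integral => z.
exact: (willmore_densityE z S dF ddF cF u0 s1 vE).
Qed.

(** All derivatives at one point are replaced by plain vectors, so the estimate is linear algebra.
    The four Lipschitz constants are merged into the single size [e] of [energy_expansion]. *)
Lemma variation_estimate (f A B N a b p q a0 b0 p0 q0 Gu Gv Guu Gvv : 'rV[R]_4)
    (k m n K x y z w t : R) :
  [/\ dot f f = 1, dot A A = 1, dot B B = 1 & dot N N = 1] ->
  [/\ dot f A = 0, dot f B = 0 & dot f N = 0] /\
  [/\ dot A B = 0, dot A N = 0 & dot B N = 0] ->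
  1 <= K -> `|k| <= K -> `|m| <= K -> `|n| <= K ->
  a0 = A -> b0 = B -> p0 = - f + k *: N -> q0 = - f ->
  Gu = a - a0 -> Gv = b - b0 -> Guu = p - p0 -> Gvv = q - q0 ->
  0 <= x -> 0 <= y -> 0 <= z -> 0 <= w -> 0 <= t -> 6 * ((x + y + z + w + 1) * t) <= 1 ->
  dot (a - a0) (a - a0) <= (x * t) ^+ 2 -> dot (b - b0) (b - b0) <= (y * t) ^+ 2 ->
  dot (p - p0) (p - p0) <= (z * t) ^+ 2 -> dot (q - q0) (q - q0) <= (w * t) ^+ 2 ->
  dot a a = dot b b -> dot a b = 0 ->
  `|energy_density a b (p + q) - energy_density a0 b0 (p0 + q0)
    - linear_variation f A B N k m n Gu Gv (Guu + Gvv)|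
  <= 200 * K ^+ 2 * ((x + y + z + w + 1) * t) ^+ 2.
Proof.
move=> [ff AA BB NN] [[fA fB fN] [AB AN BN]] K1 kK mK nK -> -> -> ->.
move=> /esym/eqP; rewrite subr_eq => /eqP ->.
move=> /esym/eqP; rewrite subr_eq => /eqP ->.
move=> /esym/eqP; rewrite subr_eq => /eqP ->.
move=> /esym/eqP; rewrite subr_eq => /eqP ->.
rewrite !addrK.
move=> x0 y0 z0 w0 t0 e6 Gux Gvy Gpz Gqw c1 c2.
set e := (x + y + z + w + 1) * t.
have e0 : 0 <= e by rewrite mulr_ge0// !addr_ge0.
have le_e r : 0 <= r -> r <= x + y + z + w + 1 -> (r * t) ^+ 2 <= e ^+ 2.
  by move=> r0 rx; rewrite lerXn2r// ?nnegrE ?mulr_ge0// ler_wpM2r.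
have Gpq : dot (Guu + Gvv) (Guu + Gvv) <= e ^+ 2.
  apply: (le_trans (dot_add_le (mulr_ge0 z0 t0) (mulr_ge0 w0 t0) Gpz Gqw)).
  by rewrite -mulrDl le_e ?addr_ge0//; clear -x0 y0; lra.
have -> : Guu + (- f + k *: N) + (Gvv - f) = (- 2) *: f + k *: N + (Guu + Gvv).
  by apply/rowP => i; rewrite !mxE; ring.
have -> : energy_density A B (- f + k *: N - f) = (4 + k ^+ 2) / 4.
  rewrite /energy_density !dotE AA ff NN fN AN BN.
  by rewrite (dotC A f) (dotC B f) (dotC N f) fA fB fN; field.
rewrite (addrC Gu) (addrC Gv) in c1 c2 *.
apply: energy_expansion => //.
  by apply: le_trans Gux _; apply: le_e => //; clear -y0 z0 w0; lra.
by apply: le_trans Gvy _; apply: le_e => //; clear -x0 z0 w0; lra.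
Qed.

Lemma torus_integral_compare (w1 w2 : R * R) (f g h : R * R -> R) C :
  continuous f -> continuous g -> continuous h -> torus_integral w1 w2 h = 0 ->
  (forall x y, 0 <= x <= 1 -> 0 <= y <= 1 ->
    `|f (x *: w1 + y *: w2) - g (x *: w1 + y *: w2) - h (x *: w1 + y *: w2)| <= C) ->
  `|torus_integral w1 w2 f - torus_integral w1 w2 g| <= C * `|det2 w1 w2|.
Proof.
move=> cf cg ch Ih HC.
have cgh : continuous (fun z => g z + h z) by move=> z; apply: cvgD; [exact: cg|exact: ch].
have cN : continuous (fun z => (-1) * (g z + h z)).
  by move=> z; apply: cvgM; [exact: cvg_cst|exact: cgh].
have -> : torus_integral w1 w2 f - torus_integral w1 w2 g =
    torus_integral w1 w2 (fun z => f z + (-1) * (g z + h z)).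
  by rewrite torus_integralD// torus_integralZ// torus_integralD// Ih addr0 mulN1r.
apply: torus_integral_le => [z|x y x01 y01].
  by apply: cvgD; [exact: cf|exact: cN].
by rewrite mulN1r opprD addrA; exact: HC.
Qed.

Lemma le_dot_sub (a a' b b' : 'rV[R]_4) (x : R) : a' = a -> b' = b ->
  dot (a' - b') (a' - b') <= x -> dot (a - b) (a - b) <= x.
Proof. by move=> -> ->. Qed.

(** On the compact parallelogram the four derivatives entering the density are Lipschitz in [t], so
    the increment is of order [t]; its linear effect integrates to zero, and a remainder of order
    [t ^ 2] is left. *)
Theorem frame_constrained_willmore w1 w2 u v f A B N k k1 m n (s : R) :
  R_independent w1 w2 -> u != 0 -> s ^+ 2 = 1 -> v = (- s * u.2, s * u.1) ->
  hopf_frame w1 w2 u v f A B N k k1 m n -> constrained_willmore w1 w2 f.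
Proof.
move=> wi u0 s1 vE fr eps F [eps0 smF cF F0]; subst f.
set f := F 0 in fr *.
pose Ft (p : R * (R * R)) := F p.1 p.2.
have smFt' : smooth_on [set p : R * (R * R) | `|p.1| < eps] Ft := smF.
pose K := (fun p : R * R => p.1 *: w1 + p.2 *: w2) @` (`[0, 1] `*` `[0, 1]).
have cK : compact K := @par_compact w1 w2.
pose u' : R * (R * R) := (0, u); pose v' : R * (R * R) := (0, v).
have E1 t z w : 'D_((0, w) : R * (R * R)) Ft (t, z) = 'D_w (F t) z by rewrite slice_derive.
have E2 t z w : 'D_((0, w) : R * (R * R)) (fun p => 'D_((0, w) : R * (R * R)) Ft p) (t, z) =
    'D_w (fun z => 'D_w (F t) z) z.
  have -> : (fun p => 'D_((0, w) : R * (R * R)) Ft p) = (fun p => 'D_w (F p.1) p.2).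
    by apply/funext => -[r y]; exact: E1.
  exact: esym (slice_derive (fun t z => 'D_w (F t) z) t z w).
have lip1 w : exists2 C, 0 <= C & forall t z, `|t| <= eps / 2 -> K z ->
    dot ('D_w (F t) z - 'D_w (F 0) z) ('D_w (F t) z - 'D_w (F 0) z) <= (C * `|t|) ^+ 2.
  have [C C0 HC] := param_lipschitz_mx eps0 (Ck_derive ((0, w) : R * (R * R)) (smFt' 2%N)) cK.
  exists C; [exact: C0|move=> t z te Kz]; exact: le_dot_sub (E1 t z w) (E1 0 z w) (HC t z te Kz).
have lip2 w : exists2 C, 0 <= C & forall t z, `|t| <= eps / 2 -> K z ->
    dot ('D_w (fun z => 'D_w (F t) z) z - 'D_w (fun z => 'D_w (F 0) z) z)
        ('D_w (fun z => 'D_w (F t) z) z - 'D_w (fun z => 'D_w (F 0) z) z) <= (C * `|t|) ^+ 2.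
  have [C C0 HC] := param_lipschitz_mx eps0 (Ck_derive ((0, w) : R * (R * R))
    (Ck_derive ((0, w) : R * (R * R)) (smFt' 3%N))) cK.
  exists C; [exact: C0|move=> t z te Kz]; exact: le_dot_sub (E2 t z w) (E2 0 z w) (HC t z te Kz).
have [Cu Cu0 HCu] := lip1 u; have [Cv Cv0 HCv] := lip1 v.
have [Duu Duu0 HDuu] := lip2 u; have [Dvv Dvv0 HDvv] := lip2 v.
pose C := Cu + Cv + Duu + Dvv + 1.
have [C2 [CA CB CN Ck0 _] perf _ _ _ _ _ unit orth Du Dv _ _] := fr.
have [Kb [K1 mK nK kK]] : exists Kb, [/\ 1 <= Kb, `|m| <= Kb, `|n| <= Kb &
    forall z, K z -> `|k z| <= Kb].
  have /compact_bounded [M [_ HM]] : compact (k @` K).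
    apply: continuous_compact => //; apply: continuous_subspaceT => z.
    exact: Ck_continuous Ck0 I.
  exists (`|M| + 1 + `|m| + `|n|); split.
  - by have := normr_ge0 M; have := normr_ge0 m; have := normr_ge0 n; clear; lra.
  - by have := normr_ge0 M; have := normr_ge0 n; clear; lra.
  - by have := normr_ge0 M; have := normr_ge0 m; clear; lra.
  move=> z Kz; apply: (@le_trans _ _ (`|M| + 1)).
    by apply: HM; [rewrite (le_lt_trans (ler_norm M))// ltrDl|exists z].
  by have := normr_ge0 n; have := normr_ge0 m; clear; lra.
(* The first bound keeps [t] where the Lipschitz estimates hold, the second ensures the smallness
   [6 e <= 1] with [e = C |t|]. *)
pose d := Num.min (eps / 2) (6 * C)^-1.
have C1 : 1 <= C by rewrite /C; clear -Cu0 Cv0 Duu0 Dvv0; lra.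
have d0 : 0 < d by rewrite lt_min divr_gt0//= invr_gt0; clear -C1; lra.
pose l := u.1 ^+ 2 + u.2 ^+ 2.
have l0 : 0 <= l^-1 by rewrite invr_ge0 addr_ge0 ?sqr_ge0.
pose M := l^-1 * (200 * Kb ^+ 2 * C ^+ 2 * `|det2 w1 w2|).
have M0 : 0 <= M := mulr_ge0 l0 (mulr_ge0 (mulr_ge0 (mulr_ge0 (ler0n _ 200)
  (sqr_ge0 Kb)) (sqr_ge0 C)) (normr_ge0 _)).
apply: (@is_derive_quadratic _ _ M d d0 M0).
move=> t td.
have te2 : `|t| <= eps / 2 by move: td; rewrite lt_min => /andP[/ltW].
have te : `|t| < eps by apply: (le_lt_trans te2); clear -eps0; lra.
have e6 : 6 * (C * `|t|) <= 1.
  move: td; rewrite lt_min => /andP[_ /ltW h]; rewrite mulrA.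
  by rewrite -ler_pdivlMl ?mulr1//; clear -C1; lra.
have z0 : `|0 : R| < eps by rewrite normr0.
pose E r z := energy_density ('D_u (F r) z) ('D_v (F r) z)
  ('D_u (fun z => 'D_u (F r) z) z + 'D_v (fun z => 'D_v (F r) z) z).
have [cEt WEt] : continuous (E t) /\ willmore w1 w2 (F t) = l^-1 * torus_integral w1 w2 (E t)
  := willmoreE (cF t te) u0 s1 vE.
have [cE0 WE0] : continuous (E 0) /\ willmore w1 w2 (F 0) = l^-1 * torus_integral w1 w2 (E 0)
  := willmoreE (cF 0 z0) u0 s1 vE.
rewrite WEt WE0 {WEt WE0}.
pose G z := F t z - f z.
have smFt : smooth_on setT (F t) by have [[]] := cF t te.
have CG : Ck setT 2 G by apply: CkB; [exact: smFt|exact: C2].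
have perG : Defs.periodic (lattice w1 w2) G.
  by move=> z x Lx; rewrite /G perf//; have [[-> //]] := cF t te.
pose L z := linear_variation (f z) (A z) (B z) (N z) (k z) m n
    ('D_u G z) ('D_v G z) ('D_u (fun z => 'D_u G z) z + 'D_v (fun z => 'D_v G z) z).
have IL : torus_integral w1 w2 L = 0 := frame_divergence wi fr CG perG.
have cL : continuous L.
  apply: linear_variation_continuous => z.
  - exact: (Ck_continuous (C2 0%N) I).
  - exact: (Ck_continuous CA I).
  - exact: (Ck_continuous CB I).
  - exact: (Ck_continuous CN I).
  - exact: (Ck_continuous Ck0 I).
  - exact: (Ck_continuous (Ck_derive u CG) I).
  - exact: (Ck_continuous (Ck_derive v CG) I).
  - apply: cvgD.
      exact: (Ck_continuous (Ck_derive u (Ck_derive u CG)) I).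
    exact: (Ck_continuous (Ck_derive v (Ck_derive v CG)) I).
rewrite -mulrBr normrM (ger0_norm l0) /M -[X in _ <= X]mulrA; apply: (ler_wpM2l l0).
rewrite [X in _ <= X](_ : _ = 200 * Kb ^+ 2 * (C * `|t|) ^+ 2 * `|det2 w1 w2|); last first.
  by rewrite exprMn; ring.
apply: (torus_integral_compare cEt cE0 cL IL) => x y x01 y01.
set z := x *: w1 + y *: w2.
have Kz : K z by exists (x, y).
have dG w : 'D_w G z = 'D_w (F t) z - 'D_w f z.
  apply: (@deriveB _ _ _ (F t) f); apply: diff_derivable.
    exact: (Ck_differentiable (smFt 1%N) I).
  exact: (Ck_differentiable (C2 1%N) I).
have ddG w : 'D_w (fun z => 'D_w G z) z =
    'D_w (fun z => 'D_w (F t) z) z - 'D_w (fun z => 'D_w f z) z.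
  have -> : (fun z => 'D_w G z) = (fun z => 'D_w (F t) z - 'D_w f z).
    apply/funext => a; apply: (@deriveB _ _ _ (F t) f); apply: diff_derivable.
      exact: (Ck_differentiable (smFt 1%N) I).
    exact: (Ck_differentiable (C2 1%N) I).
  apply: (@deriveB _ _ _ (fun z => 'D_w (F t) z) (fun z => 'D_w f z)); apply: diff_derivable.
    exact: (Ck_differentiable (Ck_derive w (smFt 2%N)) I).
  exact: (Ck_differentiable (Ck_derive w (C2 2%N)) I).
have fuu : 'D_u (fun z => 'D_u f z) z = - f z + k z *: N z.
  have -> : (fun z => 'D_u f z) = A by apply/funext => a; have [] := Du a.
  by have [] := Du z.
have fvv : 'D_v (fun z => 'D_v f z) z = - f z.
  have -> : (fun z => 'D_v f z) = B by apply/funext => a; have [] := Dv a.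
  by have [] := Dv z.
have fu : 'D_u f z = A z by have [] := Du z.
have fv : 'D_v f z = B z by have [] := Dv z.
have [c1 c2 _] := conformal_dir z (cF t te).2 u0 s1 vE.
exact: (variation_estimate (unit z) (orth z) K1 (kK z Kz) mK nK fu fv fuu fvv
  (dG u) (dG v) (ddG u) (ddG v) Cu0 Cv0 Duu0 Dvv0 (normr_ge0 t) e6
  (HCu t z te2 Kz) (HCv t z te2 Kz) (HDuu t z te2 Kz) (HDvv t z te2 Kz) c1 c2).
Qed.

End ConstrainedWillmore.

(** * Hopf tori over closed curves *)

Section Smoothness.
Context {R : realType}.

(** Smoothness by invariance: it is enough to exhibit a class of differentiable functions that is
    stable under directional derivatives. *)
Lemma closed_smooth (V : normedModType R) (S : (V -> R) -> Prop) :
  (forall g, S g -> (forall x, differentiable g x) /\ forall v, S (fun x => 'D_v g x)) ->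
  forall k g, S g -> Ck setT k g.
Proof.
move=> HS; elim=> [|k IH] g Sg.
  by move=> x _; exact: differentiable_continuous ((HS g Sg).1 x).
by split => [x _|v]; [exact: (HS g Sg).1|apply: IH; exact: (HS g Sg).2].
Qed.

Lemma row_delta (a : 'rV[R]_4) : a = \sum_i a 0 i *: delta_mx 0 i.
Proof.
apply/rowP => j; rewrite summxE (bigD1 j)//= big1 => [|i ij]; rewrite !mxE !eqxx.
  by rewrite mulr1 addr0.
by rewrite eq_sym (negbTE ij) mulr0.
Qed.

Lemma differentiable_row (V : normedModType R) (F : V -> 'rV[R]_4) x :
  (forall i, differentiable (fun y => F y 0 i : R) x) -> differentiable F x.
Proof.
move=> dF.
have -> : F = \sum_(i < 4) (fun y => F y 0 i *: (delta_mx 0 i : 'rV[R]_4)).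
  by apply/funext => y; rewrite fct_sumE -row_delta.
by apply: differentiable_sum => i; exact: differentiableZl.
Qed.

Lemma smooth_row (V : normedModType R) (F : V -> 'rV[R]_4) :
  (forall k i, Ck setT k (fun y => F y 0 i : R)) -> smooth_on setT F.
Proof.
move=> sF k; elim: k F sF => [|k IH] F sF.
  move=> x _; apply: differentiable_continuous; apply: differentiable_row => i.
  exact: (sF 1%N i).1.
have dF x : differentiable F x by apply: differentiable_row => i; exact: (sF 1%N i).1.
split => [x _|v]; first exact: dF.
apply: IH => j i.
have -> : (fun y => 'D_v F y 0 i) = (fun y => 'D_v (fun y => F y 0 i : R) y).
  by apply/funext => y; rewrite derive_mx ?mxE//; exact: diff_derivable.
exact: (sF j.+1 i).2.
Qed.

Lemma lin_comp_derive (h : R -> R) (h' : R) (a b : R) (z w : R * R) :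
  is_derive (a * z.1 + b * z.2) (1 : R) h h' ->
  differentiable (fun z : R * R => h (a * z.1 + b * z.2)) z /\
  'D_w (fun z : R * R => h (a * z.1 + b * z.2)) z = (a * w.1 + b * w.2) * h'.
Proof.
move=> [dh hE].
pose X (z : R * R) : R := a * z.1 + b * z.2.
have linX : linear X by move=> r y y'; rewrite /X /= /GRing.scale/=; ring.
pose XL : {linear (R * R)%type -> R} :=
  HB.pack X (GRing.isLinear.Build _ _ _ _ X linX).
have cX : continuous XL.
  move=> y; apply: cvgD; apply: cvgM; try exact: cvg_cst.
    exact: cvg_fst.
  exact: cvg_snd.
have dX y : differentiable X y := linear_differentiable y cX.
have dhX : differentiable h (X z) by apply/derivable1_diffP.
have dhXz : differentiable (h \o X) z := differentiable_comp (dX z) dhX.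
split; first exact: dhXz.
have XE r : X (r *: w + z) = r *: X w + X z.
  by rewrite /X /= /GRing.scale/=; ring.
apply: etrans (@derive_slice R _ _ R h X z w (X w) XE) _.
rewrite (deriveE _ dhX) -hE (deriveE _ dhX) -[in LHS](mulr1 (X w)).
by rewrite -[X w * 1]/(X w *: (1 : R)) linearZ.
Qed.

End Smoothness.

Section Algebra.
Context {R : realType} (x1 x2 y1 y2 : R).
Let X (z : R * R) : R := x1 * z.1 + x2 * z.2.
Let Y (z : R * R) : R := y1 * z.1 + y2 * z.2.

(** A syntactic algebra containing all coordinates of the frame. If the generators in [P] have
    derivatives in the algebra, then it is stable under differentiation, and [closed_smooth]
    applies. *)
Inductive trig_alg (P : (R -> R) -> Prop) : (R * R -> R) -> Prop :=
| alg_gen h : P h -> trig_alg P (fun z => h (X z))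
| alg_cos : trig_alg P (fun z => cos (Y z))
| alg_sin : trig_alg P (fun z => sin (Y z))
| alg_cst c : trig_alg P (fun _ => c)
| alg_add f g : trig_alg P f -> trig_alg P g -> trig_alg P (fun z => f z + g z)
| alg_mul f g : trig_alg P f -> trig_alg P g -> trig_alg P (fun z => f z * g z).

Lemma trig_alg_smooth P :
  (forall h, P h -> exists h', trig_alg P (fun z => h' (X z)) /\
    forall x, is_derive x (1 : R) h (h' x)) ->
  forall k g, trig_alg P g -> Ck setT k g.
Proof.
move=> HP; apply: closed_smooth => g; elim=> {g} [h Ph|||c|f g af [df Df] ag [dg Dg]|f g af [df Df] ag [dg Dg]].
- have [h' [ah' dh]] := HP h Ph.
  split => [z|w]; first exact: (@lin_comp_derive R h _ x1 x2 z 0 (dh _)).1.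
  have -> : (fun x => 'D_w (fun z => h (X z)) x) = (fun z => (x1 * w.1 + x2 * w.2) * h' (X z)).
    by apply/funext => z; exact: (@lin_comp_derive R h _ x1 x2 z w (dh _)).2.
  exact: alg_mul (alg_cst _ _) ah'.
- split => [z|w]; first exact: (@lin_comp_derive R cos _ y1 y2 z 0 (is_derive_cos _)).1.
  have -> : (fun x => 'D_w (fun z => cos (Y z)) x) = (fun z => (- (y1 * w.1 + y2 * w.2)) * sin (Y z)).
    apply/funext => z; apply: (etrans (@lin_comp_derive R cos _ y1 y2 z w (is_derive_cos _)).2).
    by rewrite mulrN mulNr.
  exact: alg_mul (alg_cst _ _) (alg_sin _).
- split => [z|w]; first exact: (@lin_comp_derive R sin _ y1 y2 z 0 (is_derive_sin _)).1.
  have -> : (fun x => 'D_w (fun z => sin (Y z)) x) = (fun z => (y1 * w.1 + y2 * w.2) * cos (Y z)).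
    by apply/funext => z; exact: (@lin_comp_derive R sin _ y1 y2 z w (is_derive_sin _)).2.
  exact: alg_mul (alg_cst _ _) (alg_cos _).
- split => [z|w]; first exact: differentiable_cst.
  have -> : (fun x => 'D_w (fun _ : R * R => c) x) = (fun=> 0).
    by apply/funext => z; exact: derive_cst.
  exact: alg_cst.
- split => [z|w]; first exact: differentiableD.
  have -> : (fun x => 'D_w (fun z => f z + g z) x) = (fun z => 'D_w f z + 'D_w g z).
    by apply/funext => z; apply: (@deriveD _ _ _ f g); exact: diff_derivable.
  by apply: alg_add; [exact: Df|exact: Dg].
- split => [z|w]; first exact: differentiableM.
  have -> : (fun x => 'D_w (fun z => f z * g z) x) = (fun z => 'D_w f z * g z + f z * 'D_w g z).
    apply/funext => z; apply: (derive_val (is_derive := is_derive_mulv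
      (derivableP (diff_derivable (df z))) (derivableP (diff_derivable (dg z))))).
  exact: alg_add (alg_mul (Df w) ag) (alg_mul af (Dg w)).
Qed.

(** The real part of [exp(i y) (a + i b)]. Multiplying by [- i] turns [(a, b)] into [(b, - a)], so
    [rc y b (- a)] is the imaginary part. *)
Definition rc (y a b : R) : R := cos y * a - sin y * b.

Lemma rc_derive (g h : R -> R) (g' h' : R) z w :
  is_derive (X z) (1 : R) g g' -> is_derive (X z) (1 : R) h h' ->
  is_derive z w (fun z : R * R => rc (Y z) (g (X z)) (h (X z)))
    (X w * rc (Y z) g' h' + Y w * rc (Y z) (- h (X z)) (g (X z))).
Proof.
move=> dg dh.
have [dg1 dg2] := @lin_comp_derive R g _ x1 x2 z w dg; have [dh1 dh2] := @lin_comp_derive R h _ x1 x2 z w dh.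
have [dc1 dc2] := @lin_comp_derive R cos _ y1 y2 z w (is_derive_cos (Y z)).
have [ds1 ds2] := @lin_comp_derive R sin _ y1 y2 z w (is_derive_sin (Y z)).
have mk (f : R * R -> R) x : differentiable f z -> 'D_w f z = x -> is_derive z w f x.
  by move=> df <-; apply: derivableP; exact: diff_derivable.
have D := is_derive_addv (is_derive_mulv (mk _ _ dc1 dc2) (mk _ _ dg1 dg2))
  (is_derive_scalev (-1) (is_derive_mulv (mk _ _ ds1 ds2) (mk _ _ dh1 dh2))).
rewrite (_ : (fun z => rc _ _ _) = (fun z => cos (Y z) * g (X z) + (-1) * (sin (Y z) * h (X z)))).
  by apply: (is_derive_eq D); rewrite /rc /X /Y; ring.
by apply/funext => y; rewrite /rc; ring.
Qed.

(* [exp(i y) (a + i b, c + i d)] in C^2 = R^4. *)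
Definition hv (y a b c d : R) : 'rV[R]_4 :=
  \row_i nth 0 [:: rc y a b; rc y b (- a); rc y c d; rc y d (- c)] i.

Lemma hv_dot y a b c d a' b' c' d' : dot (hv y a b c d) (hv y a' b' c' d') =
  a * a' + b * b' + c * c' + d * d'.
Proof.
have cs := cos2Dsin2 y.
rewrite dot4 !mxE /= /rc.
rewrite [LHS](_ : _ = (cos y ^+ 2 + sin y ^+ 2) * (a * a' + b * b' + c * c' + d * d')).
  by rewrite cs mul1r.
by ring.
Qed.

Lemma hv_derive (a b c d : R -> R) (a' b' c' d' : R) z w :
  is_derive (X z) (1 : R) a a' -> is_derive (X z) (1 : R) b b' ->
  is_derive (X z) (1 : R) c c' -> is_derive (X z) (1 : R) d d' ->
  'D_w (fun z => hv (Y z) (a (X z)) (b (X z)) (c (X z)) (d (X z))) z =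
  X w *: hv (Y z) a' b' c' d' +
  Y w *: hv (Y z) (- b (X z)) (a (X z)) (- d (X z)) (c (X z)).
Proof.
move=> da db dc dd.
have dN (f : R -> R) (f' : R) : is_derive (X z) (1 : R) f f' -> is_derive (X z) (1 : R) (fun x => - f x) (- f').
  by move=> df; exact: is_deriveN.
pose F z := hv (Y z) (a (X z)) (b (X z)) (c (X z)) (d (X z)).
have E (i : 'I_4) : is_derive z w (fun z => F z 0 i : R)
    ((X w *: hv (Y z) a' b' c' d' +
      Y w *: hv (Y z) (- b (X z)) (a (X z)) (- d (X z)) (c (X z))) 0 i).
  rewrite (_ : (fun z => _) = (fun z => nth 0 [:: rc (Y z) (a (X z)) (b (X z));
    rc (Y z) (b (X z)) (- a (X z)); rc (Y z) (c (X z)) (d (X z));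
    rc (Y z) (d (X z)) (- c (X z))] i)); last by apply/funext => y; rewrite mxE.
  rewrite !mxE; case: i => -[|[|[|[|//]]]] i4 /=.
  - exact: rc_derive.
  - by have := rc_derive w db (dN _ _ da); rewrite !opprK.
  - exact: rc_derive.
  - by have := rc_derive w dd (dN _ _ dc); rewrite !opprK.
have dF : derivable F z w by apply/derivable_mxP => j i; rewrite !ord1; have [] := E i.
by apply/rowP => i; rewrite derive_mx// mxE; exact: derive_val.
Qed.

End Algebra.

Section HopfTorus.
Context {R : realType}.

(* [(a + i b, c + i d)] is a horizontal lift to S^3 in C^2 with velocity
   [(p + i q, r + i t)]; both satisfy [c'' = - c + i k c'] componentwise. *)
Record hopf_curve (a b c d p q r t k k1 : R -> R) (m n : R) : Prop := HopfCurve {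
  curve_D : forall x, [/\ is_derive x (1 : R) a (p x), is_derive x (1 : R) b (q x),
    is_derive x (1 : R) c (r x) & is_derive x (1 : R) d (t x)];
  curve_DD : forall x, [/\ is_derive x (1 : R) p (- a x - k x * q x),
    is_derive x (1 : R) q (- b x + k x * p x),
    is_derive x (1 : R) r (- c x - k x * t x) &
    is_derive x (1 : R) t (- d x + k x * r x)];
  curve_Dk : forall x, is_derive x (1 : R) k (k1 x) /\
    is_derive x (1 : R) k1 (- (k x ^+ 3 / 2 + 2 * (1 + m) * k x - 4 * n));
  curve_unit : forall x, a x ^+ 2 + b x ^+ 2 + c x ^+ 2 + d x ^+ 2 = 1 /\
    p x ^+ 2 + q x ^+ 2 + r x ^+ 2 + t x ^+ 2 = 1;
  curve_orth : forall x, a x * p x + b x * q x + c x * r x + d x * t x = 0 /\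
    a x * q x - b x * p x + c x * t x - d x * r x = 0
}.

Lemma periodic_lattice (T : Type) (w1 w2 : R * R) (g : R * R -> T) :
  (forall z, g (z + w1) = g z) -> (forall z, g (z + w2) = g z) ->
  Defs.periodic (lattice w1 w2) g.
Proof.
move=> g1 g2.
have natp w n z : (forall z, g (z + w) = g z) -> g (z + w *+ n) = g z.
  move=> gw; elim: n => [|n IH]; first by rewrite mulr0n addr0.
  by rewrite mulrSr addrA gw IH.
have intp w (n : int) z : (forall z, g (z + w) = g z) -> g (z + w *~ n) = g z.
  move=> gw; case: n => n; first exact: natp.
  by rewrite NegzE mulrNz -[in RHS](subrK (w *+ n.+1) z) natp.
by move=> z _ [m [n ->]]; rewrite addrA intp// intp.
Qed.

Lemma periodic_derive (W : normedModType R) (L : set (R * R)) (g : R * R -> W) w :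
  Defs.periodic L g -> Defs.periodic L (fun z => 'D_w g z).
Proof.
move=> perg z l Ll; rewrite -(@derive_slice _ _ _ _ g (fun z => z + l) z w w) => [|h].
  by congr ('D_w _ z); apply/funext => y; exact: perg.
by rewrite addrA.
Qed.

Lemma rc_add (x y a b : R) : rc (x + y) a b = rc x (rc y a b) (rc y b (- a)).
Proof. by rewrite /rc cosD sinD; ring. Qed.

Lemma rcN (y a b : R) : rc y (- a) (- b) = - rc y a b.
Proof. by rewrite /rc; ring. Qed.

(** [X] and [Y] are the coordinates dual to [u] and to [v], the vector [u] turned by a right angle
    in the sense [s]; so [exp(i Y) c(X)] has the constant conformal factor [1 / l]. The period
    hypothesis says [exp(i Y(w)) c(x + X(w)) = c(x)] for both generators, in real and imaginary
    parts. *)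
Lemma hopf_torus (w1 w2 u : R * R) (s : R) (a b c d p q r t k k1 : R -> R) (m n : R) :
  let l := u.1 ^+ 2 + u.2 ^+ 2 in
  let X (z : R * R) := u.1 / l * z.1 + u.2 / l * z.2 in
  let Y (z : R * R) := - s * u.2 / l * z.1 + s * u.1 / l * z.2 in
  R_independent w1 w2 -> u != 0 -> s ^+ 2 = 1 -> hopf_curve a b c d p q r t k k1 m n ->
  (forall w, w = w1 \/ w = w2 -> forall x,
    [/\ rc (Y w) (a (x + X w)) (b (x + X w)) = a x,
        rc (Y w) (b (x + X w)) (- a (x + X w)) = b x,
        rc (Y w) (c (x + X w)) (d (x + X w)) = c x &
        rc (Y w) (d (x + X w)) (- c (x + X w)) = d x] /\ k (x + X w) = k x) ->
  exists f : R * R -> 'rV[R]_4, conformal_immersion w1 w2 f /\ constrained_willmore w1 w2 f.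
Proof.
move=> l X Y wi u0 s1 [HD HDD HDk Hunit Horth] per.
pose v : R * R := (- s * u.2, s * u.1).
have l0 : l != 0.
  rewrite paddr_eq0 ?sqr_ge0// !sqrf_eq0.
  by apply: contra u0 => /andP[]; case: (u) => x y /= /eqP -> /eqP ->.
have l_gt0 : 0 < l by rewrite lt_neqAle eq_sym l0 addr_ge0// sqr_ge0.
have Xu : X u = 1 by rewrite /X; move: l0; rewrite /l => ?; field.
have Yu : Y u = 0 by rewrite /Y; ring.
have Xv : X v = 0 by rewrite /X /v /=; ring.
have Yv : Y v = 1.
  by rewrite /Y /v /= -[RHS]s1; move: l0; rewrite /l => ?; field.
pose f z := hv (Y z) (a (X z)) (b (X z)) (c (X z)) (d (X z)).
(* In complex terms [A = exp(i Y) c'(X)], [B = i f] and [N = i A]. *)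
pose A z := hv (Y z) (p (X z)) (q (X z)) (r (X z)) (t (X z)).
pose B z := hv (Y z) (- b (X z)) (a (X z)) (- d (X z)) (c (X z)).
pose N z := hv (Y z) (- q (X z)) (p (X z)) (- t (X z)) (r (X z)).
have dN (h : R -> R) (h' : R) x : is_derive x (1 : R) h h' ->
    is_derive x (1 : R) (fun x => - h x) (- h').
  by move=> dh; exact: is_deriveN.
pose hvD := @hv_derive R (u.1 / l) (u.2 / l) (- s * u.2 / l) (s * u.1 / l).
have Df w z : 'D_w f z = X w *: A z + Y w *: B z.
  by have [da db dc dd] := HD (X z); exact: hv_derive.
have DA w z : 'D_w A z = X w *: (- f z + k (X z) *: N z) + Y w *: N z.
  have [da db dc dd] := HDD (X z); apply: (etrans (hvD _ _ _ _ _ _ _ _ z w da db dc dd)).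
  congr (_ *: _ + _); apply/rowP => i; rewrite !mxE.
  by case: i => -[|[|[|[|//]]]] i4 /=; rewrite /rc; ring.
have DB w z : 'D_w B z = X w *: N z + Y w *: (- f z).
  have [da db dc dd] := HD (X z).
  apply: (etrans (hvD _ _ _ _ _ _ _ _ z w (dN _ _ _ db) da (dN _ _ _ dd) dc)).
  congr (_ + _ *: _); apply/rowP => i; rewrite !mxE.
  by case: i => -[|[|[|[|//]]]] i4 /=; rewrite /rc; ring.
have DN w z : 'D_w N z = X w *: (- B z - k (X z) *: A z) + Y w *: (- A z).
  have [da db dc dd] := HDD (X z).
  apply: (etrans (hvD _ _ _ _ _ _ _ _ z w (dN _ _ _ db) da (dN _ _ _ dd) dc)).
  congr (_ *: _ + _ *: _); apply/rowP => i; rewrite !mxE.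
    by case: i => -[|[|[|[|//]]]] i4 /=; rewrite /rc; ring.
  by case: i => -[|[|[|[|//]]]] i4 /=; rewrite /rc; ring.
pose K z := k (X z); pose K1 z := k1 (X z).
have DK w z : 'D_w K z = X w * k1 (X z).
  by have [dk _] := HDk (X z); exact: (@lin_comp_derive R _ _ (u.1 / l) (u.2 / l) z w dk).2.
have DK1 w z : 'D_w K1 z = X w * - (K z ^+ 3 / 2 + 2 * (1 + m) * K z - 4 * n).
  by have [_ dk] := HDk (X z); exact: (@lin_comp_derive R _ _ (u.1 / l) (u.2 / l) z w dk).2.
(* The derivatives of these ten functions are polynomials in the ten functions, by the equations of
   [hopf_curve]. *)
pose P (h : R -> R) := List.In h [:: a; b; c; d; p; q; r; t; k; k1].
pose alg := trig_alg (u.1 / l) (u.2 / l) (- s * u.2 / l) (s * u.1 / l) P.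
have gen h : P h -> alg (fun z => h (X z)) by move=> Ph; exact: alg_gen.
have [ga gb gc gd gp] : [/\ alg (fun z => a (X z)), alg (fun z => b (X z)),
    alg (fun z => c (X z)), alg (fun z => d (X z)) & alg (fun z => p (X z))].
  by split; apply: gen; rewrite /P /=; tauto.
have [gq gr gt gk gk1] : [/\ alg (fun z => q (X z)), alg (fun z => r (X z)),
    alg (fun z => t (X z)), alg (fun z => k (X z)) & alg (fun z => k1 (X z))].
  by split; apply: gen; rewrite /P /=; tauto.
have algN h : alg h -> alg (fun z => - h z).
  move=> ah; rewrite (_ : (fun z => - h z) = (fun z => (-1) * h z)).
    exact: alg_mul (alg_cst _ _ _ _ _ _) ah.
  by apply/funext => z; rewrite mulN1r.
have algM g h : alg g -> alg h -> alg (fun z => g z * h z) by exact: alg_mul.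
have algD g h : alg g -> alg h -> alg (fun z => g z + h z) by exact: alg_add.
have closed h : P h -> exists h', alg (fun z => h' (X z)) /\
    forall x, is_derive x (1 : R) h (h' x).
  rewrite /P /=; case=> [<-|]; first by exists p; split => // x; have [] := HD x.
  case=> [<-|]; first by exists q; split => // x; have [] := HD x.
  case=> [<-|]; first by exists r; split => // x; have [] := HD x.
  case=> [<-|]; first by exists t; split => // x; have [] := HD x.
  case=> [<-|].
    exists (fun x => - a x - k x * q x); split => [|x]; last by have [] := HDD x.
    exact: algD _ _ (algN _ ga) (algN _ (algM _ _ gk gq)).
  case=> [<-|].
    exists (fun x => - b x + k x * p x); split => [|x]; last by have [] := HDD x.
    exact: algD _ _ (algN _ gb) (algM _ _ gk gp).
  case=> [<-|].
    exists (fun x => - c x - k x * t x); split => [|x]; last by have [] := HDD x.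
    exact: algD _ _ (algN _ gc) (algN _ (algM _ _ gk gt)).
  case=> [<-|].
    exists (fun x => - d x + k x * r x); split => [|x]; last by have [] := HDD x.
    exact: algD _ _ (algN _ gd) (algM _ _ gk gr).
  case=> [<-|]; first by exists k1; split => // x; have [] := HDk x.
  case=> [<-|//].
  exists (fun x => - (k x * (k x * k x) * 2^-1 + (2 * (1 + m)) * k x + - (4 * n))).
  split => [|x]; last first.
    have [_ dk] := HDk x; apply: (is_derive_eq dk).
    by ring.
  have cst x : alg (fun=> x) by exact: alg_cst.
  exact: algN _ (algD _ _ (algD _ _ (algM _ _ (algM _ _ gk (algM _ _ gk gk)) (cst _))
    (algM _ _ (cst _) gk)) (cst _)).
have sm g : alg g -> forall j, Ck setT j g.
  by move=> ag j; apply: (trig_alg_smooth closed) ag.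
have cY : alg (fun z => cos (Y z)) by exact: alg_cos.
have sY : alg (fun z => sin (Y z)) by exact: alg_sin.
have algrc g h : alg g -> alg h -> alg (fun z => rc (Y z) (g z) (h z)).
  by move=> ag ah; exact: algD _ _ (algM _ _ cY ag) (algN _ (algM _ _ sY ah)).
have smhv g1 g2 g3 g4 : alg g1 -> alg g2 -> alg g3 -> alg g4 ->
    smooth_on setT (fun z => hv (Y z) (g1 z) (g2 z) (g3 z) (g4 z)).
  move=> a1 a2 a3 a4; apply: smooth_row => j i.
  rewrite (_ : (fun y => hv _ _ _ _ _ 0 i) = (fun z => nth 0 [:: rc (Y z) (g1 z) (g2 z);
    rc (Y z) (g2 z) (- g1 z); rc (Y z) (g3 z) (g4 z);
    rc (Y z) (g4 z) (- g3 z)] i)); last by apply/funext => y; rewrite mxE.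
  by case: i => -[|[|[|[|//]]]] i4 /=; apply: sm; apply: algrc => //; exact: algN.
have smf : smooth_on setT f by exact: smhv.
have smA : smooth_on setT A by exact: smhv.
have smB : smooth_on setT B by apply: smhv => //; exact: algN.
have smN : smooth_on setT N by apply: smhv => //; exact: algN.
have XD z w : X (z + w) = X z + X w by rewrite /X /=; ring.
have YD z w : Y (z + w) = Y z + Y w by rewrite /Y /=; ring.
have perfw w z : w = w1 \/ w = w2 -> f (z + w) = f z.
  move=> ww; have [[pa pb pc pd] _] := per w ww (X z).
  apply/rowP => i; rewrite !mxE XD YD.
  by case: i => -[|[|[|[|//]]]] i4 /=; rewrite rc_add ?opprK ?rcN ?pa ?pb ?pc ?pd.
have perf : Defs.periodic (lattice w1 w2) f.
  by apply: periodic_lattice => z; apply: perfw; [left|right].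
have perK : Defs.periodic (lattice w1 w2) K.
  by apply: periodic_lattice => z; rewrite /K XD; apply: (per _ _ _).2; [left|right].
(* Recognising [A], [B], [N] and [K1] as derivatives of periodic maps makes them periodic at
   once. *)
have AE : A = (fun z => 'D_u f z).
  by apply/funext => z; rewrite Df Xu Yu scale1r scale0r addr0.
have BE : B = (fun z => 'D_v f z).
  by apply/funext => z; rewrite Df Xv Yv scale1r scale0r add0r.
have NE : N = (fun z => 'D_v A z).
  by apply/funext => z; rewrite DA Xv Yv scale1r scale0r add0r.
have K1E : K1 = (fun z => 'D_u K z) by apply/funext => z; rewrite DK Xu mul1r.
have perA : Defs.periodic (lattice w1 w2) A by rewrite AE; exact: periodic_derive.
have perB : Defs.periodic (lattice w1 w2) B by rewrite BE; exact: periodic_derive.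
have perN : Defs.periodic (lattice w1 w2) N by rewrite NE; exact: periodic_derive.
have perK1 : Defs.periodic (lattice w1 w2) K1 by rewrite K1E; exact: periodic_derive.
have unit z : [/\ dot (f z) (f z) = 1, dot (A z) (A z) = 1, dot (B z) (B z) = 1
    & dot (N z) (N z) = 1].
  have [h1 h2] := Hunit (X z).
  by split; rewrite hv_dot; [rewrite -h1|rewrite -h2|rewrite -h1|rewrite -h2]; ring.
have orth z : [/\ dot (f z) (A z) = 0, dot (f z) (B z) = 0 & dot (f z) (N z) = 0] /\
    [/\ dot (A z) (B z) = 0, dot (A z) (N z) = 0 & dot (B z) (N z) = 0].
  have [h1 h2] := Horth (X z).
  split; split; rewrite hv_dot; try ring.
  - by rewrite -h1; ring.
  - by rewrite -[RHS]oppr0 -h2; ring.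
  - by rewrite -h2; ring.
  - by rewrite -h1; ring.
have frame : hopf_frame w1 w2 u v f A B N K K1 m n.
  split => //.
  - by split; [exact: smA|exact: smB|exact: smN|exact: sm|exact: sm].
  - move=> z; rewrite Df DA DB DN Xu Yu !scale1r !scale0r !addr0.
    by [].
  - move=> z; rewrite Df DA DB DN Xv Yv !scale1r !scale0r !add0r.
    by [].
  - by move=> z; rewrite !DK Xu Xv mul1r mul0r.
  - by move=> z; rewrite !DK1 Xu Xv mul1r mul0r.
exists f; split; last exact: (frame_constrained_willmore wi u0 s1 (erefl v) frame).
have dotD w w' z : dot ('D_w f z) ('D_w' f z) = X w * X w' + Y w * Y w'.
  have [_ AA BB _] := unit z; have [_ [AB _ _]] := orth z.
  by rewrite !Df !dotE (dotC (B z) (A z)) AA BB AB; ring.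
have quad w w' : X w * X w' + Y w * Y w' = l^-1 * (w.1 * w'.1 + w.2 * w'.2).
  have [sE|sE] : s = 1 \/ s = -1 by move/eqP: s1; rewrite sqrf_eq1 => /orP[/eqP|/eqP]; [left|right].
    by rewrite /X /Y sE; move: l0; rewrite /l => ?; field.
  by rewrite /X /Y sE; move: l0; rewrite /l => ?; field.
split; first split => //.
- by move=> z; have [] := unit z.
- move=> z w Dw0; have := dotD w w z; rewrite Dw0 dot0l quad => /esym/eqP.
  rewrite mulf_eq0 invr_eq0 (negbTE l0)/= -!expr2 paddr_eq0 ?sqr_ge0// !sqrf_eq0.
  by move=> /andP[]; case: (w) => x y /= /eqP -> /eqP ->.
- by move=> z; exists l^-1; [rewrite invr_gt0|move=> w w'; rewrite dotD quad].
Qed.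

End HopfTorus.

(** * Constrained elastic curves *)

Section Primitive.
Context {R : realType}.
Implicit Types (g : R -> R).
Notation mu := (@lebesgue_measure R).

Lemma continuous_segment_integrable g a b : continuous g ->
  mu.-integrable `[a, b] (EFin \o g).
Proof.
move=> cg; apply: continuous_compact_integrable; first exact: segment_compact.
by apply: continuous_subspaceT => x; exact: cg.
Qed.

Lemma integral_chasles g a b u : continuous g -> a <= b -> b <= u ->
  \int[mu]_(t in `[a, u]) g t = \int[mu]_(t in `[a, b]) g t + \int[mu]_(t in `[b, u]) g t.
Proof.
move=> cg ab bu.
have H := @Rintegral_itvB R g (BLeft a) (BRight u) b (continuous_segment_integrable a u cg).
rewrite -(subrK (\int[mu]_(t in `[a, b]) g t) (\int[mu]_(t in `[a, u]) g t)) addrC H ?bnd_simp//.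
congr (_ + _).
apply: (@Rintegral_itv_obnd_cbnd R b (BRight u) g).
apply: (integrableS _ _ _ (continuous_segment_integrable b u cg)) => //.
exact: subset_itv_oc_cc.
Qed.

(** The integral from a fixed left end is a primitive only to the right of that end. The integrals
    from [- n], normalised at [0], agree where they overlap, and near each point one [n] serves. *)
Lemma primitive_exists g : continuous g ->
  exists P : R -> R, forall u, is_derive u (1 : R) P (g u).
Proof.
move=> cg.
pose F (n : nat) (u : R) := \int[mu]_(t in `[- n%:R, u]) g t - \int[mu]_(t in `[- n%:R, 0]) g t.
have Fle n p (u : R) : (n <= p)%N -> - n%:R < u -> F n u = F p u.
  move=> np nu; have pn : - (p%:R : R) <= - n%:R by rewrite lerN2 ler_nat.
  rewrite /F (integral_chasles cg pn (ltW nu)).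
  by rewrite (@integral_chasles g (- p%:R) (- n%:R) 0)//; ring.
have FE n p (u : R) : - n%:R < u -> - p%:R < u -> F n u = F p u.
  move=> nu pu; have [np|/ltnW pn] := leqP n p; first exact: Fle.
  by apply/esym; exact: Fle.
have dF n (u : R) : - n%:R < u -> is_derive u (1 : R) (F n) (g u).
  move=> nu.
  have uu1 : u < u + 1 by rewrite ltrDl.
  have [dI IE] := continuous_FTC1_closed uu1
    (continuous_segment_integrable (- n%:R) (u + 1) cg) nu (cg u).
  have dI' : is_derive u (1 : R) (fun u => \int[mu]_(t in `[- n%:R, u]) g t) (g u).
    by rewrite -IE derive1E; exact: derivableP.
  by apply: (is_derive_eq (is_derive_subf dI' (is_derive_const u _))); rewrite subr0.
pose N (u : R) := (Num.trunc `|u|).+1.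
have NP u : - (N u)%:R < u.
  have : `|u| < (N u)%:R by exact: truncnS_gt.
  by move=> /ltr_normlP[]; rewrite ltrNl.
exists (fun u => F (N u) u) => u.
have uN : - (N u).+1%:R < u by rewrite (lt_trans _ (NP u))// ltrN2 ltr_nat.
apply: (near_eq_is_derive (f := F (N u).+1)); last exact: dF.
near=> v; apply: FE; last exact: NP.
by near: v; exact: lt_nbhsr.
Unshelve. all: by end_near. Qed.

Lemma derive_eq_diff (P Q g : R -> R) : (forall u, is_derive u (1 : R) P (g u)) ->
  (forall u, is_derive u (1 : R) Q (g u)) -> forall u v, P u - Q u = P v - Q v.
Proof.
move=> dP dQ u v.
apply: (@is_derive_0_is_cst _ (fun x => P x - Q x)) => x.
by have := is_derive_subf (dP x) (dQ x); rewrite subrr.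
Qed.

Lemma is_derive_shift_arg (P g : R -> R) c : (forall u, is_derive u (1 : R) P (g u)) ->
  forall u, is_derive u (1 : R) (fun u => P (u + c)) (g (u + c)).
Proof.
move=> dP u.
apply: is_derive_eq (@is_derive1_comp R P (fun u => u + c) u _ _ (dP (u + c))
  (is_derive_addf (is_derive_id u (1 : R)) (is_derive_const u c))) _.
by rewrite addr0 mulr1.
Qed.

Lemma primitive_periodic (P g : R -> R) c : (forall u, is_derive u (1 : R) P (g u)) ->
  (forall u, g (u + c) = g u) -> forall u, P (u + c) = P u + (P c - P 0).
Proof.
move=> dP pg u.
have dPc v : is_derive v (1 : R) (fun u => P (u + c)) (g v).
  by rewrite -[g v]pg; exact: is_derive_shift_arg.
have := derive_eq_diff dPc dP u 0; rewrite add0r => <-.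
by rewrite [RHS]addrC subrK.
Qed.

Lemma primitive_integral (P g : R -> R) a b : a < b -> continuous g ->
  (forall u, is_derive u (1 : R) P (g u)) -> P b - P a = \int[mu]_(u in `[a, b]) g u.
Proof.
move=> ab cg dP; rewrite /Rintegral (@continuous_FTC2 _ g P)//.
- by apply: continuous_subspaceT => s; exact: cg.
- have cP : continuous P := is_derive_continuous dP.
  split => [s _||]; first by have [] := dP s.
  + exact/cvg_at_right_filter/cP.
  + exact/cvg_at_left_filter/cP.
- by move=> s _; rewrite derive1E; exact: derive_val.
Qed.

Lemma primitive_incr (P g : R -> R) : (forall u, is_derive u (1 : R) P (g u)) ->
  (forall u, 0 < g u) -> forall u v, u < v -> P u < P v.
Proof.
move=> dP g0 u v uv.
have [|x _ E] := MVT uv (fun x _ => dP x).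
  by apply: continuous_subspaceT => s; exact: (is_derive_continuous dP).
by rewrite -subr_gt0 E mulr_gt0// subr_gt0.
Qed.

(** Separation of variables: [U] inverts the time function [P], a primitive of [1 / g]. Since [P]
    gains the positive amount [T] over each period, it is onto, so the solution is global. *)
Lemma autonomous_flow (g : R -> R) (c : R) : 0 < c -> continuous g -> (forall u, 0 < g u) ->
  (forall u, g (u + c) = g u) ->
  exists (U : R -> R) (T : R), [/\ 0 < T, forall x, is_derive x (1 : R) U (g (U x)),
    forall x, U (x + T) = U x + c & T = \int[mu]_(u in `[0, c]) (g u)^-1].
Proof.
move=> c0 cg g0 pg.
have cG : continuous (fun u => (g u)^-1).
  by move=> u; apply: cvgV; [rewrite gt_eqF|exact: cg].
have [P dP] := primitive_exists cG.
have incP := primitive_incr dP (fun u => _ : 0 < (g u)^-1).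
have {}incP u v : u < v -> P u < P v by apply: incP => w; rewrite invr_gt0.
have cP : continuous P := is_derive_continuous dP.
pose T := P c - P 0.
have T0 : 0 < T by rewrite subr_gt0 incP.
have PT u : P (u + c) = P u + T.
  by apply: (primitive_periodic dP) => v; rewrite pg.
have PTn n u : P (u + c *+ n) = P u + T *+ n.
  elim: n => [|n IH]; first by rewrite !mulr0n !addr0.
  by rewrite mulrSr addrA PT IH -addrA -mulrSr.
have surj x : exists u, P u = x.
  pose n := (Num.trunc (`|x - P 0| / T)).+1.
  have xn : `|x - P 0| < T *+ n.
    by rewrite -mulr_natr mulrC -ltr_pdivrMr//; exact: truncnS_gt.
  have Pp : P (c *+ n) = P 0 + T *+ n by rewrite -PTn add0r.
  have Pm : P (- (c *+ n)) = P 0 - T *+ n.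
    by have := PTn n (- (c *+ n)); rewrite addNr => ->; rewrite addrK.
  move/ltr_normlP: xn => [x1 x2].
  have cn : 0 <= c *+ n by rewrite mulrn_wge0// ltW.
  have [|||u _ <-] := @IVT _ P (- (c *+ n)) (c *+ n) x.
  - by rewrite (le_trans _ cn)// oppr_le0.
  - by apply: continuous_subspaceT => s; exact: cP.
  - rewrite Pp Pm ge_min le_max; apply/andP; split; apply/orP; [left|right]; lra.
  by exists u.
have [U PU] := choice surj.
have injP u v : P u = P v -> u = v.
  move=> E; case: (ltgtP u v) => // /incP; rewrite E ltxx//.
have UP u : U (P u) = u by apply: injP; rewrite PU.
exists U, T; split => //.
- move=> x; have := @is_derive_inverse _ P U (g (U x))^-1 (U x).
  rewrite PU invrK; apply; last by rewrite gt_eqF// invr_gt0.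
  + by near=> u; exact: UP.
  + by near=> u; exact: cP.
- by move=> x; apply: injP; rewrite PU PT PU.
- exact: primitive_integral.
Unshelve. all: by end_near. Qed.

End Primitive.

(** * Spherical curves in polar coordinates about an axis *)

Section ElasticCurve.
Context {R : realType}.
Notation mu := (@lebesgue_measure R).

Section Component.
Variables (w w1 eta k psi : R -> R).
Hypothesis (dw : forall x, is_derive x (1 : R) w (w1 x)).
Hypothesis (dw1 : forall x, is_derive x (1 : R) w1 (2 * (1 - 2 * w x - k x * eta x))).
Hypothesis (deta : forall x, is_derive x (1 : R) eta (k x * w1 x / 2)).
Hypothesis (dpsi : forall x, is_derive x (1 : R) psi (eta x / w x)).
Hypothesis (w_gt0 : forall x, 0 < w x).
Hypothesis (wE : forall x, w1 x ^+ 2 / 4 + eta x ^+ 2 = w x * (1 - w x)).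

(** One complex component [z] of the lift: [w] is [|z| ^ 2], and [w1 / 2 + i eta] is the conjugate
    of [z] times [z'], whence the formulas for [p] and [q]. Hypothesis [wE] says [|z'| ^ 2 = 1 - w];
    [dw1] and [deta] are the real and imaginary parts of [z'' = - z + i k z'] paired with [z]. *)
Let a x := Num.sqrt (w x) * cos (psi x).
Let b x := Num.sqrt (w x) * sin (psi x).
Let p x := (a x * w1 x / 2 - b x * eta x) / w x.
Let q x := (b x * w1 x / 2 + a x * eta x) / w x.

Let w0 x : w x != 0. Proof. by rewrite gt_eqF. Qed.
Let s0 x : Num.sqrt (w x) != 0. Proof. by rewrite gt_eqF// sqrtr_gt0. Qed.
Let ss x : Num.sqrt (w x) ^+ 2 = w x. Proof. by rewrite sqr_sqrtr// ltW. Qed.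

Let dsqrt x : is_derive x (1 : R) (fun x => Num.sqrt (w x)) (w1 x / (2 * Num.sqrt (w x))).
Proof.
apply: (is_derive_eq (@is_derive1_comp R Num.sqrt w x _ _ (is_derive1_sqrt (w_gt0 x)) (dw x))).
by rewrite mulrC.
Qed.

Let dcos x : is_derive x (1 : R) (fun x => cos (psi x)) (- sin (psi x) * (eta x / w x)).
Proof. exact: (@is_derive1_comp R cos psi x _ _ (is_derive_cos _) (dpsi x)). Qed.

Let dsin x : is_derive x (1 : R) (fun x => sin (psi x)) (cos (psi x) * (eta x / w x)).
Proof. exact: (@is_derive1_comp R sin psi x _ _ (is_derive_sin _) (dpsi x)). Qed.

Lemma component_D1 x : is_derive x (1 : R) a (p x).
Proof.
apply: (is_derive_eq (is_derive_mulf (dsqrt x) (dcos x))).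
rewrite /p /a /b; move: (s0 x) (w0 x) (ss x).
set s := Num.sqrt (w x) => sn0 wn0 sE; rewrite -sE; field.
by rewrite sn0.
Qed.

Lemma component_D2 x : is_derive x (1 : R) b (q x).
Proof.
apply: (is_derive_eq (is_derive_mulf (dsqrt x) (dsin x))).
rewrite /q /a /b; move: (s0 x) (w0 x) (ss x).
set s := Num.sqrt (w x) => sn0 wn0 sE; rewrite -sE; field.
by rewrite sn0.
Qed.

Lemma component_DD1 x : is_derive x (1 : R) p (- a x - k x * q x).
Proof.
have n1 := is_derive_scale 2^-1 (is_derive_mulf (component_D1 x) (dw1 x)).
have n2 := is_derive_mulf (component_D2 x) (deta x).
have D := is_derive_divf (w0 x) (is_derive_subf n1 n2) (dw x).
rewrite (_ : p = fun x => (2^-1 * (a x * w1 x) - b x * eta x) / w x); last first.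
  by apply/funext => y; rewrite /p; congr (_ / _); rewrite mulrC.
apply: (is_derive_eq D); rewrite /p /q.
have E := wE x; have := w0 x.
move: (a x) (b x) (w x) (w1 x) (eta x) (k x) E => A B W W1 H K E W0.
apply/eqP; rewrite -subr_eq0; apply/eqP.
rewrite (_ : _ - _ = - A * (W1 ^+ 2 / 4 + H ^+ 2 - W * (1 - W)) / W ^+ 2); last by field.
by rewrite E subrr mulr0 mul0r.
Qed.

Lemma component_DD2 x : is_derive x (1 : R) q (- b x + k x * p x).
Proof.
have n1 := is_derive_scale 2^-1 (is_derive_mulf (component_D2 x) (dw1 x)).
have n2 := is_derive_mulf (component_D1 x) (deta x).
have D := is_derive_divf (w0 x) (is_derive_addf n1 n2) (dw x).
rewrite (_ : q = fun x => (2^-1 * (b x * w1 x) + a x * eta x) / w x); last first.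
  by apply/funext => y; rewrite /q; congr (_ / _); rewrite mulrC.
apply: (is_derive_eq D); rewrite /p /q.
have E := wE x; have := w0 x.
move: (a x) (b x) (w x) (w1 x) (eta x) (k x) E => A B W W1 H K E W0.
apply/eqP; rewrite -subr_eq0; apply/eqP.
rewrite (_ : _ - _ = - B * (W1 ^+ 2 / 4 + H ^+ 2 - W * (1 - W)) / W ^+ 2); last by field.
by rewrite E subrr mulr0 mul0r.
Qed.

Lemma component_norm x : a x ^+ 2 + b x ^+ 2 = w x.
Proof.
rewrite /a /b !exprMn -mulrDr cos2Dsin2 mulr1.
exact: ss.
Qed.

Lemma component_norm_D x : p x ^+ 2 + q x ^+ 2 = 1 - w x.
Proof.
have E := wE x; have N := component_norm x; have := w0 x.
rewrite /p /q; move: (a x) (b x) (w x) (w1 x) (eta x) E N => A B W W1 H E N W0.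
rewrite [LHS](_ : _ = (A ^+ 2 + B ^+ 2) * (W1 ^+ 2 / 4 + H ^+ 2) / W ^+ 2); last by field.
by rewrite E N; field.
Qed.

Lemma component_re x : a x * p x + b x * q x = w1 x / 2.
Proof.
have N := component_norm x; have := w0 x.
rewrite /p /q; move: (a x) (b x) (w x) (w1 x) (eta x) N => A B W W1 H N W0.
rewrite [LHS](_ : _ = (A ^+ 2 + B ^+ 2) * W1 / 2 / W); last by field.
by rewrite N; field.
Qed.

Lemma component_im x : a x * q x - b x * p x = eta x.
Proof.
have N := component_norm x; have := w0 x.
rewrite /p /q; move: (a x) (b x) (w x) (w1 x) (eta x) N => A B W W1 H N W0.
rewrite [LHS](_ : _ = (A ^+ 2 + B ^+ 2) * H / W); last by field.
by rewrite N; field.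
Qed.

End Component.

(* The curvature [k = m + h sin u], [u' = elastic_speed u], solves
   [k' ^ 2 = (h ^ 2 - (k - m) ^ 2) ((k + m) ^ 2 + d) / 4], whose quartic on the
   right has no cubic term, as the constrained elastica equation demands.
   [k' ^ 2 + elastic_e ^ 2 / 4 + (2 k + elastic_be / 2) ^ 2 = elastic_Q] is a first
   integral, and [elastic_tau] is the angular velocity of the curve on S^2 about the
   axis through the corresponding fixed vector. *)
Definition elastic_k (m h u : R) : R := m + h * sin u.
Definition elastic_speed (m h d u : R) : R := Num.sqrt ((2 * m + h * sin u) ^+ 2 + d) / 2.
Definition elastic_al (m h d : R) : R := (d - h ^+ 2 - 2 * m ^+ 2) / 4.
Definition elastic_be (m h d : R) : R := - m * (d + h ^+ 2) / 4.
Definition elastic_e (m h d u : R) : R := 8 - 2 * elastic_al m h d - elastic_k m h u ^+ 2.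
Definition elastic_Q (m h d : R) : R :=
  (h ^+ 2 * m ^+ 2 + h ^+ 2 * d - m ^+ 4 - d * m ^+ 2) / 4 + (elastic_al m h d - 4) ^+ 2
  + elastic_be m h d ^+ 2 / 4.
Definition elastic_tau (m h d u : R) : R :=
  4 * Num.sqrt (elastic_Q m h d) * elastic_e m h d u /
  (4 * (h * cos u * elastic_speed m h d u) ^+ 2 + elastic_e m h d u ^+ 2).

Definition elastic_T (m h d : R) : R :=
  \int[mu]_(u in `[0, 2 * pi]) (elastic_speed m h d u)^-1.
Definition elastic_Phi (m h d : R) : R :=
  \int[mu]_(u in `[0, 2 * pi]) (elastic_k m h u / elastic_speed m h d u).
Definition elastic_theta (m h d : R) : R :=
  \int[mu]_(u in `[0, 2 * pi]) (elastic_tau m h d u / elastic_speed m h d u).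

End ElasticCurve.

Section ElasticCurveExists.
Context {R : realType}.
Notation mu := (@lebesgue_measure R).

Lemma cos_period (x : R) (n : int) : cos (x + 2 * pi * n%:~R) = cos x.
Proof.
have nat_case (y : R) (p : nat) : cos (y + 2 * pi * p%:R) = cos y.
  rewrite (_ : 2 * pi * p%:R = (pi *+ 2) *+ p); first exact: (periodicn (@cosD2pi R)).
  by rewrite -[RHS]mulr_natr -[pi *+ 2]mulr_natl.
case: n => n; first exact: nat_case.
by rewrite NegzE mulrNz mulrN -[LHS](nat_case _ n.+1) subrK.
Qed.

Lemma sin_period (x : R) (n : int) : sin (x + 2 * pi * n%:~R) = sin x.
Proof.
have nat_case (y : R) (p : nat) : sin (y + 2 * pi * p%:R) = sin y.
  rewrite (_ : 2 * pi * p%:R = (pi *+ 2) *+ p); first exact: (periodicn (@sinD2pi R)).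
  by rewrite -[RHS]mulr_natr -[pi *+ 2]mulr_natl.
case: n => n; first exact: nat_case.
by rewrite NegzE mulrNz mulrN -[LHS](nat_case _ n.+1) subrK.
Qed.

Lemma rc_polar1 (y f s : R) : rc y (s * cos f) (s * sin f) = s * cos (f + y).
Proof. by rewrite /rc cosD; ring. Qed.

Lemma rc_polar2 (y f s : R) : rc y (s * sin f) (- (s * cos f)) = s * sin (f + y).
Proof. by rewrite /rc sinD; ring. Qed.

Section Lift.
Variables (m h d : R).
Hypothesis (D_gt0 : forall u, 0 < (2 * m + h * sin u) ^+ 2 + d).
Hypothesis (e_gt0 : forall u, 0 < elastic_e m h d u).

Let g := elastic_speed m h d.
Let k0 := elastic_k m h.
Let k10 u := h * cos u * g u.
Let e0 := elastic_e m h d.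
Let Q := elastic_Q m h d.
Let nu := (Num.sqrt Q)^-1.

Lemma elastic_speed_gt0 u : 0 < g u.
Proof. by rewrite /g /elastic_speed divr_gt0// sqrtr_gt0. Qed.

Lemma elastic_speed_sqr u : g u ^+ 2 = ((2 * m + h * sin u) ^+ 2 + d) / 4.
Proof. by rewrite /g /elastic_speed expr_div_n sqr_sqrtr ?ltW//; field. Qed.

Lemma is_derive_elastic_k u : is_derive u (1 : R) k0 (h * cos u).
Proof.
apply: (is_derive_eq (is_derive_addf (is_derive_const u m) (is_derive_scale h (is_derive_sin u)))).
by rewrite add0r.
Qed.

Lemma is_derive_elastic_speed u :
  is_derive u (1 : R) g ((2 * m + h * sin u) * h * cos u / (4 * g u)).
Proof.
have dD : is_derive u (1 : R) (fun u => (2 * m + h * sin u) * (2 * m + h * sin u) + d)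
    (2 * (2 * m + h * sin u) * (h * cos u)).
  have d1 := is_derive_addf (is_derive_const u (2 * m)) (is_derive_scale h (is_derive_sin u)).
  apply: (is_derive_eq (is_derive_addf (is_derive_mulf d1 d1) (is_derive_const u d))).
  by ring.
have D0 : 0 < (2 * m + h * sin u) * (2 * m + h * sin u) + d by rewrite -expr2.
have ds := @is_derive1_comp R Num.sqrt _ u _ _ (is_derive1_sqrt D0) dD.
have -> : g = fun u => 2^-1 * Num.sqrt ((2 * m + h * sin u) * (2 * m + h * sin u) + d).
  by apply/funext => v; rewrite /g /elastic_speed expr2 mulrC.
apply: (is_derive_eq (is_derive_scale 2^-1 ds)).
have s0 : Num.sqrt ((2 * m + h * sin u) * (2 * m + h * sin u) + d) != 0.
  by rewrite gt_eqF// sqrtr_gt0.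
by field.
Qed.

Lemma is_derive_elastic_k1 u : is_derive u (1 : R) k10
  (- (k0 u ^+ 3 / 2 + elastic_al m h d * k0 u + elastic_be m h d) / g u).
Proof.
have d1 := is_derive_mulf (is_derive_scale h (is_derive_cos u)) (is_derive_elastic_speed u).
apply: (is_derive_eq d1).
have g0 : g u != 0 by rewrite gt_eqF// elastic_speed_gt0.
have g2 := elastic_speed_sqr u; have cs : cos u ^+ 2 = 1 - sin u ^+ 2.
  by rewrite -(cos2Dsin2 u) addrK.
rewrite [LHS](_ : _ = (- h * sin u * g u ^+ 2
  + h * h * (2 * m + h * sin u) * cos u ^+ 2 / 4) / g u); last by field.
by rewrite g2 cs /k0 /elastic_k /elastic_al /elastic_be; field.
Qed.

Lemma elastic_QE u : k10 u ^+ 2 + e0 u ^+ 2 / 4 +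
  (2 * k0 u + elastic_be m h d / 2) ^+ 2 = Q.
Proof.
have cs : cos u ^+ 2 = 1 - sin u ^+ 2 by rewrite -(cos2Dsin2 u) addrK.
rewrite (_ : k10 u ^+ 2 = h ^+ 2 * cos u ^+ 2 * g u ^+ 2); last by rewrite /k10; ring.
rewrite (elastic_speed_sqr u) cs /e0 /Q /elastic_e /elastic_Q /k0 /elastic_k.
by rewrite /elastic_al /elastic_be; field.
Qed.

Lemma elastic_Q_gt0 : 0 < Q.
Proof.
rewrite -(elastic_QE 0); have := sqr_ge0 (k10 0).
have := sqr_ge0 (2 * k0 0 + elastic_be m h d / 2).
have : 0 < e0 0 ^+ 2 by rewrite exprn_gt0.
by lra.
Qed.

(* The phases of the two components of the lift are half the sum and half the
   difference of the holonomy angle [Th] and of [K + chi], [chi] periodic. *)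
Lemma elastic_curve : exists (a b c d' p q r t k k1 : R -> R) (m' n' : R),
  hopf_curve a b c d' p q r t k k1 m' n' /\
  forall (j : nat) (N1 N2 : int) (y : R),
    y + j%:R * (elastic_Phi m h d + elastic_theta m h d) / 2 = 2 * pi * N1%:~R ->
    y + j%:R * (elastic_Phi m h d - elastic_theta m h d) / 2 = 2 * pi * N2%:~R ->
    forall x, let s := j%:R * elastic_T m h d in
    [/\ rc y (a (x + s)) (b (x + s)) = a x, rc y (b (x + s)) (- a (x + s)) = b x,
        rc y (c (x + s)) (d' (x + s)) = c x & rc y (d' (x + s)) (- c (x + s)) = d' x] /\
    k (x + s) = k x.
Proof.
have g0 u : g u != 0 by rewrite gt_eqF// elastic_speed_gt0.
have cg : continuous g := is_derive_continuous is_derive_elastic_speed.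
have ck0 : continuous k0 := is_derive_continuous is_derive_elastic_k.
have ck10 : continuous k10 := is_derive_continuous is_derive_elastic_k1.
have pg u : g (u + 2 * pi) = g u.
  by rewrite /g /elastic_speed -[2 * pi]mulr1 (sin_period u 1).
have pk0 u : k0 (u + 2 * pi) = k0 u.
  by rewrite /k0 /elastic_k -[2 * pi]mulr1 (sin_period u 1).
have pk10 u : k10 (u + 2 * pi) = k10 u.
  by rewrite /k10 pg -[2 * pi]mulr1 (cos_period u 1).
have pe0 u : e0 (u + 2 * pi) = e0 u by rewrite /e0 /elastic_e -/(k0 _) pk0.
have twopi : 0 < 2 * pi :> R by rewrite mulr_gt0// pi_gt0.
have [U [T [T0 dU UT TE]]] := autonomous_flow twopi cg elastic_speed_gt0 pg.
pose tau := elastic_tau m h d.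
have ce0 : continuous e0.
  move=> u; apply: cvgB; [exact: cvg_cst|].
  by apply: (@continuous_comp _ _ _ k0 (fun x : R => x ^+ 2)); [exact: ck0|exact: exprn_continuous].
have den0 u : 4 * k10 u ^+ 2 + e0 u ^+ 2 != 0.
  have := sqr_ge0 (k10 u); have : 0 < e0 u ^+ 2 by rewrite exprn_gt0.
  by move=> ? ?; rewrite gt_eqF//; lra.
have ctau : continuous tau.
  move=> u; have k2 : {for u, continuous (fun u => k10 u ^+ 2)}.
    by apply: cvgM; exact: ck10.
  have e2 : {for u, continuous (fun u => e0 u ^+ 2)} by apply: cvgM; exact: ce0.
  apply: cvgM; first by apply: cvgM; [exact: cvg_cst|exact: ce0].
  apply: cvgV; first exact: den0.
  by apply: cvgD => //; apply: cvgM => //; exact: cvg_cst.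
have cdiv (f : R -> R) : continuous f -> continuous (fun u => f u / g u).
  move=> cf u; apply: cvgM; first exact: cf.
  by apply: cvgV; [exact: g0|exact: cg].
have [K dK] := primitive_exists (cdiv _ ck0).
have [Th dTh] := primitive_exists (cdiv _ ctau).
have KP : K (2 * pi) - K 0 = elastic_Phi m h d by exact: primitive_integral (cdiv _ ck0) dK.
have ThP : Th (2 * pi) - Th 0 = elastic_theta m h d.
  exact: primitive_integral (cdiv _ ctau) dTh.
have Kper u : K (u + 2 * pi) = K u + elastic_Phi m h d.
  by rewrite (primitive_periodic dK) ?KP// => v; rewrite pk0 pg.
have Thper u : Th (u + 2 * pi) = Th u + elastic_theta m h d.
  rewrite (primitive_periodic dTh) ?ThP// => v.
  by rewrite pg /tau /elastic_tau -/(k10 _) -/(k10 _) pk10 -/(e0 _) -/(e0 _) pe0.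
have comp (f f' : R -> R) : (forall u, is_derive u (1 : R) f (f' u / g u)) ->
    forall x, is_derive x (1 : R) (fun x => f (U x)) (f' (U x)).
  move=> df x; apply: (is_derive_eq (@is_derive1_comp R f U x _ _ (df (U x)) (dU x))).
  by rewrite -mulrA mulVf ?g0 ?mulr1.
pose k x := k0 (U x); pose k1 x := k10 (U x); pose e x := e0 (U x).
have dk x : is_derive x (1 : R) k (k1 x).
  apply: comp => u; apply: (is_derive_eq (is_derive_elastic_k u)).
  by rewrite /k10 mulfK ?g0.
have dk1 x : is_derive x (1 : R) k1
    (- (k x ^+ 3 / 2 + elastic_al m h d * k x + elastic_be m h d)).
  by apply: (comp k10 (fun u => - (k0 u ^+ 3 / 2 + elastic_al m h d * k0 u + elastic_be m h d)));
    exact: is_derive_elastic_k1.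
have eE x : e x = 8 - 2 * elastic_al m h d - k x * k x by rewrite /e /e0 /elastic_e expr2.
have de x : is_derive x (1 : R) e (- 2 * k x * k1 x).
  rewrite (_ : e = fun x => (8 - 2 * elastic_al m h d) - k x * k x); last by apply/funext.
  apply: (is_derive_eq (is_derive_subf (is_derive_const x _) (is_derive_mulf (dk x) (dk x)))).
  by ring.
have Q0 := elastic_Q_gt0; rewrite -/Q in Q0.
have sQ0 : Num.sqrt Q != 0 by rewrite gt_eqF// sqrtr_gt0.
have nu0 : 0 < nu by rewrite invr_gt0 sqrtr_gt0.
have nu2 : nu ^+ 2 * Q = 1.
  by rewrite /nu exprVn sqr_sqrtr ?ltW// mulVf// gt_eqF.
(* [w] is [(1 - height) / 2], where [nu * (2 k + elastic_be / 2)] is the height of the curve on S^2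
   along its axis; [nu] normalises the fixed vector of squared length [Q]. *)
pose w x := 2^-1 - nu * (k x + elastic_be m h d / 4).
pose w1 x := - nu * k1 x.
pose eta x := nu / 4 * e x.
have dw x : is_derive x (1 : R) w (w1 x).
  apply: (is_derive_eq (is_derive_subf (is_derive_const x _)
    (is_derive_scale nu (is_derive_addf (dk x) (is_derive_const x _))))).
  by rewrite /w1; ring.
have dw1 x : is_derive x (1 : R) w1 (2 * (1 - 2 * w x - k x * eta x)).
  apply: (is_derive_eq (is_derive_scale (- nu) (dk1 x))).
  by rewrite /w /eta eE; field.
have deta x : is_derive x (1 : R) eta (k x * w1 x / 2).
  apply: (is_derive_eq (is_derive_scale (nu / 4) (de x))).
  by rewrite /w1; field.
have wE x : w1 x ^+ 2 / 4 + eta x ^+ 2 = w x * (1 - w x).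
  rewrite [RHS](_ : _ = 4^-1 - nu ^+ 2 * (k x + elastic_be m h d / 4) ^+ 2); last first.
    by rewrite /w; field.
  have nuQ := nu2; rewrite -(elastic_QE (U x)) -/(k1 x) -/(e x) -/(k x) in nuQ.
  apply/eqP; rewrite -subr_eq0 /w1 /eta; apply/eqP.
  rewrite [LHS](_ : _ = (nu ^+ 2 * (k1 x ^+ 2 + e x ^+ 2 / 4 +
    (2 * k x + elastic_be m h d / 2) ^+ 2) - 1) / 4); last by field.
  by rewrite nuQ subrr mul0r.
(* Positivity of [elastic_e] is used here: with [wE] it forces [0 < w < 1], so neither component of
   the lift vanishes. *)
have eta0 x : 0 < eta x by rewrite /eta mulr_gt0 ?e_gt0 ?divr_gt0.
have ww0 x : 0 < w x * (1 - w x).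
  by rewrite -wE ltr_pwDr ?exprn_gt0// divr_ge0// sqr_ge0.
have w0 x : 0 < w x.
  by rewrite ltNge; apply/negP => w0; move: (ww0 x); rewrite ltNge => /negP; apply; nra.
have w0' x : 0 < 1 - w x by move: (ww0 x); rewrite pmulr_rgt0.
(* Minus the argument of [e + 2 i k1]; since [e] is positive, the arctangent is a global branch and
   [chi] is periodic. *)
pose chi x := - atan (2 * k1 x / e x).
have den x : 4 * k1 x ^+ 2 + e x ^+ 2 != 0 by exact: den0.
have e_neq0 x : e x != 0 by rewrite gt_eqF// /e /e0 e_gt0.
have wden x : w x * (1 - w x) = nu ^+ 2 * (4 * k1 x ^+ 2 + e x ^+ 2) / 16.
  by rewrite -wE /w1 /eta; field.
have dchi x : is_derive x (1 : R) chi ((1 - 2 * w x) * (eta x / (w x * (1 - w x))) - k x).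
  have dq := is_derive_divf (e_neq0 x) (is_derive_scale 2 (dk1 x)) (de x).
  have da := @is_derive1_comp R atan _ x _ _ (is_derive1_atan (2 * k1 x / e x)) dq.
  have dn := @is_deriveN _ _ _ _ _ _ _ da.
  apply: (is_derive_eq dn); rewrite wden.
  have nn : nu != 0 by rewrite gt_eqF.
  have := den x; have := e_neq0 x.
  rewrite /w /eta.
  have -> : elastic_al m h d = (8 - e x - k x * k x) / 2 by rewrite eE; field.
  move: (e x) (k x) (k1 x) (elastic_be m h d) nn => E k' k1' be nn E0 den'.
  by field; rewrite nn E0 den'.
have dK' := comp _ _ dK; have dTh' := comp _ _ dTh.
have tauE x : tau (U x) = eta x / (w x * (1 - w x)).
  have nn : nu != 0 by rewrite gt_eqF.
  rewrite wden /tau /elastic_tau -/(k10 _) -/(e0 _) -/(e x) -/(k1 x) -/Q.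
  rewrite -[Num.sqrt Q]invrK -/nu /eta.
  by move: (den x) => dx0; field; rewrite nn dx0.
(* [K + chi] has derivative [(1 - 2 w) tau] with [tau = eta / (w (1 - w))], so half the sum and half
   the difference with [Th] have the required derivatives [eta / w] and [- eta / (1 - w)]. *)
pose psi1 x := 2^-1 * (Th (U x) + (K (U x) + chi x)).
pose psi2 x := 2^-1 * ((K (U x) + chi x) - Th (U x)).
have dpsi1 x : is_derive x (1 : R) psi1 (eta x / w x).
  apply: (is_derive_eq (is_derive_scale 2^-1 (is_derive_addf (dTh' x)
    (is_derive_addf (dK' x) (dchi x))))).
  rewrite tauE -/(k x); have h1 := w0 x; have h2 := w0' x.
  by field; rewrite !gt_eqF.
have dpsi2 x : is_derive x (1 : R) psi2 (- eta x / (1 - w x)).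
  apply: (is_derive_eq (is_derive_scale 2^-1 (is_derive_subf
    (is_derive_addf (dK' x) (dchi x)) (dTh' x)))).
  rewrite tauE -/(k x); have h1 := w0 x; have h2 := w0' x.
  by field; rewrite !gt_eqF.
have dv x : is_derive x (1 : R) (fun x => 1 - w x) (- w1 x).
  by apply: (is_derive_eq (is_derive_subf (is_derive_const x 1) (dw x))); rewrite sub0r.
have dv1 x : is_derive x (1 : R) (fun x => - w1 x)
    (2 * (1 - 2 * (1 - w x) - k x * (- eta x))).
  by apply: (is_derive_eq (@is_deriveN _ _ _ _ _ _ _ (dw1 x))); ring.
have dveta x : is_derive x (1 : R) (fun x => - eta x) (k x * (- w1 x) / 2).
  by apply: (is_derive_eq (@is_deriveN _ _ _ _ _ _ _ (deta x))); ring.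
have vE x : (- w1 x) ^+ 2 / 4 + (- eta x) ^+ 2 = (1 - w x) * (1 - (1 - w x)).
  by rewrite !sqrrN wE; ring.
pose s1 x := Num.sqrt (w x); pose s2 x := Num.sqrt (1 - w x).
pose a x := s1 x * cos (psi1 x); pose b x := s1 x * sin (psi1 x).
pose c x := s2 x * cos (psi2 x); pose d' x := s2 x * sin (psi2 x).
(* The second component is the first construction applied to [1 - w], [- w1], [- eta]. The last two
   witnesses solve [2 (1 + m') = elastic_al] and [- 4 n' = elastic_be]. *)
exists a, b, c, d', (fun x => (a x * w1 x / 2 - b x * eta x) / w x),
  (fun x => (b x * w1 x / 2 + a x * eta x) / w x),
  (fun x => (c x * (- w1 x) / 2 - d' x * (- eta x)) / (1 - w x)),
  (fun x => (d' x * (- w1 x) / 2 + c x * (- eta x)) / (1 - w x)), k, k1,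
  (elastic_al m h d / 2 - 1), (- elastic_be m h d / 4).
split.
  split => x.
  - split; [exact: (component_D1 dw dpsi1 w0 x)|exact: (component_D2 dw dpsi1 w0 x)| |].
      exact: (component_D1 dv dpsi2 w0' x).
    exact: (component_D2 dv dpsi2 w0' x).
  - split.
    + exact: (component_DD1 dw dw1 deta dpsi1 w0 wE x).
    + exact: (component_DD2 dw dw1 deta dpsi1 w0 wE x).
    + exact: (component_DD1 dv dv1 dveta dpsi2 w0' vE x).
    + exact: (component_DD2 dv dv1 dveta dpsi2 w0' vE x).
  - by split => //; apply: (is_derive_eq (dk1 x)); field.
  - have n1 := component_norm psi1 w0 x.
    have n2 := component_norm psi2 w0' x.
    have n3 := component_norm_D psi1 w0 wE x.
    have n4 := @component_norm_D _ _ _ (fun x => - eta x) psi2 w0' vE x.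
    split; first by rewrite -addrA n1 n2; ring.
    by rewrite -addrA [X in _ + X]n4 [X in X + _]n3; ring.
  - have n1 := component_re w1 eta psi1 w0 x.
    have n2 := component_re (fun x => - w1 x) (fun x => - eta x) psi2 w0' x.
    have n3 := component_im w1 eta psi1 w0 x.
    have n4 := component_im (fun x => - w1 x) (fun x => - eta x) psi2 w0' x.
    split; first by rewrite -addrA [X in _ + X]n2 [X in X + _]n1; field.
    by rewrite -addrA [X in _ + X]n4 [X in X + _]n3; ring.
move=> j N1 N2 y y1 y2 x s.
have TE' : elastic_T m h d = T by rewrite TE.
have shift (f : R -> R) z : (forall u, f (u + 2 * pi) = f u + z) ->
    f (U (x + s)) = f (U x) + j%:R * z.
  move=> fc; rewrite /s TE'.
  elim: (j) => [|i IH]; first by rewrite !mul0r !addr0.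
  by rewrite -natr1 !mulrDl !mul1r !addrA UT fc IH.
have shift0 (f : R -> R) : (forall u, f (u + 2 * pi) = f u) -> f (U (x + s)) = f (U x).
  by move=> fc; rewrite (@shift f 0) ?mulr0 ?addr0// => u; rewrite addr0.
have ks : k (x + s) = k x by exact: shift0.
have k1s : k1 (x + s) = k1 x by exact: shift0.
have es : e (x + s) = e x by exact: shift0.
have chis : chi (x + s) = chi x by rewrite /chi k1s es.
have ws : w (x + s) = w x by rewrite /w ks.
have p1 : psi1 (x + s) + y = psi1 x + 2 * pi * N1%:~R.
  by rewrite -y1 /psi1 chis (shift _ _ Kper) (shift _ _ Thper); field.
have p2 : psi2 (x + s) + y = psi2 x + 2 * pi * N2%:~R.
  by rewrite -y2 /psi2 chis (shift _ _ Kper) (shift _ _ Thper); field.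
split => //; split.
- by rewrite rc_polar1 p1 cos_period /s1 ws.
- by rewrite rc_polar2 p1 sin_period /s1 ws.
- by rewrite rc_polar1 p2 cos_period /s2 ws.
- by rewrite rc_polar2 p2 sin_period /s2 ws.
Qed.

End Lift.
End ElasticCurveExists.

(** * Closing the curves *)

Section ParameterIntegrals.
Context {R : realType}.
Notation mu := (@lebesgue_measure R).
Implicit Types (f g : R -> R) (a b c : R).

Lemma Rintegral_lt f g a b : a < b -> continuous f -> continuous g ->
  (forall u, f u < g u) ->
  \int[mu]_(u in `[a, b]) f u < \int[mu]_(u in `[a, b]) g u.
Proof.
move=> ab cf cg fg.
have [F dF] := primitive_exists cf; have [G dG] := primitive_exists cg.
rewrite -(primitive_integral ab cf dF) -(primitive_integral ab cg dG).
have gf0 u : 0 < g u - f u by rewrite subr_gt0.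
have /= := primitive_incr (fun u => is_derive_subf (dG u) (dF u)) gf0 ab.
by lra.
Qed.

Lemma Rintegral_le f g a b : a < b -> continuous f -> continuous g ->
  (forall u, f u <= g u) ->
  \int[mu]_(u in `[a, b]) f u <= \int[mu]_(u in `[a, b]) g u.
Proof.
move=> ab cf cg fg; apply: le_Rintegral => //.
- exact: continuous_segment_integrable.
- exact: continuous_segment_integrable.
Qed.

Lemma Rintegral_const a b c : a < b -> \int[mu]_(u in `[a, b]) c = (b - a) * c.
Proof.
move=> ab; have dP (u : R) : is_derive u (1 : R) (fun u => c * u) c.
  by apply: (is_derive_eq (is_derive_scale c (is_derive_id u (1 : R)))); rewrite mulr1.
have cc : continuous (fun _ : R => c) by move=> u; exact: cvg_cst.
by rewrite -(primitive_integral ab cc dP); ring.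
Qed.

Lemma Rintegral_add f g a b : continuous f -> continuous g ->
  \int[mu]_(u in `[a, b]) (f u + g u) =
  \int[mu]_(u in `[a, b]) f u + \int[mu]_(u in `[a, b]) g u.
Proof.
move=> cf cg; rewrite -RintegralD//.
- exact: continuous_segment_integrable.
- exact: continuous_segment_integrable.
Qed.

Lemma Rintegral_scale f a b c : continuous f ->
  \int[mu]_(u in `[a, b]) (c * f u) = c * \int[mu]_(u in `[a, b]) f u.
Proof. by move=> cf; rewrite RintegralZl//; exact: continuous_segment_integrable. Qed.

(** Dominated convergence, with the constant bound of [G] on a compact rectangle around [p0]. *)
Lemma continuous_parameter_integral (G : R * R -> R) c : continuous G ->
  continuous (fun p => \int[mu]_(u in `[0, c]) G (p, u)).
Proof.
move=> cG p0.
have cGl p : continuous (fun u => G (p, u)).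
  move=> u; apply: (continuous_comp (f := fun u => (p, u)) (g := G)); last exact: cG.
  exact: (cvg_pair (cvg_cst p) cvg_id).
have cGr u : continuous (fun p => G (p, u)).
  move=> p; apply: (continuous_comp (f := fun p => (p, u)) (g := G)); last exact: cG.
  exact: (cvg_pair cvg_id (cvg_cst u)).
have /compact_bounded [M [_ HM]] : compact (G @` (`[p0 - 1, p0 + 1] `*` `[0, c])).
  apply: continuous_compact; last by apply: compact_setX; exact: segment_compact.
  by apply: continuous_subspaceT => z; exact: cG.
apply: (@continuity_under_integral R _ _ mu (fun p u => G (p, u)) `[0, c] _ (p0 - 1) (p0 + 1)
  _ _ (fun=> `|M| + 1)) => //.
- by move=> p _; exact: continuous_segment_integrable.
- by apply: aeW => u _ p _; exact: cGr.
- by apply: continuous_segment_integrable => u; exact: cvg_cst.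
- move=> p; rewrite /= in_itv/= => /andP[p1 p2]; apply: aeW => u uc.
  apply: HM; first by rewrite (le_lt_trans (ler_norm M))// ltrDl.
  by exists (p, u) => //; split => //=; rewrite in_itv/= !ltW.
- by rewrite inE/= in_itv/=; apply/andP; split; lra.
Qed.

End ParameterIntegrals.

Section ElasticContinuity.
Context {R : realType}.
Variables (m h d : R -> R).
Hypothesis (cm : continuous m) (ch : continuous h) (cd : continuous d).
Hypothesis (D0 : forall p u : R, 0 < (2 * m p + h p * sin u) ^+ 2 + d p).

Let c1 (f : R -> R) : continuous f -> continuous (fun z : R * R => f z.1).
Proof. by move=> cf z; apply: (continuous_comp (g := f)); [exact: cvg_fst|exact: cf]. Qed.

Let c2 (f : R -> R) : continuous f -> continuous (fun z : R * R => f z.2).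
Proof. by move=> cf z; apply: (continuous_comp (g := f)); [exact: cvg_snd|exact: cf]. Qed.

Let cM (f g : R * R -> R) : continuous f -> continuous g -> continuous (fun z => f z * g z).
Proof. by move=> cf cg z; apply: cvgM; [exact: cf|exact: cg]. Qed.

Let cD (f g : R * R -> R) : continuous f -> continuous g -> continuous (fun z => f z + g z).
Proof. by move=> cf cg z; apply: cvgD; [exact: cf|exact: cg]. Qed.

Let cV (f : R * R -> R) : continuous f -> (forall z, f z != 0) ->
  continuous (fun z => (f z)^-1).
Proof. by move=> cf f0 z; apply: cvgV; [exact: f0|exact: cf]. Qed.

Let cC (c : R) : continuous (fun _ : R * R => c).
Proof. by move=> z; exact: cvg_cst. Qed.

Let cS (f : R * R -> R) : continuous f -> continuous (fun z => Num.sqrt (f z)).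
Proof. by move=> cf z; apply: (continuous_comp (g := Num.sqrt)); [exact: cf|exact: sqrt_continuous]. Qed.

Let cE (f g : R * R -> R) : f =1 g -> continuous f -> continuous g.
Proof. by move=> /funext ->. Qed.

Lemma elastic_speed_continuous2 :
  continuous (fun z : R * R => elastic_speed (m z.1) (h z.1) (d z.1) z.2).
Proof.
have cx := cD (cM (@cC 2) (c1 cm)) (cM (c1 ch) (c2 (@continuous_sin R))).
exact: cM (cS (cD (cM cx cx) (c1 cd))) (@cC _).
Qed.

Lemma elastic_speed_neq0 z : elastic_speed (m z.1) (h z.1) (d z.1) z.2 != 0.
Proof. by rewrite gt_eqF//; apply: elastic_speed_gt0 => u; exact: D0. Qed.

Lemma elastic_k_continuous2 : continuous (fun z : R * R => elastic_k (m z.1) (h z.1) z.2).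
Proof. exact: cD (c1 cm) (cM (c1 ch) (c2 (@continuous_sin R))). Qed.

Lemma elastic_T_continuous : continuous (fun p => elastic_T (m p) (h p) (d p)).
Proof.
exact: (@continuous_parameter_integral R
  (fun z => (elastic_speed (m z.1) (h z.1) (d z.1) z.2)^-1) (2 * pi)
  (cV elastic_speed_continuous2 elastic_speed_neq0)).
Qed.

Lemma elastic_Phi_continuous : continuous (fun p => elastic_Phi (m p) (h p) (d p)).
Proof.
exact: (@continuous_parameter_integral R
  (fun z => elastic_k (m z.1) (h z.1) z.2 / elastic_speed (m z.1) (h z.1) (d z.1) z.2) (2 * pi)
  (cM elastic_k_continuous2 (cV elastic_speed_continuous2 elastic_speed_neq0))).
Qed.

Hypothesis (e0 : forall p u : R, 0 < elastic_e (m p) (h p) (d p) u).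

Lemma elastic_theta_continuous : continuous (fun p => elastic_theta (m p) (h p) (d p)).
Proof.
have cal : continuous (fun z : R * R => elastic_al (m z.1) (h z.1) (d z.1)).
  apply: (@cE _ _ _ (cM (cD (cD (c1 cd) (cM (@cC (-1)) (cM (c1 ch) (c1 ch))))
    (cM (@cC (- 2)) (cM (c1 cm) (c1 cm)))) (@cC 4^-1))).
  by move=> z; rewrite /elastic_al; ring.
have cbe : continuous (fun z : R * R => elastic_be (m z.1) (h z.1) (d z.1)).
  apply: (@cE _ _ _ (cM (cM (cM (@cC (-1)) (c1 cm)) (cD (c1 cd) (cM (c1 ch) (c1 ch)))) (@cC 4^-1))).
  by move=> z; rewrite /elastic_be; ring.
have ce : continuous (fun z : R * R => elastic_e (m z.1) (h z.1) (d z.1) z.2).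
  apply: (@cE _ _ _ (cD (cD (@cC 8) (cM (@cC (- 2)) cal))
    (cM (@cC (-1)) (cM elastic_k_continuous2 elastic_k_continuous2)))).
  by move=> z; rewrite /elastic_e; ring.
have cQ : continuous (fun z : R * R => elastic_Q (m z.1) (h z.1) (d z.1)).
  have hh := cM (c1 ch) (c1 ch); have mm := cM (c1 cm) (c1 cm); have dd := c1 cd.
  have al4 := cD cal (@cC (- 4)).
  apply: (@cE _ _ _ (cD (cD (cM (cD (cD (cM hh mm) (cM hh dd))
    (cM (@cC (-1)) (cM mm (cD mm dd)))) (@cC 4^-1)) (cM al4 al4))
    (cM (cM cbe cbe) (@cC 4^-1)))).
  by move=> z; rewrite /elastic_Q; ring.
have ck1 : continuous (fun z : R * R =>
    h z.1 * cos z.2 * elastic_speed (m z.1) (h z.1) (d z.1) z.2).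
  exact: cM (cM (c1 ch) (c2 (@continuous_cos R))) elastic_speed_continuous2.
have cden : continuous (fun z : R * R =>
    4 * (h z.1 * cos z.2 * elastic_speed (m z.1) (h z.1) (d z.1) z.2) ^+ 2 +
    elastic_e (m z.1) (h z.1) (d z.1) z.2 ^+ 2).
  exact: cD (cM (@cC 4) (cM ck1 ck1)) (cM ce ce).
have den0 z : 4 * (h z.1 * cos z.2 * elastic_speed (m z.1) (h z.1) (d z.1) z.2) ^+ 2 +
    elastic_e (m z.1) (h z.1) (d z.1) z.2 ^+ 2 != 0.
  rewrite gt_eqF// ltr_pwDr ?exprn_gt0 ?e0//.
  by rewrite mulr_ge0// sqr_ge0.
exact: (@continuous_parameter_integral R
  (fun z => elastic_tau (m z.1) (h z.1) (d z.1) z.2 / elastic_speed (m z.1) (h z.1) (d z.1) z.2)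
  (2 * pi) (cM (cM (cM (cM (@cC 4) (cS cQ)) ce) (cV cden den0))
    (cV elastic_speed_continuous2 elastic_speed_neq0))).
Qed.

End ElasticContinuity.

(** * Size, monotonicity and scaling of the periods *)

Section ElasticPeriods.
Context {R : realType}.
Notation mu := (@lebesgue_measure R).
Implicit Types (h d u s X : R).

Let twopi : 0 < 2 * pi :> R. Proof. by rewrite mulr_gt0// pi_gt0. Qed.

Lemma sin_bounds u : - 1 <= sin u <= 1.
Proof. by rewrite sin_geN1 sin_le1. Qed.

Lemma h_sin_bounds h u : 0 <= h <= 1 / 2 -> - (1 / 2) <= h * sin u <= 1 / 2.
Proof.
move=> /andP[h0 h1]; have /andP[s1 s2] := sin_bounds u.
by apply/andP; split; nra.
Qed.

(** For [h <= 1 / 2] the square is at least [9 / 4], so the bound [- 5 / 4] on [d] keeps the speed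
    away from zero. *)
Lemma unit_D_ge1 h d u : 0 <= h <= 1 / 2 -> - (5 / 4) <= d ->
  1 <= (2 * 1 + h * sin u) ^+ 2 + d.
Proof. by move=> hh dd; have /andP[x1 x2] := h_sin_bounds u hh; nra. Qed.

Lemma unit_D_gt0 h d u : 0 <= h <= 1 / 2 -> - (5 / 4) <= d ->
  0 < (2 * 1 + h * sin u) ^+ 2 + d.
Proof. by move=> hh dd; exact: lt_le_trans (unit_D_ge1 u hh dd). Qed.

Lemma unit_speed_ge h d u : 0 <= h <= 1 / 2 -> - (5 / 4) <= d ->
  1 / 2 <= elastic_speed 1 h d u.
Proof.
move=> hh dd; rewrite /elastic_speed ler_pM2r ?invr_gt0//.
by rewrite -[leLHS]sqrtr1 ler_wsqrtr// unit_D_ge1.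
Qed.

Lemma unit_speed_gt0 h d u : 0 <= h <= 1 / 2 -> - (5 / 4) <= d ->
  0 < elastic_speed 1 h d u.
Proof. by move=> hh dd; have := unit_speed_ge u hh dd; lra. Qed.

Lemma continuous_unit_k_speed h d : 0 <= h <= 1 / 2 -> - (5 / 4) <= d ->
  continuous (fun u => elastic_k 1 h u / elastic_speed 1 h d u).
Proof.
move=> hh dd; have D0 u := unit_D_gt0 u hh dd.
have g0 u : elastic_speed 1 h d u != 0 by rewrite gt_eqF// unit_speed_gt0.
exact: (is_derive_continuous (fun u =>
  is_derive_divf (g0 u) (is_derive_elastic_k 1 h u) (is_derive_elastic_speed D0 u))).
Qed.

Lemma continuous_unit_speedV h d : 0 <= h <= 1 / 2 -> - (5 / 4) <= d ->
  continuous (fun u => (elastic_speed 1 h d u)^-1).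
Proof.
move=> hh dd; have D0 u := unit_D_gt0 u hh dd.
have g0 u : elastic_speed 1 h d u != 0 by rewrite gt_eqF// unit_speed_gt0.
exact: (is_derive_continuous (fun u => is_derive_inv (g0 u) (is_derive_elastic_speed D0 u))).
Qed.

Let cst_continuous_fun (c : R) : continuous (fun _ : R => c).
Proof. by move=> u; exact: cvg_cst. Qed.

Lemma elastic_Phi_decr h d d' : 0 <= h <= 1 / 2 -> - (5 / 4) <= d -> d < d' ->
  elastic_Phi 1 h d' < elastic_Phi 1 h d.
Proof.
move=> hh dd dd'; have d'd : - (5 / 4) <= d' by rewrite (le_trans dd)// ltW.
apply: Rintegral_lt => //; [exact: continuous_unit_k_speed|exact: continuous_unit_k_speed|].
move=> u; have k0 : 0 < elastic_k 1 h u.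
  by rewrite /elastic_k; have /andP[x1 x2] := h_sin_bounds u hh; lra.
rewrite ltr_pM2l// ltf_pV2 ?posrE ?unit_speed_gt0//.
by rewrite /elastic_speed ltr_pM2r ?invr_gt0// ltr_sqrt ?unit_D_gt0// ltrD2l.
Qed.

(** At this [d] the speed is at most [k]: with [x = h sin u >= - 1 / 2], four times the difference
    of the squares is [(2 x + 1) (6 x + 5) / 4 >= 0]. *)
Lemma elastic_Phi_ge h : 0 <= h <= 1 / 2 -> 2 * pi <= elastic_Phi 1 h (- (5 / 4)).
Proof.
move=> hh; have -> : 2 * pi = \int[mu]_(u in `[0, 2 * pi]) 1 :> R.
  by rewrite Rintegral_const// subr0 mulr1.
apply: Rintegral_le => //; first exact: continuous_unit_k_speed.
move=> u; have s0 := unit_speed_gt0 u hh (lexx _).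
rewrite ler_pdivlMr// mul1r /elastic_speed ler_pdivrMr//.
have /andP[x1 x2] := h_sin_bounds u hh; rewrite /elastic_k.
rewrite -(@ler_pXn2r _ 2%N) ?nnegrE ?sqrtr_ge0//; last by lra.
by rewrite sqr_sqrtr ?(ltW (unit_D_gt0 _ _ _))//; nra.
Qed.

(** For [d = 100] the speed is at least 5 while [k <= 3 / 2], so the integrand is at most
    [3 / 10]. *)
Lemma elastic_Phi_le h : 0 <= h <= 1 / 2 -> elastic_Phi 1 h 100 < pi.
Proof.
move=> hh; have d100 : - (5 / 4) <= 100 :> R by lra.
apply: (@le_lt_trans _ _ (\int[mu]_(u in `[0, 2 * pi]) (3 / 10))); last first.
  by rewrite Rintegral_const//; have := @pi_gt0 R; lra.
apply: Rintegral_le => //; first exact: continuous_unit_k_speed.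
move=> u; have s0 := unit_speed_gt0 u hh d100.
rewrite ler_pdivrMr//; have /andP[x1 x2] := h_sin_bounds u hh; rewrite /elastic_k.
suff : 5 <= elastic_speed 1 h 100 u by lra.
rewrite /elastic_speed ler_pdivlMr// -(@ler_pXn2r _ 2%N) ?nnegrE ?sqrtr_ge0//.
rewrite sqr_sqrtr ?(ltW (unit_D_gt0 _ _ _))//.
by have := sqr_ge0 (2 * 1 + h * sin u); lra.
Qed.

Lemma elastic_Phi_circle : elastic_Phi 1 0 0 = 2 * pi :> R.
Proof.
have -> : 2 * pi = \int[mu]_(u in `[0, 2 * pi]) 1 :> R.
  by rewrite Rintegral_const// subr0 mulr1.
apply: eq_Rintegral => u _; rewrite /elastic_k /elastic_speed !mul0r !addr0 sqrtr_sqr.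
by rewrite ger0_norm//; field.
Qed.

Lemma speed_d0 m h u : 0 <= 2 * m + h * sin u ->
  elastic_speed m h 0 u = (2 * m + h * sin u) / 2.
Proof. by move=> x0; rewrite /elastic_speed addr0 sqrtr_sqr ger0_norm. Qed.

(** With [S = sin u] the integrand is [1 + S / (4 + S)]. It lies below [g], because the gap times
    [4 + S] is [S ^ 2 (1 - S) / 20], and [g] integrates to [2 pi - pi / 20]. The strict inequality
    leaves room for [Phi] below [2 pi]. *)
Lemma elastic_Phi_half_lt : elastic_Phi 1 (1 / 2) 0 < 2 * pi :> R.
Proof.
have hh : 0 <= (1 / 2 : R) <= 1 / 2 by apply/andP; split; lra.
have d0 : - (5 / 4) <= 0 :> R by lra.
pose g (u : R) := 1 + (1 / 4) * sin u - (1 / 20) * sin u ^+ 2.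
pose P (u : R) := u - (1 / 4) * cos u - (1 / 40) * (u - sin u * cos u).
have dP u : is_derive u (1 : R) P (g u).
  have ds := is_derive_sin u; have dc := is_derive_cos u.
  have di := is_derive_id u (1 : R).
  apply: (is_derive_eq (is_derive_subf (is_derive_subf di (is_derive_scale (1 / 4) dc))
    (is_derive_scale (1 / 40) (is_derive_subf di (is_derive_mulf ds dc))))).
  have := cos2Dsin2 u; rewrite /g; move: (sin u) (cos u) => S C E.
  apply/eqP; rewrite -subr_eq0 [X in X == _](_ : _ = (C ^+ 2 + S ^+ 2 - 1) / 40).
    by rewrite E subrr mul0r.
  by field.
have cg : continuous g.
  have ds u := is_derive_sin u.
  exact: (is_derive_continuous (fun u => is_derive_subf
    (is_derive_addf (is_derive_const u 1) (is_derive_scale (1 / 4) (ds u)))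
    (is_derive_scale (1 / 20) (is_derive_mulf (ds u) (ds u))))).
apply: (@le_lt_trans _ _ (\int[mu]_(u in `[0, 2 * pi]) g u)); last first.
  rewrite -(primitive_integral twopi cg dP) /P.
  rewrite -[2 * pi]add0r -[2 * pi]mulr1 (cos_period 0 1) (sin_period 0 1) sin0 cos0.
  by have := @pi_gt0 R; lra.
apply: Rintegral_le => //; first exact: continuous_unit_k_speed.
move=> u; have /andP[x1 x2] := sin_bounds u.
rewrite speed_d0; last by lra.
rewrite ler_pdivrMr; last by lra.
by rewrite /g /elastic_k; move: (sin u) x1 x2 => S x1 x2; nra.
Qed.

(** The speed is homogeneous of degree one, so this scaling divides [T] by [s] and preserves [Phi].
    One normalises [m = 1] and adjusts the length afterwards; [theta] has no such invariance, since
    [elastic_e] contains the constant 8. *)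
Lemma elastic_speed_scale s h d u : 0 < s ->
  elastic_speed s (s * h) (s ^+ 2 * d) u = s * elastic_speed 1 h d u.
Proof.
move=> s0; rewrite /elastic_speed mulrA; congr (_ / _).
rewrite (_ : _ + _ = s ^+ 2 * ((2 * 1 + h * sin u) ^+ 2 + d)); last by ring.
by rewrite sqrtrM ?sqr_ge0// sqrtr_sqr ger0_norm// ltW.
Qed.

Lemma elastic_T_scale s h d : 0 < s -> 0 <= h <= 1 / 2 -> - (5 / 4) <= d ->
  elastic_T s (s * h) (s ^+ 2 * d) = elastic_T 1 h d / s.
Proof.
move=> s0 hh dd; rewrite [RHS]mulrC /elastic_T -Rintegral_scale; last exact: continuous_unit_speedV.
by apply: eq_Rintegral => u _; rewrite elastic_speed_scale// invfM.
Qed.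

Lemma elastic_Phi_scale s h d : 0 < s ->
  elastic_Phi s (s * h) (s ^+ 2 * d) = elastic_Phi 1 h d.
Proof.
move=> s0; apply: eq_Rintegral => u _; rewrite elastic_speed_scale//.
rewrite /elastic_k.
by rewrite -mulrA -{1}[s]mulr1 -mulrDr invfM mulrACA divff ?gt_eqF// mul1r.
Qed.

(** The integrand is at most 2, and [4 pi < 16]. *)
Lemma elastic_T_bounds h d : 0 <= h <= 1 / 2 -> - (5 / 4) <= d ->
  0 < elastic_T 1 h d <= 16.
Proof.
move=> hh dd; have cs := continuous_unit_speedV hh dd; apply/andP; split.
  have <- : \int[mu]_(u in `[0, 2 * pi]) 0 = 0 :> R by rewrite Rintegral_const// mulr0.
  by apply: Rintegral_lt => // u; rewrite invr_gt0 unit_speed_gt0.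
apply: (@le_trans _ _ (\int[mu]_(u in `[0, 2 * pi]) 2)).
  apply: Rintegral_le => // u; rewrite invf_ple ?posrE ?unit_speed_gt0//.
  by have := unit_speed_ge u hh dd; lra.
by rewrite Rintegral_const//; have := @pihalf_lt2 R; lra.
Qed.

(** The scale [16 / 100] is the bound on [T] divided by the least prescribed length; all corrections
    to the leading 8 are then small, even for [d = 100]. *)
Lemma elastic_e_gt0 s h d u : 0 <= s <= 16 / 100 -> 0 <= h <= 1 / 2 -> d <= 100 ->
  0 < elastic_e s (s * h) (s ^+ 2 * d) u.
Proof.
move=> /andP[s0 s1] hh dd; have /andP[x1 x2] := h_sin_bounds u hh.
have ss : s ^+ 2 <= 256 / 10000 by nra.
rewrite /elastic_e /elastic_al /elastic_k -mulrA.
have -> : s + s * (h * sin u) = s * (1 + h * sin u) by ring.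
move: (h * sin u) x1 x2 => x x1 x2.
have xx : (1 + x) ^+ 2 <= 9 / 4 by move: x1 x2; clear => x1 x2; nra.
have sd : s ^+ 2 * d <= 256 / 10000 * 100.
  by apply: (@le_trans _ _ (s ^+ 2 * 100)); [rewrite ler_wpM2l ?sqr_ge0|rewrite ler_wpM2r].
have sx : (s * (1 + x)) ^+ 2 <= 256 / 10000 * (9 / 4).
  by rewrite exprMn ler_pM// sqr_ge0.
move: (sqr_ge0 (s * h)) (sqr_ge0 s) sd sx; clear.
by move: (s ^+ 2 * d) ((s * h) ^+ 2) (s ^+ 2) ((s * (1 + x)) ^+ 2) => A B C D *; lra.
Qed.

End ElasticPeriods.

(** * Exact periods at the two ends of the family *)

Section ElasticLimits.
Context {R : realType}.
Notation mu := (@lebesgue_measure R).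
Implicit Types (m h d u : R).

Let twopi : 0 < 2 * pi :> R. Proof. by rewrite mulr_gt0// pi_gt0. Qed.

Let cst_continuous_fun (c : R) : continuous (fun _ : R => c).
Proof. by move=> u; exact: cvg_cst. Qed.

Lemma elastic_Phi_h0 m d : elastic_Phi m 0 d = m * elastic_T m 0 d.
Proof.
rewrite /elastic_T -Rintegral_scale.
  by apply: eq_Rintegral => u _; rewrite /elastic_k mul0r addr0.
rewrite (_ : (fun u => _) = (fun _ => (elastic_speed m 0 d 0)^-1)).
  exact: cst_continuous_fun.
by apply/funext => u; rewrite /elastic_speed !mul0r.
Qed.

(** For constant curvature [Q] is [(e / 4) ^ 2 (4 + m ^ 2)], so the angular velocity is the constant
    [sqrt (4 + m ^ 2)]. *)
Lemma elastic_theta_h0 m d : (forall u, 0 < elastic_e m 0 d u) ->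
  elastic_theta m 0 d = Num.sqrt (4 + m ^+ 2) * elastic_T m 0 d.
Proof.
move=> e0; rewrite /elastic_T -Rintegral_scale.
  apply: eq_Rintegral => u _; congr (_ * _); rewrite /elastic_tau.
  have eu0 := e0 u.
  have -> : elastic_Q m 0 d = (elastic_e m 0 d u / 4) ^+ 2 * (4 + m ^+ 2).
    by rewrite /elastic_Q /elastic_e /elastic_al /elastic_be /elastic_k; field.
  rewrite sqrtrM ?sqr_ge0// sqrtr_sqr ger0_norm; last by rewrite divr_ge0// ltW.
  move: (elastic_e m 0 d u) (Num.sqrt (4 + m ^+ 2)) (gt_eqF eu0) => E S E0.
  by field; rewrite E0.
rewrite (_ : (fun u => _) = (fun _ => (elastic_speed m 0 d 0)^-1)).
  exact: cst_continuous_fun.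
by apply/funext => u; rewrite /elastic_speed !mul0r.
Qed.

Section ZeroD.
Variables (m h : R).
Hypothesis (m_gt0 : 0 < m) (m_le : m <= 16 / 100) (h_ge0 : 0 <= h) (h_le : h <= m / 2).

Let Om := Num.sqrt (4 + m ^+ 2).
Let xx u := 1 - h ^+ 2 / 16 - m * h / 4 * sin u.
Let yy u := h / 4 * Om * cos u.

Let hs u : - (m / 2) <= h * sin u <= m / 2.
Proof.
have /andP[s1 s2] := sin_bounds u.
have x1 : h * sin u <= h by rewrite ler_piMr.
have x2 : - h <= h * sin u by rewrite -[- h]mulrN1 ler_wpM2l.
by rewrite (le_trans x1 h_le) (le_trans _ x2)// lerN2.
Qed.

Let lin_gt0 u : 0 < 2 * m + h * sin u.
Proof. by have /andP[x1 x2] := hs u; have := m_gt0; lra. Qed.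

Let speedE u : elastic_speed m h 0 u = (2 * m + h * sin u) / 2.
Proof. by rewrite speed_d0// ltW. Qed.

Let xx_gt0 u : 0 < xx u.
Proof.
have /andP[x1 x2] := hs u; rewrite /xx (_ : m * h / 4 * sin u = m * (h * sin u) / 4); last by ring.
move: (h * sin u) x1 x2 => x x1 x2.
have m0 := m_gt0; have m1 := m_le; have h0 := h_ge0; have h1 := h_le.
have h2 : h ^+ 2 <= 64 / 10000 by nra.
have mx : m * x <= 1 by nra.
by move: (h ^+ 2) (m * x) h2 mx => H M *; lra.
Qed.

Let Om2 : Om ^+ 2 = 4 + m ^+ 2.
Proof. by rewrite /Om sqr_sqrtr// addr_ge0// sqr_ge0. Qed.

Let continuous_speedV : continuous (fun u => (elastic_speed m h 0 u)^-1).
Proof.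
have D0 u : 0 < (2 * m + h * sin u) ^+ 2 + 0 by rewrite addr0 exprn_gt0.
have g0 u : elastic_speed m h 0 u != 0 by rewrite gt_eqF// elastic_speed_gt0.
exact: (is_derive_continuous (fun u => is_derive_inv (g0 u) (is_derive_elastic_speed D0 u))).
Qed.

(** For [d = 0] the speed is [(m + k) / 2], hence [k / speed = 2 - m / speed]. *)
Lemma elastic_Phi_d0 : elastic_Phi m h 0 = 4 * pi - m * elastic_T m h 0.
Proof.
have -> : 4 * pi = \int[mu]_(u in `[0, 2 * pi]) 2 :> R by rewrite Rintegral_const//; ring.
rewrite -mulNr /elastic_T -Rintegral_scale// -Rintegral_add//.
  apply: eq_Rintegral => u _; rewrite speedE /elastic_k.
  by have := lin_gt0 u; move: (sin u) => S; move=> /gt_eqF/negbT; move=> E; field.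
by move=> u; apply: (@cvgM _ _ _ _ _ _ (- m)); [exact: cvg_cst|exact: continuous_speedV].
Qed.

Let dxx u : is_derive u (1 : R) xx (- (m * h / 4 * cos u)).
Proof.
apply: (is_derive_eq (is_derive_subf (is_derive_const u (1 - h ^+ 2 / 16))
  (is_derive_scale (m * h / 4) (is_derive_sin u)))).
by rewrite sub0r.
Qed.

Let dyy u : is_derive u (1 : R) yy (h / 4 * Om * - sin u).
Proof. exact: (is_derive_scale (h / 4 * Om) (is_derive_cos u)). Qed.

Let nn_neq0 u : xx u * xx u + yy u * yy u != 0.
Proof. by rewrite -!expr2 gt_eqF// ltr_pwDl ?sqr_ge0// exprn_gt0. Qed.

Let B u := h / 4 * Om * (sin u * xx u - m * h / 4 * (cos u * cos u)) /
  (xx u * xx u + yy u * yy u).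

Let B_continuous : continuous B.
Proof.
exact: (is_derive_continuous (fun u => @is_derive_divf R
  (fun u => h / 4 * Om * (sin u * xx u - m * h / 4 * (cos u * cos u)))
  (fun u => xx u * xx u + yy u * yy u) u _ _ (nn_neq0 u)
  (is_derive_scale (h / 4 * Om) (is_derive_subf (is_derive_mulf (is_derive_sin u) (dxx u))
    (is_derive_scale (m * h / 4) (is_derive_mulf (is_derive_cos u) (is_derive_cos u)))))
  (is_derive_addf (is_derive_mulf (dxx u) (dxx u)) (is_derive_mulf (dyy u) (dyy u))))).
Qed.

Let dA u : is_derive u (1 : R) (fun u => - atan (yy u / xx u)) (B u).
Proof.
have x0 : xx u != 0 by rewrite gt_eqF.
have dq := is_derive_divf x0 (dyy u) (dxx u).
have da := @is_derive1_comp R (@atan R) _ u _ _ (is_derive1_atan _) dq.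
apply: (is_derive_eq (@is_deriveN _ _ _ _ _ _ _ da)).
have N0 := nn_neq0 u; rewrite /B {2}/yy; field.
by rewrite x0 -!expr2 in N0 *; rewrite N0.
Qed.

(* [4 k' ^ 2 + e ^ 2 = 64 (xx ^ 2 + yy ^ 2)], and the integrand differs from
   [Om / elastic_speed] by the derivative of the argument of [xx - i yy]. *)
Let tauE u : elastic_tau m h 0 u / elastic_speed m h 0 u =
  Om * (elastic_speed m h 0 u)^-1 + B u.
Proof.
have Q0 : Num.sqrt (elastic_Q m h 0) = Om * (2 + h ^+ 2 / 8).
  rewrite (_ : elastic_Q m h 0 = (Om * (2 + h ^+ 2 / 8)) ^+ 2).
    by rewrite sqrtr_sqr ger0_norm// mulr_ge0 ?sqrtr_ge0// addr_ge0// divr_ge0// sqr_ge0.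
  by rewrite exprMn Om2 /elastic_Q /elastic_al /elastic_be; field.
rewrite /elastic_tau Q0 speedE.
have -> : elastic_e m h 0 u = 8 * (1 + h ^+ 2 / 16 - m * h / 4 * sin u) - h ^+ 2 * sin u ^+ 2.
  by rewrite /elastic_e /elastic_al /elastic_k; field.
have C2 : cos u ^+ 2 = 1 - sin u ^+ 2 by rewrite -(cos2Dsin2 u) addrK.
have L0 := gt_eqF (lin_gt0 u); have O2 := Om2; have := nn_neq0 u.
rewrite /B -!expr2 C2.
have NE : xx u ^+ 2 + yy u ^+ 2 = (1 - h ^+ 2 / 16 - m * h / 4 * sin u) ^+ 2
    + (h / 4) ^+ 2 * (4 + m ^+ 2) * (1 - sin u ^+ 2).
  by rewrite /yy !exprMn O2 C2.
rewrite [X in _ / X / _](_ : _ = 64 * (xx u ^+ 2 + yy u ^+ 2)); last first.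
  by rewrite NE !exprMn C2; field.
move: NE L0; rewrite [X in sin u * X](_ : xx u = 1 - h ^+ 2 / 16 - m * h / 4 * sin u)//.
move: (xx u ^+ 2 + yy u ^+ 2) (sin u) Om => N S W NE /negbT L0 N0.
apply/eqP; rewrite -subr_eq0; apply/eqP.
rewrite [LHS](_ : _ = (N - ((1 - h ^+ 2 / 16 - m * h / 4 * S) ^+ 2
    + (h / 4) ^+ 2 * (4 + m ^+ 2) * (1 - S ^+ 2))) * W * - 2 / (N * (2 * m + h * S))).
  by rewrite NE subrr !mul0r.
by field; rewrite N0 L0.
Qed.

Lemma elastic_theta_d0 : elastic_theta m h 0 = Om * elastic_T m h 0.
Proof.
rewrite /elastic_T -Rintegral_scale; last exact: continuous_speedV.
rewrite -[RHS]addr0.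
(* [B] is the derivative of a periodic function, globally defined because [xx] is positive. *)
have B0 : \int[mu]_(u in `[0, 2 * pi]) B u = 0.
  rewrite -(primitive_integral twopi B_continuous dA).
  rewrite -[2 * pi]add0r -[2 * pi]mulr1 /yy /xx (cos_period 0 1) (sin_period 0 1).
  by rewrite subrr.
rewrite -[X in _ = _ + X]B0 -Rintegral_add//; first by apply: eq_Rintegral => u _; exact: tauE.
by move=> u; apply: (@cvgM _ _ _ _ _ _ Om); [exact: cvg_cst|exact: continuous_speedV].
Qed.

End ZeroD.
End ElasticLimits.

(** * Choice of the elastic curve *)

Section ElasticParameters.
Context {R : realType}.
Implicit Types (h d p Phi : R) (hc delta : R -> R).

Lemma elastic_level h Phi : 0 <= h <= 1 / 2 -> pi <= Phi <= 2 * pi ->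
  exists d, - (5 / 4) <= d <= 100 /\ elastic_Phi 1 h d = Phi.
Proof.
move=> hh /andP[P1 P2].
(* The interval from [- 5 / 4] to [100] is swept by a function on the whole line, since the
   continuity lemmas require admissible parameters everywhere. *)
pose dc (y : R) := - (5 / 4) + 405 / 4 * sin y ^+ 2.
have s01 (y : R) : 0 <= sin y ^+ 2 <= 1.
  by rewrite sqr_ge0/= -(cos2Dsin2 y) lerDr sqr_ge0.
have dc_ge y : - (5 / 4) <= dc y.
  by rewrite /dc lerDl; apply: mulr_ge0; [lra|exact: sqr_ge0].
have cdc : continuous dc.
  have ds (y : R) := is_derive_sin y.
  exact: (is_derive_continuous (fun y => is_derive_addf (is_derive_const y (- (5 / 4)))
    (is_derive_scale (405 / 4) (is_derive_mulf (ds y) (ds y))))).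
have cst (c : R) : continuous (fun _ : R => c) by move=> y; exact: cvg_cst.
have cf : continuous (fun y => elastic_Phi 1 h (dc y)).
  apply: (@elastic_Phi_continuous R (fun=> 1) (fun=> h) dc) => // y u.
  exact: unit_D_gt0.
have pi2 : 0 <= pi / 2 :> R by rewrite divr_ge0// pi_ge0.
have f0 : 2 * pi <= elastic_Phi 1 h (dc 0).
  by rewrite /dc sin0 expr0n mulr0 addr0 elastic_Phi_ge.
have f1 : elastic_Phi 1 h (dc (pi / 2)) < pi.
  rewrite /dc sin_pihalf expr1n (_ : _ + _ = 100); first exact: elastic_Phi_le.
  by field.
have [||y _ E] := @IVT R (fun y => elastic_Phi 1 h (dc y)) 0 (pi / 2) Phi pi2.
- by apply: continuous_subspaceT => y; exact: cf.
- by rewrite ge_min le_max (le_trans P2 f0) (le_trans (ltW f1) P1) orbT.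
exists (dc y); split => //; rewrite dc_ge/=.
by have /andP[_ a2] := s01 y; rewrite /dc; move: (_ ^+ 2) a2; clear => x x1; lra.
Qed.

(** An implicit function theorem by monotonicity: [Phi] is strictly decreasing in [d], so its values
    at [delta p0 - eps] and [delta p0 + eps] enclose the level strictly, and still do so for nearby
    [p]. *)
Lemma elastic_level_continuous hc delta Phi : continuous hc ->
  (forall p, 0 <= hc p <= 1 / 2) -> (forall p, - (5 / 4) <= delta p) ->
  (forall p, elastic_Phi 1 (hc p) (delta p) = Phi) -> continuous delta.
Proof.
move=> ch hh dd PE p0.
have cst (c : R) : continuous (fun _ : R => c) by move=> y; exact: cvg_cst.
have cA q : - (5 / 4) <= q -> continuous (fun p => elastic_Phi 1 (hc p) q).
  move=> q0; apply: (@elastic_Phi_continuous R (fun=> 1) hc (fun=> q)) => // y u.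
  exact: unit_D_gt0.
apply/cvgrPdist_lt => eps eps0.
have lo : \forall p \near p0, delta p0 - eps < delta p.
  have [q0|q0] := ltP (delta p0 - eps) (- (5 / 4)).
    by apply: (@filterE _ (nbhs p0)) => p; exact: lt_le_trans q0 (dd p).
  have A0 : Phi < elastic_Phi 1 (hc p0) (delta p0 - eps).
    by rewrite -(PE p0); apply: elastic_Phi_decr => //; rewrite gtrBl.
  have N : \forall p \near p0, Phi < elastic_Phi 1 (hc p) (delta p0 - eps).
    exact: cvgr_gt (cA _ q0 p0) _ A0.
  apply: filterS N => p Ap; rewrite ltNge; apply/negP.
  rewrite le_eqVlt => /orP[/eqP E|E]; first by move: Ap; rewrite -E PE ltxx.
  by have := elastic_Phi_decr (hh p) (dd p) E; rewrite PE; move/(lt_trans Ap); rewrite ltxx.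
have up : \forall p \near p0, delta p < delta p0 + eps.
  have q0 : - (5 / 4) <= delta p0 + eps by rewrite (le_trans (dd p0))// lerDl ltW.
  have A0 : elastic_Phi 1 (hc p0) (delta p0 + eps) < Phi.
    by rewrite -(PE p0); apply: elastic_Phi_decr => //; rewrite ltrDl.
  have N : \forall p \near p0, elastic_Phi 1 (hc p) (delta p0 + eps) < Phi.
    exact: cvgr_lt (cA _ q0 p0) _ A0.
  apply: filterS N => p Ap; rewrite ltNge; apply/negP.
  rewrite le_eqVlt => /orP[/eqP E|E]; first by move: Ap; rewrite E PE ltxx.
  by have := elastic_Phi_decr (hh p) q0 E; rewrite PE => /lt_trans/(_ Ap); rewrite ltxx.
by apply: filterS2 lo up => p l1 l2; rewrite ltr_distlC l1.
Qed.

(* Along the family [(1, h, delta h)] of curves with a given [Phi], rescaled to length [X],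
   [theta ^ 2] is [4 X ^ 2 + Phi ^ 2] at the circle [h = 0] and
   [4 X ^ 2 + (4 pi - Phi) ^ 2] where [delta] vanishes, and [Phi < 2 pi]. *)
Lemma elastic_parameters : exists Phi0 : R, Phi0 < 2 * pi /\
  forall Phi X : R, Phi0 < Phi -> Phi < 2 * pi -> 100 <= X ->
  exists (m h d : R) (r : rat),
    [/\ forall u, 0 < (2 * m + h * sin u) ^+ 2 + d, forall u, 0 < elastic_e m h d u,
        elastic_T m h d = X, elastic_Phi m h d = Phi &
        elastic_theta m h d = 2 * pi * ratr r].
Proof.
(* Being above the first value forces [delta] to change sign before [h = 1 / 2]; being above [pi]
   makes the level attainable. *)
exists (Num.max (elastic_Phi 1 (1 / 2) 0) pi); split.
  by rewrite gt_max elastic_Phi_half_lt/= mulr2n mulrDl mul1r ltrDl pi_gt0.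
move=> Phi X; rewrite gt_max => /andP[PhiA Phipi] Phi2 X100.
pose hc (p : R) := 1 / 2 * (sin p * sin p).
have hh p : 0 <= hc p <= 1 / 2.
  have S0 : 0 <= sin p ^+ 2 by exact: sqr_ge0.
  have S1 : sin p ^+ 2 <= 1 by rewrite -(cos2Dsin2 p) lerDr sqr_ge0.
  by rewrite /hc -expr2; move: (sin p ^+ 2) S0 S1 => x x0 x1; apply/andP; split; lra.
have chc : continuous hc.
  have ds (y : R) := is_derive_sin y.
  exact: (is_derive_continuous (fun y => is_derive_scale (1 / 2) (is_derive_mulf (ds y) (ds y)))).
have cst (c : R) : continuous (fun _ : R => c) by move=> y; exact: cvg_cst.
have Phir : pi <= Phi <= 2 * pi by rewrite !ltW.
pose delta p := projT1 (cid (elastic_level (hh p) Phir)).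
have dd p : - (5 / 4) <= delta p <= 100 by have [] := projT2 (cid (elastic_level (hh p) Phir)).
have PE p : elastic_Phi 1 (hc p) (delta p) = Phi.
  by have [] := projT2 (cid (elastic_level (hh p) Phir)).
have dd1 p : - (5 / 4) <= delta p by have /andP[] := dd p.
have dd2 p : delta p <= 100 by have /andP[] := dd p.
have cdelta := elastic_level_continuous chc hh dd1 PE.
have h0 : hc 0 = 0 by rewrite /hc sin0 !mulr0.
have h1 : hc (pi / 2) = 1 / 2 by rewrite /hc sin_pihalf !mulr1.
have z54 : - (5 / 4) <= 0 :> R by lra.
(* Monotonicity compares [Phi] with the value at [d = 0]: it is smaller at the circle, where that
   value is [2 pi], and larger at [h = 1 / 2]. A zero of [delta] lies in between. *)
have del0 : 0 <= delta 0.
  rewrite leNgt; apply/negP => E; have := elastic_Phi_decr (hh 0) (dd1 0) E.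
  by rewrite PE h0 elastic_Phi_circle => /(lt_trans Phi2); rewrite ltxx.
have del1 : delta (pi / 2) <= 0.
  rewrite leNgt; apply/negP => E; have := elastic_Phi_decr (hh (pi / 2)) z54 E.
  by rewrite PE h1 => /(lt_trans PhiA); rewrite ltxx.
have pi2 : 0 <= pi / 2 :> R by rewrite divr_ge0// pi_ge0.
have [||p1 /itvP p1I delp1] := @IVT R delta 0 (pi / 2) 0 pi2.
- by apply: continuous_subspaceT => y; exact: cdelta.
- by rewrite ge_min le_max del0 del1 orbT.
have X0 : 0 < X by rewrite (lt_le_trans _ X100).
(* This scale factor brings every curve of the family to period [X]. *)
pose s p := elastic_T 1 (hc p) (delta p) / X.
have sI p : 0 < s p <= 16 / 100.
  have /andP[T0 T1] := elastic_T_bounds (hh p) (dd1 p).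
  by rewrite /s divr_gt0//= ler_pdivrMr//; move: T1 X100; lra.
have s0 p : 0 < s p by have /andP[] := sI p.
have s1 p : s p <= 16 / 100 by have /andP[] := sI p.
have cs : continuous s.
  have cT : continuous (fun p => elastic_T 1 (hc p) (delta p)).
    apply: (@elastic_T_continuous R (fun=> 1) hc delta) => // p u; exact: unit_D_gt0.
  by move=> p; apply: cvgM; [exact: cT|exact: cvg_cst].
pose hs p := s p * hc p; pose ds p := s p ^+ 2 * delta p.
have chs : continuous hs by move=> p; apply: cvgM; [exact: cs|exact: chc].
have cds : continuous ds.
  by move=> p; apply: cvgM; [apply: cvgM; exact: cs|exact: cdelta].
have D0 p u : 0 < (2 * s p + hs p * sin u) ^+ 2 + ds p.
  rewrite (_ : _ + _ = s p ^+ 2 * ((2 * 1 + hc p * sin u) ^+ 2 + delta p)).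
    by rewrite mulr_gt0 ?exprn_gt0// unit_D_gt0.
  by rewrite /hs /ds; ring.
have e0 p u : 0 < elastic_e (s p) (hs p) (ds p) u.
  by apply: elastic_e_gt0; rewrite ?(ltW (s0 p)) ?s1.
have TX p : elastic_T (s p) (hs p) (ds p) = X.
  rewrite elastic_T_scale// /s invf_div mulrCA divff ?mulr1// gt_eqF//.
  by have /andP[] := elastic_T_bounds (hh p) (dd1 p).
have PX p : elastic_Phi (s p) (hs p) (ds p) = Phi by rewrite elastic_Phi_scale// PE.
have cth : continuous (fun p => elastic_theta (s p) (hs p) (ds p)).
  exact: elastic_theta_continuous.
have th0 : elastic_theta (s 0) (hs 0) (ds 0) = Num.sqrt (4 + s 0 ^+ 2) * X.
  by have e00 := e0 0; rewrite -(TX 0) /hs h0 mulr0 in e00 *; exact: elastic_theta_h0.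
have ph0 : s 0 * X = Phi.
  by rewrite -(PX 0) -(TX 0) /hs h0 mulr0 elastic_Phi_h0.
have hs1 : 0 <= hs p1.
  by have /andP[hp _] := hh p1; rewrite /hs mulr_ge0// ltW.
have hs2 : hs p1 <= s p1 / 2.
  by have /andP[_ hp] := hh p1; rewrite /hs ler_pM2l// -div1r.
have th1 : elastic_theta (s p1) (hs p1) (ds p1) = Num.sqrt (4 + s p1 ^+ 2) * X.
  by rewrite -(TX p1) /ds delp1 mulr0; exact: elastic_theta_d0.
have ph1 : Phi = 4 * pi - s p1 * X.
  by rewrite -(PX p1) -(TX p1) /ds delp1 mulr0; exact: elastic_Phi_d0.
clearbody s; clearbody hs ds.
(* At the two ends [s X] is [Phi] and [4 pi - Phi]; these differ because [Phi < 2 pi], so [theta] is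
   not constant. *)
have lt01 : s 0 < s p1.
  rewrite -(ltr_pM2r X0) ph0; move: (s p1 * X) (pi : R) ph1 Phi2 => y z; clear.
  by move=> E1 E2; lra.
have th01 : elastic_theta (s 0) (hs 0) (ds 0) < elastic_theta (s p1) (hs p1) (ds p1).
  rewrite th0 th1 ltr_pM2r// ltr_sqrt ?ltrD2l ?ltr_pXn2r ?nnegrE ?ltW//.
  by rewrite ltr_pwDl// sqr_ge0.
have tp : 0 < 2 * pi :> R by rewrite mulr_gt0// pi_gt0.
have [|r] := @rat_in_itvoo R (elastic_theta (s 0) (hs 0) (ds 0) / (2 * pi))
  (elastic_theta (s p1) (hs p1) (ds p1) / (2 * pi)).
  by rewrite ltr_pM2r// invr_gt0.
rewrite in_itv/= ltr_pdivrMr// ltr_pdivlMr// => /andP[r1 r2].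
have [|||p _ thp] := @IVT R (fun p => elastic_theta (s p) (hs p) (ds p)) 0 p1 (ratr r * (2 * pi)).
- by rewrite p1I.
- by apply: continuous_subspaceT => y; exact: cth.
- by rewrite ge_min le_max (ltW r1) (ltW r2) orbT.
by exists (s p), (hs p), (ds p), r; split => //; rewrite thp mulrC.
Qed.

End ElasticParameters.

Theorem corollary1 (R : realType) (w1 w2 : R * R) (hw : R_independent w1 w2) :
  exists f : R * R -> 'rV[R]_4,
    conformal_immersion w1 w2 f /\ constrained_willmore w1 w2 f.
Proof.
have tp : 0 < 2 * pi :> R by rewrite mulr_gt0// pi_gt0.
have [Phi0 [Phi0lt params]] := @elastic_parameters R.
pose D := det2 w1 w2; have D0 : D != 0 := hw.
pose L := w1.1 ^+ 2 + w1.2 ^+ 2.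
have L0 : 0 < L.
  rewrite lt_def addr_ge0 ?sqr_ge0// andbT; apply: contra_neq D0 => /eqP.
  rewrite paddr_eq0 ?sqr_ge0// !sqrf_eq0 => /andP[/eqP e1 /eqP e2].
  by rewrite /D /det2 e1 e2 !mul0r subrr.
(* The similarity taking [w1] to one turn [2 pi] of the fibre takes [w2] to the displacement [X1]
   along the curve, up to orientation, and [Y1] along the fibre. *)
pose X1 := 2 * pi * `|D| / L; pose Y1 := 2 * pi * (w1.1 * w2.1 + w1.2 * w2.2) / L.
have X10 : 0 < X1 by rewrite divr_gt0// mulr_gt0// normr_gt0.
(* Covering the fibre [N] times multiplies [X1] and [Y1] by [N], which reaches the length 100
   required by [params]. *)
pose N := (Num.truncn (100 / X1)).+1.
have NX : 100 <= N%:R * X1 by rewrite -ler_pdivrMr// ltW// truncnS_gt.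
(* [r] is chosen so that [Phi], corrected by the fibre shift [2 N Y1], is [4 pi r], while [Phi]
   falls between [Phi0] and [2 pi]. *)
have [|r] := @rat_in_itvoo R ((Phi0 + 2 * N%:R * Y1) / (4 * pi))
  ((2 * pi + 2 * N%:R * Y1) / (4 * pi)).
  by rewrite ltr_pM2r ?ltrD2r// invr_gt0 mulr_gt0// pi_gt0.
have fp : 0 < 4 * pi :> R by rewrite mulr_gt0// pi_gt0.
rewrite in_itv/= ltr_pdivrMr// ltr_pdivlMr// => /andP[r1 r2].
pose Phi := ratr r * (4 * pi) - 2 * N%:R * Y1.
have [||m [h [d [q [D_gt0 e_gt0 TE PhiE thetaE]]]]] := params Phi (N%:R * X1) _ _ NX.
- by rewrite /Phi ltrBrDr.
- by rewrite /Phi ltrBlDr.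
have [a [b [c [d' [p [q' [r' [t [k [k1 [m' [n' [hc per]]]]]]]]]]]]] := elastic_curve D_gt0 e_gt0.
(* After [j] periods the phases change by [j (Phi + theta) / 2] and [j (Phi - theta) / 2], with
   [theta = 2 pi q]; the factor 2 compensates the half in front of [theta]. *)
pose j := (2 * (`|denq r| * `|denq q|))%N.
have jE : j%:R = 2 * ((denq r)%:~R * (denq q)%:~R) :> R.
  by rewrite /j !natrM !natr_absz !gtr0_norm ?denq_gt0.
have dr0 : (denq r)%:~R != 0 :> R by rewrite intr_eq0 denq_eq0.
have dq0 : (denq q)%:~R != 0 :> R by rewrite intr_eq0 denq_eq0.
have j0 : 0 < j%:R :> R by rewrite jE !mulr_gt0// ltr0z denq_gt0.
pose M : R := j%:R * N%:R.
have M0 : 0 < M by rewrite mulr_gt0// ltr0n.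
pose s : R := - Num.sg D.
have s2 : s ^+ 2 = 1 by rewrite /s sqrrN sqr_sg D0.
have sD : s * D = - `|D| by rewrite /s mulNr -normrEsg.
(* [u] is orthogonal to [w1] and scaled so that [w1] becomes [M = j N] fibre turns; the sign [s]
   makes [w2] advance along the curve by [+ j T]. *)
clearbody s; pose u : R * R := (s * w1.2 / (2 * pi * M), - s * w1.1 / (2 * pi * M)).
have piM : 2 * pi * M != 0 by rewrite gt_eqF// mulr_gt0.
have lE : u.1 ^+ 2 + u.2 ^+ 2 = L / (2 * pi * M) ^+ 2.
  rewrite /u /= !expr_div_n -mulrDl; congr (_ / _).
  by rewrite !exprMn sqrrN s2 !mul1r addrC.
have l0 : L / (2 * pi * M) ^+ 2 != 0 by rewrite gt_eqF// divr_gt0// exprn_gt0// mulr_gt0.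
have u0 : u != 0.
  apply/negP => /eqP E; move: lE; rewrite E /= expr0n addr0 => /esym/eqP.
  by rewrite (negbTE l0).
apply: (@hopf_torus R w1 w2 u s a b c d' p q' r' t k k1 m' n' hw u0 s2 hc) => w.
rewrite lE => wE x.
have Lu : L != 0 by rewrite gt_eqF.
have XE (z : R * R) : u.1 / (L / (2 * pi * M) ^+ 2) * z.1 + u.2 / (L / (2 * pi * M) ^+ 2) * z.2
    = - (s * det2 w1 z) * (2 * pi * M) / L.
  by rewrite /u /det2 /=; move: (2 * pi * M) piM => A A0; field; rewrite A0 Lu.
have YE (z : R * R) : - s * u.2 / (L / (2 * pi * M) ^+ 2) * z.1 +
    s * u.1 / (L / (2 * pi * M) ^+ 2) * z.2 =
    (w1.1 * z.1 + w1.2 * z.2) * (2 * pi * M) / L.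
  rewrite /u /=; move: (2 * pi * M) piM => A A0.
  rewrite [LHS](_ : _ = s ^+ 2 * ((w1.1 * z.1 + w1.2 * z.2) * A / L)); first by rewrite s2 mul1r.
  by field; rewrite A0 Lu.
rewrite XE YE; case: wE => ->.
  (* Along [w1] the curve parameter does not move, so closing means a whole number [j N] of fibre
     turns. *)
  have -> : det2 w1 w1 = 0 by rewrite /det2 mulrC subrr.
  have -> : (w1.1 * w1.1 + w1.2 * w1.2) * (2 * pi * M) / L = 2 * pi * (j * N)%N%:Z%:~R.
    by rewrite -!expr2 -/L mulrAC divff// mul1r -pmulrn natrM.
  have -> : - (s * 0) * (2 * pi * M) / L = 0%:R * elastic_T m h d.
    by rewrite mulr0 oppr0 !mul0r.
  by apply: (per 0%N (j * N)%N%:Z (j * N)%N%:Z); rewrite !mul0r addr0.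
have -> : - (s * det2 w1 w2) * (2 * pi * M) / L = j%:R * elastic_T m h d.
  by rewrite -/D sD opprK TE /X1 /M; field.
have -> : (w1.1 * w2.1 + w1.2 * w2.2) * (2 * pi * M) / L = M * Y1.
  by rewrite /Y1; field.
apply: (per j (2 * (numq r * denq q) + numq q * denq r) (2 * (numq r * denq q) - numq q * denq r)).
- rewrite PhiE thetaE /Phi /M jE /ratr !rmorphD !rmorphM /=; field.
  by rewrite dr0 dq0.
- rewrite PhiE thetaE /Phi /M jE /ratr !rmorphB !rmorphM /=; field.
  by rewrite dr0 dq0.
Qed.
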